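(* Given a set $S$ of $n\ge 2$ points in the plane, there always exist two curves $P,Q$ that partition $S$ such that $d_{dF}(P,Q)\le \varepsilon^*$, $|P|\ge |Q|$ and $|P|-|Q|\le 4$ (and, in case $n$ is odd, $|P|-|Q|\le 3$). Moreover, such curves can be found in $O(n\log n)$ time.
   Context: A (polygonal) curve is given by its finite non-empty sequence of vertices; $|P|$ denotes the number of vertices of $P$. Two curves $P,Q$ partition a finite point set $S$ if there is a partition of $S$ into two sets $A,B$ such that the vertex set of $P$ is exactly $A$, the vertex set of $Q$ is exactly $B$, and each point of $S$ is used exactly once (either in $P$ or in $Q$). A paired-walk along $P$ and $Q$ is a sequence of pairs $\pi=\{(P_i,Q_i)\}_{i=1}^k$ such that $P_1,\dots,P_k$ and $Q_1,\dots,Q_k$ partition the vertex sequences of $P$ and $Q$, respectively, in order, into disjoint non-empty contiguous subsequences, and for every $i$ either $|P_i|=1$ or $|Q_i|=1$. Its cost is $\max_i\max_{(p,q)\in P_i\times Q_i}\|p-q\|$. The discrete Fréchet distance $d_{dF}(P,Q)$ is the minimum cost of a paired-walk along $P$ and $Q$. $\varepsilon^*$ denotes the minimum of $d_{dF}(P,Q)$ over all pairs of curves $P,Q$ that partition $S$. *)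

(* Defs.v *)
From HB Require Import structures.
From mathcomp Require Import all_boot all_order all_algebra finmap.
From mathcomp Require Import all_classical all_reals all_analysis.

Set Implicit Arguments.
Unset Strict Implicit.
Unset Printing Implicit Defensive.

Import Order.TTheory GRing.Theory Num.Theory.
Import numFieldNormedType.Exports.

Local Open Scope classical_set_scope.
Local Open Scope ring_scope.

(* A curve is a non-empty sequence of points of the plane R * R. *)
Notation plane R := (R * R)%type.

Section Frechet.
Context {R : realType}.
Implicit Types (p q : plane R) (P Q : seq (plane R)) (S : {fset plane R}).

(* The library norm on R * R is the sup norm, hence this definition. *)
Definition dist p q : R :=
  Num.sqrt ((p.1 - q.1) ^+ 2 + (p.2 - q.2) ^+ 2).

Definition partition_into P Q S : Prop :=
  [/\ P != [::], Q != [::], uniq P, uniq Q &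
      exists A B : {fset plane R},
        [/\ (A `|` B)%fset = S, (A `&` B)%fset = fset0, P =i A & Q =i B]].

Definition paired_walk P Q (w : seq (seq (plane R) * seq (plane R))) : Prop :=
  [/\ flatten [seq b.1 | b <- w] = P,
      flatten [seq b.2 | b <- w] = Q &
      forall b, b \in w ->
        [/\ b.1 != [::], b.2 != [::] &
            (size b.1 == 1)%N || (size b.2 == 1)%N]].

(* Distances are nonnegative, so 0 is a neutral starting value for the max. *)
Definition walk_cost (w : seq (seq (plane R) * seq (plane R))) : R :=
  \big[Num.max/0]_(b <- w)
    \big[Num.max/0]_(p <- b.1) \big[Num.max/0]_(q <- b.2) dist p q.

(* The least element of A (junk value 0 if A has none). *)
Definition minimum (A : set R) : R := xget 0 (A `&` lbound A).

Definition dF P Q : R := minimum [set walk_cost w | w in paired_walk P Q].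

Definition eps_star S : R :=
  minimum [set dF PQ.1 PQ.2 | PQ in [set PQ | partition_into PQ.1 PQ.2 S]].

Definition balanced_pair S P Q : Prop :=
  [/\ partition_into P Q S,
      dF P Q <= eps_star S,
      (size Q <= size P)%N,
      (size P - size Q <= 4)%N &
      odd #|` S| -> (size P - size Q <= 3)%N].

End Frechet.

(* A real RAM: finitely many registers and arrays (addressed indirectly)
   holding natural numbers, and likewise for real numbers.  Real registers
   support exact arithmetic and comparison; there is no rounding, no conversion
   from reals to integers, and no multiplication of integers.  Programs do not
   depend on R, and their only real constants are natural numbers. *)

Inductive iexp :=
| ICst of nat
| IVar of nat
| IGet of nat & iexp          (* IGet a i is entry i of the integer array a *)
| IAdd of iexp & iexp
| ISub of iexp & iexp.        (* truncated *)

Inductive rexp :=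
| RCst of nat
| RVar of nat
| RGet of nat & iexp
| RAdd of rexp & rexp
| RSub of rexp & rexp
| RMul of rexp & rexp
| RDiv of rexp & rexp.        (* x / 0 = 0 *)

Inductive bexp :=
| ILe of iexp & iexp
| RLe of rexp & rexp
| BNot of bexp
| BAnd of bexp & bexp.

Inductive cmd :=
| Skip
| ISet of nat & iexp
| IPut of nat & iexp & iexp   (* IPut a i e writes e to entry i of array a *)
| RSet of nat & rexp
| RPut of nat & iexp & rexp
| Seq of cmd & cmd
| If of bexp & cmd & cmd
| While of bexp & cmd.

Section RealRAM.
Context {R : realType}.

Record state := State {
  ivar : nat -> nat;
  iarr : nat -> nat -> nat;
  rvar : nat -> R;
  rarr : nat -> nat -> R }.

Fixpoint ieval (s : state) (e : iexp) : nat :=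
  match e with
  | ICst k => k
  | IVar x => ivar s x
  | IGet a i => iarr s a (ieval s i)
  | IAdd e1 e2 => (ieval s e1 + ieval s e2)%N
  | ISub e1 e2 => (ieval s e1 - ieval s e2)%N
  end.

Fixpoint reval (s : state) (e : rexp) : R :=
  match e with
  | RCst k => k%:R
  | RVar x => rvar s x
  | RGet a i => rarr s a (ieval s i)
  | RAdd e1 e2 => reval s e1 + reval s e2
  | RSub e1 e2 => reval s e1 - reval s e2
  | RMul e1 e2 => reval s e1 * reval s e2
  | RDiv e1 e2 => reval s e1 / reval s e2
  end.

Fixpoint beval (s : state) (b : bexp) : bool :=
  match b with
  | ILe e1 e2 => (ieval s e1 <= ieval s e2)%N
  | RLe e1 e2 => reval s e1 <= reval s e2
  | BNot b1 => ~~ beval s b1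
  | BAnd b1 b2 => beval s b1 && beval s b2
  end.

Definition upd A (f : nat -> A) (i : nat) (v : A) : nat -> A :=
  fun j => if j == i then v else f j.

Definition iset s x v :=
  State (upd (ivar s) x v) (iarr s) (rvar s) (rarr s).
Definition iput s a i v :=
  State (ivar s) (upd (iarr s) a (upd (iarr s a) i v)) (rvar s) (rarr s).
Definition rset s x v :=
  State (ivar s) (iarr s) (upd (rvar s) x v) (rarr s).
Definition rput s a i v :=
  State (ivar s) (iarr s) (rvar s) (upd (rarr s) a (upd (rarr s a) i v)).

(* exec c s s' t: started in s, c halts in s' after t steps.  Assignments and
   evaluations of tests cost 1: the expressions in a fixed program have bounded
   size, so this counts elementary operations up to a constant factor. *)
Inductive exec : cmd -> state -> state -> nat -> Prop :=
| ExecSkip s : exec Skip s s 1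
| ExecISet s x e : exec (ISet x e) s (iset s x (ieval s e)) 1
| ExecIPut s a i e :
    exec (IPut a i e) s (iput s a (ieval s i) (ieval s e)) 1
| ExecRSet s x e : exec (RSet x e) s (rset s x (reval s e)) 1
| ExecRPut s a i e :
    exec (RPut a i e) s (rput s a (ieval s i) (reval s e)) 1
| ExecSeq s s1 s2 t1 t2 c1 c2 :
    exec c1 s s1 t1 -> exec c2 s1 s2 t2 -> exec (Seq c1 c2) s s2 (t1 + t2)
| ExecIf s s1 t b c1 c2 :
    exec (if beval s b then c1 else c2) s s1 t -> exec (If b c1 c2) s s1 t.+1
| ExecWhileFalse s b c : ~~ beval s b -> exec (While b c) s s 1
| ExecWhileTrue s s1 s2 t1 t2 b c :
    beval s b -> exec c s s1 t1 -> exec (While b c) s1 s2 t2 ->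
    exec (While b c) s s2 (t1 + t2).+1.

(* Input: the number of points in integer register 0, and their coordinates in
   real arrays 0 and 1; everything else is 0. *)
Definition input (l : seq (plane R)) : state :=
  State (upd (fun=> 0%N) 0 (size l))
        (fun _ _ => 0%N)
        (fun=> 0)
        (upd (upd (fun _ _ => 0) 0 (nth 0 [seq p.1 | p <- l]))
           1 (nth 0 [seq p.2 | p <- l])).

(* Output: the curve whose number of vertices is in integer register k and whose
   vertex coordinates are in real arrays x and y. *)
Definition output_curve (s : state) (k x y : nat) : seq (plane R) :=
  mkseq (fun i => (rarr s x i, rarr s y i)) (ivar s k).

End RealRAM.
Arguments state : clear implicits.

(* The program c finds, for every set of at least two points, listed in any
   order, a pair of curves related to that set by spec, within T n steps on sets
   of n points. *)
Definition finds_in_time (R : realType)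
    (spec : {fset plane R} -> seq (plane R) -> seq (plane R) -> Prop)
    (c : cmd) (T : nat -> nat) : Prop :=
  forall (S : {fset plane R}) (l : seq (plane R)),
    (2 <= #|` S|)%N -> uniq l -> l =i S ->
    exists (s : state R) (t : nat),
      [/\ exec c (input l) s t,
          (t <= T #|` S|)%N &
          spec S (output_curve s 1 2 3) (output_curve s 2 4 5)].

(* Main.v *)
(* The value eps* is the largest nearest-neighbour distance delta of a point of
   S: in a paired walk every point is matched with another one, and conversely
   a forest of stars whose edges have length at most delta and which covers S
   yields a paired walk, each star being a block with its centre on one curve
   and its leaves on the other.  Among six leaves at distance at most delta
   from a common centre, two are at distance at most delta from each other and
   can be split off as a star of their own; so at most five leaves per star are
   needed, and a star with k leaves changes |P| - |Q| by k - 1 <= 4.  Always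
   giving the leaves to the shorter curve keeps the difference at most 4.

   Exact nearest neighbours are needed only for some points.  A first divide-and-conquer pass
   finds for every point a neighbour at most sqrt 2 times too far, by treating
   each quadrant with the L1 distance, which is linear there.  If D is the
   largest of the resulting distances, then delta >= D / sqrt 2, so the points
   whose neighbour is within D / sqrt 2 are settled.  The other ones are at
   distance more than D / 2 from every point, so a second pass of the same kind can
   find their exact nearest neighbours as in the closest-pair algorithm: near
   the dividing line, each point has to be compared with a bounded number of
   them.  A greedy maximal matching in the graph of these neighbours then gives
   the star forest. *)
Require Import Defs.
From mathcomp Require Import all_boot all_order all_algebra finmap.
From mathcomp Require Import all_classical all_reals all_analysis.
From mathcomp Require Import zify ring lra.

Set Implicit Arguments.
Unset Strict Implicit.
Unset Printing Implicit Defensive.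

Import Order.TTheory GRing.Theory Num.Theory.
Import numFieldNormedType.Exports.

Local Open Scope classical_set_scope.
Local Open Scope ring_scope.

(** * Running time logic for the real RAM *)

(** The machine has neither square roots nor rounding. All lengths in the program are therefore
    squared: the factor sqrt 2 becomes 2, the [D] of the code is the square of the distance D above,
    and isolation reads [D < 4 * d2 a b]. For the same reason points cannot be hashed into a grid;
    cells occur only in the packing argument, and both passes are hooks of one bottom-up mergesort
    by ordinate on points numbered by abscissa. Finding all exact neighbours in this way would fail,
    since points may cluster along the dividing line without any bound on the number of comparisons.
    The points that can cluster are the settled ones, whose approximate neighbour is already good
    enough. The links to neighbours may form long chains; the matching cuts them. By maximality, the
    neighbour of an unmatched point is matched and can serve as its centre. Afterwards a matched
    point still without leaves joins its partner. Splitting an overfull star interferes with this,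
    since it moves a leaf away from its neighbour; what survives, and suffices, is that the
    neighbour of a leaf always has leaves of its own. *)

Ltac arith_bool b :=
  lazymatch b with
  | leq _ _ => idtac
  | Order.le _ _ => idtac
  | @eq_op _ _ _ => idtac
  | negb ?x => arith_bool x
  | andb ?x ?y => arith_bool x; arith_bool y
  | orb ?x ?y => arith_bool x; arith_bool y
  | true => idtac
  | false => idtac
  end.

Ltac clear_nonarith :=
  intros;
  repeat match goal with
  | H : ?T |- _ =>
    lazymatch T with
    | is_true ?b => tryif arith_bool b then fail else clear H
    | @eq bool ?x ?y => tryif (arith_bool x; arith_bool y) then fail else clear H
    | @eq ?A _ _ => tryif unify A nat then fail else clear H
    | _ => tryif unify T nat then fail else clear H
    end
  end.

Ltac arith := clear_nonarith; lia.

Fixpoint iregs (c : cmd) : seq nat :=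
  match c with
  | ISet x _ => [:: x]
  | Seq c1 c2 => iregs c1 ++ iregs c2
  | If _ c1 c2 => iregs c1 ++ iregs c2
  | While _ c1 => iregs c1
  | _ => [::]
  end.

Fixpoint iarrs (c : cmd) : seq nat :=
  match c with
  | IPut a _ _ => [:: a]
  | Seq c1 c2 => iarrs c1 ++ iarrs c2
  | If _ c1 c2 => iarrs c1 ++ iarrs c2
  | While _ c1 => iarrs c1
  | _ => [::]
  end.

Fixpoint rregs (c : cmd) : seq nat :=
  match c with
  | RSet x _ => [:: x]
  | Seq c1 c2 => rregs c1 ++ rregs c2
  | If _ c1 c2 => rregs c1 ++ rregs c2
  | While _ c1 => rregs c1
  | _ => [::]
  end.

Fixpoint rarrs (c : cmd) : seq nat :=
  match c with
  | RPut a _ _ => [:: a]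
  | Seq c1 c2 => rarrs c1 ++ rarrs c2
  | If _ c1 c2 => rarrs c1 ++ rarrs c2
  | While _ c1 => rarrs c1
  | _ => [::]
  end.

Fixpoint loopfree (c : cmd) : bool :=
  match c with
  | Seq c1 c2 => loopfree c1 && loopfree c2
  | If _ c1 c2 => loopfree c1 && loopfree c2
  | While _ _ => false
  | _ => true
  end.

Fixpoint cost (c : cmd) : nat :=
  match c with
  | Seq c1 c2 => (cost c1 + cost c2)%N
  | If _ c1 c2 => (maxn (cost c1) (cost c2)).+1
  | _ => 1%N
  end.

Definition For x e y c :=
  Seq (ISet x e)
    (While (ILe (IAdd (IVar x) (ICst 1)) (IVar y))
       (Seq c (ISet x (IAdd (IVar x) (ICst 1))))).

Section Logic.
Context {R : realType}.
Implicit Types (s : state R) (c : cmd) (Q : state R -> Prop).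

(** Used on [loopfree] commands only; the identity on [While] is a default value. *)
Fixpoint run c s : state R :=
  match c with
  | ISet x e => iset s x (ieval s e)
  | IPut a i e => iput s a (ieval s i) (ieval s e)
  | RSet x e => rset s x (reval s e)
  | RPut a i e => rput s a (ieval s i) (reval s e)
  | Seq c1 c2 => run c2 (run c1 s)
  | If b c1 c2 => if beval s b then run c1 s else run c2 s
  | _ => s
  end.

Definition wp c s (b : nat) Q :=
  exists s' t, [/\ exec c s s' t, (t <= b)%N & Q s'].

(** The cells that [c] may write are read off its syntax, each array counting as a whole. Loop
    invariants then have to mention only what the loop changes. *)
Definition frame c s s' :=
  [/\ forall x, x \notin iregs c -> ivar s' x = ivar s x,
      forall a, a \notin iarrs c -> iarr s' a = iarr s a,
      forall x, x \notin rregs c -> rvar s' x = rvar s x &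
      forall a, a \notin rarrs c -> rarr s' a = rarr s a].

Definition subcmd c c' :=
  [/\ {subset iregs c <= iregs c'}, {subset iarrs c <= iarrs c'},
      {subset rregs c <= rregs c'} & {subset rarrs c <= rarrs c'}].

Lemma frame_trans c s s1 s2 : frame c s s1 -> frame c s1 s2 -> frame c s s2.
Proof.
move=> [a1 b1 c1 d1] [a2 b2 c2 d2]; split=> x hx.
- by rewrite a2 // a1.
- by rewrite b2 // b1.
- by rewrite c2 // c1.
- by rewrite d2 // d1.
Qed.

Lemma frame_sub c c' s s' : subcmd c c' -> frame c s s' -> frame c' s s'.
Proof.
move=> [h1 h2 h3 h4] [a1 b1 c1 d1].
by split=> x hx; [apply: a1|apply: b1|apply: c1|apply: d1];
  apply: contra hx; auto.
Qed.

Lemma subcmd_Seql c1 c2 : subcmd c1 (Seq c1 c2).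
Proof. by split=> x /= hx; rewrite mem_cat hx. Qed.

Lemma subcmd_Seqr c1 c2 : subcmd c2 (Seq c1 c2).
Proof. by split=> x /= hx; rewrite mem_cat hx orbT. Qed.

Lemma subcmd_Ifl b c1 c2 : subcmd c1 (If b c1 c2).
Proof. by split=> x /= hx; rewrite mem_cat hx. Qed.

Lemma subcmd_Ifr b c1 c2 : subcmd c2 (If b c1 c2).
Proof. by split=> x /= hx; rewrite mem_cat hx orbT. Qed.

Lemma exec_frame c s s' t : exec c s s' t -> frame c s s'.
Proof.
elim=> {c s s' t} //=.
- move=> s x e; split=> //= y; rewrite inE => /negbTE hy.
  by rewrite /upd hy.
- move=> s a i e; split=> //= y; rewrite inE => /negbTE hy.
  by rewrite /upd hy.
- move=> s x e; split=> //= y; rewrite inE => /negbTE hy.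
  by rewrite /upd hy.
- move=> s a i e; split=> //= y; rewrite inE => /negbTE hy.
  by rewrite /upd hy.
- move=> s s1 s2 t1 t2 c1 c2 _ h1 _ h2.
  apply: frame_trans (frame_sub (subcmd_Seql _ _) h1)
                     (frame_sub (subcmd_Seqr _ _) h2).
- move=> s s1 t b c1 c2 _; case: (beval s b) => h1.
    exact: frame_sub (subcmd_Ifl _ _ _) h1.
  exact: frame_sub (subcmd_Ifr _ _ _) h1.
- by move=> s s1 s2 t1 t2 b c1 _ _ h1 _; apply: frame_trans.
Qed.

Lemma exec_run c s : loopfree c -> exists2 t, exec c s (run c s) t & (t <= cost c)%N.
Proof.
elim: c s => //=; try by move=> *; exists 1%N => //; constructor.
- move=> c1 h1 c2 h2 s /andP[/(h1 s)[t1 e1 l1] /(h2 (run c1 s))[t2 e2 l2]].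
  by exists (t1 + t2)%N; [apply: ExecSeq e1 e2|apply: leq_add].
- move=> b c1 h1 c2 h2 s /andP[/(h1 s)[t1 e1 l1] /(h2 s)[t2 e2 l2]].
  case E: (beval s b).
    exists t1.+1; first by apply: ExecIf; rewrite E.
    by rewrite ltnS (leq_trans l1) ?leq_maxl.
  exists t2.+1; first by apply: ExecIf; rewrite E.
  by rewrite ltnS (leq_trans l2) ?leq_maxr.
Qed.

Lemma frame_run c s : loopfree c -> frame c s (run c s).
Proof. by move=> /(exec_run s)[t /exec_frame]. Qed.

Lemma wp_frame c s b Q : wp c s b (fun s' => frame c s s' -> Q s') -> wp c s b Q.
Proof.
move=> [s' [t [h1 h2 h3]]]; exists s', t; split=> //.
by apply: h3; apply: exec_frame h1.
Qed.

Lemma wp_mono c s b b' (Q Q' : state R -> Prop) :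
  wp c s b Q -> (b <= b')%N -> (forall s', Q s' -> Q' s') -> wp c s b' Q'.
Proof.
move=> [s' [t [h1 h2 h3]]] hb hQ; exists s', t; split=> //.
  exact: leq_trans hb.
exact: hQ.
Qed.

Lemma wp_seq c1 c2 s b1 b2 Q :
  wp c1 s b1 (fun s1 => wp c2 s1 b2 Q) -> wp (Seq c1 c2) s (b1 + b2) Q.
Proof.
move=> [s1 [t1 [e1 l1 [s2 [t2 [e2 l2 q]]]]]].
exists s2, (t1 + t2)%N; split=> //; first exact: ExecSeq e1 e2.
exact: leq_add.
Qed.

Lemma wp_seq_le b1 b2 b c1 c2 s Q : (b1 + b2 <= b)%N ->
  wp c1 s b1 (fun s1 => wp c2 s1 b2 Q) -> wp (Seq c1 c2) s b Q.
Proof. by move=> hb /wp_seq h; apply: wp_mono h hb _. Qed.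

Lemma wp_if b c1 c2 s k Q :
  (beval s b -> wp c1 s k Q) -> (~~ beval s b -> wp c2 s k Q) ->
  wp (If b c1 c2) s k.+1 Q.
Proof.
move=> h1 h2.
have [s' [t [e l q]]] : wp (if beval s b then c1 else c2) s k Q.
  by case: ifPn => hb; [apply: h1|apply: h2].
by exists s', t.+1; split=> //; apply: ExecIf.
Qed.

Lemma wp_run c s b Q :
  loopfree c -> (cost c <= b)%N -> Q (run c s) -> wp c s b Q.
Proof.
move=> /(exec_run s) [t e l] hb q; exists (run c s), t; split=> //.
exact: leq_trans hb.
Qed.

(* The first argument of J is the time that remains. *)
Lemma wp_while b c s f (J : nat -> state R -> Prop) Q :
  (forall s' g, frame (While b c) s s' -> J g s' ->
     if beval s' b then
       exists f1 f2, (f1 + f2 < g)%N /\ wp c s' f1 (J f2)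
     else (0 < g)%N /\ Q s') ->
  J f s -> wp (While b c) s f Q.
Proof.
move=> hstep.
suff: forall s', frame (While b c) s s' -> J f s' -> wp (While b c) s' f Q.
  by move=> h; apply: h.
have [n] := ubnP f; elim: n f => // n IH f lefn s' hfr hJ.
have := hstep _ _ hfr hJ; case: ifPn => hb; last first.
  by case=> f0 q; exists s', 1%N; split=> //; apply: ExecWhileFalse.
case=> f1 [f2 [lf [s1 [t1 [e1 l1 J1]]]]].
have [||s2 [t2 [e2 l2 q]]] := IH f2 _ s1 _ J1.
- by lia.
- by apply: (frame_trans hfr); have [] := exec_frame e1.
- exists s2, (t1 + t2).+1; split=> //; first exact: ExecWhileTrue e1 e2.
  by lia.
Qed.

(** An iteration costs its body, the increment and a test, hence [B.+2]; the final 2 pays for the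
    initial assignment and the failing test. The body may rely on the frame of the whole loop,
    counted from the initial state. *)
Lemma wp_for (x : nat) e (y : nat) c s B (I : nat -> state R -> Prop) Q :
  x != y -> x \notin iregs c -> y \notin iregs c ->
  (ieval s e <= ivar s y)%N ->
  I (ieval s e) (iset s x (ieval s e)) ->
  (forall i s', (ieval s e <= i < ivar s y)%N -> frame (For x e y c) s s' ->
     ivar s' x = i -> ivar s' y = ivar s y -> I i s' ->
     wp c s' B (fun s'' => frame (For x e y c) s s'' ->
                           I i.+1 (iset s'' x i.+1))) ->
  (forall s', frame (For x e y c) s s' -> ivar s' x = ivar s y ->
     I (ivar s y) s' -> Q s') ->
  wp (For x e y c) s ((ivar s y - ieval s e) * B.+2 + 2) Q.
Proof.
move=> xy xc yc le_aN I0 Istep IQ.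
set a := ieval s e; set N := ivar s y.
rewrite (_ : (_ + 2)%N = 1 + ((N - a) * B.+2 + 1))%N; last by lia.
apply: wp_seq; apply: wp_run => //=.
set s0 := iset s x _; rewrite -/a in s0 *.
have fr0 : frame (For x e y c) s s0.
  apply: frame_sub (subcmd_Seql _ _) _.
  by split=> //= z; rewrite inE => /negbTE hz; rewrite /upd hz.
pose J g s' := exists2 i, (a <= i <= N)%N &
  [/\ g = ((N - i) * B.+2 + 1)%N, ivar s' x = i, ivar s' y = N & I i s'].
apply: (@wp_while _ _ _ _ J); last first.
  exists a; first by rewrite leqnn.
  split=> //; first by rewrite /= /upd eqxx.
  by rewrite /= /upd eq_sym (negbTE xy).
move=> s' g fr [i /andP[ai iN] [-> hx hy hI]] /=.
have frs' : frame (For x e y c) s s'.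
  by apply: frame_trans fr0 _; rewrite /For; apply: frame_sub (subcmd_Seqr _ _) fr.
rewrite hx hy addn1; case: ifPn => iN'.
  exists (B + 1)%N, ((N - i.+1) * B.+2 + 1)%N; split.
    by rewrite (_ : (N - i) = (N - i.+1).+1)%N; [rewrite mulSn; lia|lia].
  apply: wp_seq.
  have hi : (ieval s e <= i < ivar s y)%N by rewrite ai.
  have [s1 [t1 [e1 l1 I1]]] := Istep i s' hi frs' hx hy hI.
  have fr1 := exec_frame e1.
  exists s1, t1; split=> //.
  apply: wp_run => //=.
  have [/(_ _ xc) h1 _ _ _] := fr1.
  have [/(_ _ yc) h2 _ _ _] := fr1.
  rewrite h1 hx (addn1 i).
  exists i.+1; first by rewrite iN' andbT; lia.
  split=> //=.
  - by rewrite /upd eqxx.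
  - by rewrite /upd eq_sym (negbTE xy) h2.
  - apply: I1.
    apply: frame_trans frs' _; rewrite /For; apply: frame_sub (subcmd_Seqr _ _) _.
    by apply: frame_sub fr1; split=> z /= hz; rewrite mem_cat hz.
split; first by rewrite addn1.
have h : i = N by apply/eqP; rewrite eqn_leq iN leqNgt.
by move: hI hx; rewrite h => hI hx; apply: IQ.
Qed.

End Logic.

(** * Plane geometry *)

Section Geometry.
Context {R : realType}.
Implicit Types (p q c : plane R) (P Q : seq (plane R)) (S : {fset plane R}).

Definition dist2 p q : R := (p.1 - q.1) ^+ 2 + (p.2 - q.2) ^+ 2.

Lemma dist2_ge0 p q : 0 <= dist2 p q.
Proof. by rewrite addr_ge0 // sqr_ge0. Qed.

Lemma dist2C p q : dist2 p q = dist2 q p.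
Proof. by rewrite /dist2 -opprB sqrrN -[p.2 - _]opprB sqrrN. Qed.

Lemma dist2_gt0 p q : p != q -> 0 < dist2 p q.
Proof.
move=> pq; rewrite lt_neqAle dist2_ge0 andbT eq_sym paddr_eq0 ?sqr_ge0 //.
rewrite !sqrf_eq0 !subr_eq0; apply: contra pq => /andP[/eqP h1 /eqP h2].
by rewrite [p]surjective_pairing [q]surjective_pairing h1 h2.
Qed.

(** The squared length of a u + b v for unit vectors u and v at an angle of 60 degrees. In these
    coordinates six sectors of 60 degrees are cut out by the signs of a, b and a + b alone. *)
Let hexnorm (a b : R) := a ^+ 2 + a * b + b ^+ 2.

(** Two vectors of one sector differ by no more than the longer of them. If both coordinates of the
    difference have the same sign, monotonicity of [hexnorm] for nonnegative coordinates suffices;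
    otherwise p ^ 2 - p q + q ^ 2 is at most the larger of the two squares. *)
Lemma hexnorm_cone (a b a' b' : R) : 0 <= a -> 0 <= b -> 0 <= a' -> 0 <= b' ->
  hexnorm (a - a') (b - b') <= hexnorm a b \/
  hexnorm (a - a') (b - b') <= hexnorm a' b'.
Proof.
rewrite /hexnorm => a0 b0 a0' b0'.
have [la|la] := leP a a'; have [lb|lb] := leP b b'.
- by right; nra.
- have [l|l] := leP (a' - a) (b - b'); [left|right]; nra.
- have [l|l] := leP (a - a') (b' - b); [right|left]; nra.
- by left; nra.
Qed.

(** Six vectors in six sectors leave no room for a plain pigeonhole argument. But vector 0 lies in
    two closed sectors: either another vector is in one of these, or the other five share four
    sectors. *)
Lemma hexnorm_six (a b : nat -> R) : 0 < a 0%N -> b 0%N = 0 ->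
  exists i j, [/\ (i < j)%N, (j < 6)%N &
    hexnorm (a i - a j) (b i - b j) <= hexnorm (a i) (b i) \/
    hexnorm (a i - a j) (b i - b j) <= hexnorm (a j) (b j)].
Proof.
move=> a0 b0.
pose cone k i := match k with
  | 0%N => (0 <= a i) && (0 <= b i)
  | 1%N => (0 <= a i + b i) && (a i <= 0)
  | 2%N => (0 <= b i) && (a i + b i <= 0)
  | 3%N => (a i <= 0) && (b i <= 0)
  | 4%N => (a i + b i <= 0) && (0 <= a i)
  | _ => (b i <= 0) && (0 <= a i + b i)
  end.
have same k i j : cone k i -> cone k j ->
    hexnorm (a i - a j) (b i - b j) <= hexnorm (a i) (b i) \/
    hexnorm (a i - a j) (b i - b j) <= hexnorm (a j) (b j).
  case: k => [|[|[|[|[|k]]]]] /= /andP[h1 h2] /andP[h3 h4].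
  - exact: hexnorm_cone.
  (* This and the following cases rotate the sector onto the first one by a multiple of 60 degrees;
     the rotation is a linear substitution that preserves [hexnorm]. *)
  - have := @hexnorm_cone (a i + b i) (- a i) (a j + b j) (- a j).
    rewrite !oppr_ge0 => /(_ h1 h2 h3 h4); rewrite /hexnorm.
    by case=> h; [left|right]; move: h; congr (_ <= _); ring.
  - have := @hexnorm_cone (b i) (- (a i + b i)) (b j) (- (a j + b j)).
    rewrite !oppr_ge0 => /(_ h1 h2 h3 h4); rewrite /hexnorm.
    by case=> h; [left|right]; move: h; congr (_ <= _); ring.
  - have := @hexnorm_cone (- a i) (- b i) (- a j) (- b j).
    rewrite !oppr_ge0 => /(_ h1 h2 h3 h4); rewrite /hexnorm.
    by case=> h; [left|right]; move: h; congr (_ <= _); ring.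
  - have := @hexnorm_cone (- (a i + b i)) (a i) (- (a j + b j)) (a j).
    rewrite !oppr_ge0 => /(_ h1 h2 h3 h4); rewrite /hexnorm.
    by case=> h; [left|right]; move: h; congr (_ <= _); ring.
  - have := @hexnorm_cone (- b i) (a i + b i) (- b j) (a j + b j).
    rewrite !oppr_ge0 => /(_ h1 h2 h3 h4); rewrite /hexnorm.
    by case=> h; [left|right]; move: h; congr (_ <= _); ring.
have cover i : exists k : 'I_6, cone k i.
  have [h1|h1] := leP 0 (a i); have [h2|h2] := leP 0 (b i);
    have [h3|h3] := leP 0 (a i + b i).
  - by exists (@Ordinal 6 0 isT); rewrite /= h1 h2.
  - by exists (@Ordinal 6 0 isT); rewrite /= h1 h2.
  - by exists (@Ordinal 6 5 isT); rewrite /= h3 ltW.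
  - by exists (@Ordinal 6 4 isT); rewrite /= h1 ltW.
  - by exists (@Ordinal 6 1 isT); rewrite /= h3 ltW.
  - by exists (@Ordinal 6 2 isT); rewrite /= h2 ltW.
  - by exists (@Ordinal 6 3 isT); rewrite /= !ltW.
  - by exists (@Ordinal 6 3 isT); rewrite /= !ltW.
pose cls i := xchoose (cover i).
have clsP i : cone (cls i) i := xchooseP (cover i).
(* The point with index 0 lies on the common boundary of cones 0 and 5. *)
have c00 : cone 0%N 0%N by rewrite /= b0 lexx ltW.
have c50 : cone 5%N 0%N by rewrite /= b0 lexx addr0 ltW.
have [[i i6]|hcls] := pselect (exists i : 'I_5, (cls i.+1 == 0 :> nat)%N || (cls i.+1 == 5 :> nat)%N).
  exists 0%N, i.+1; split=> //; first by rewrite ltnS.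
  have := clsP i.+1.
  by case/orP: i6 => /eqP ->; apply: same.
have lt4 (i : 'I_5) : ((cls i.+1).-1 < 4)%N.
  have : ~~ ((cls i.+1 == 0 :> nat)%N || (cls i.+1 == 5 :> nat)%N).
    by apply/negP => h; apply: hcls; exists i.
  by have := ltn_ord (cls i.+1); move: (nat_of_ord (cls i.+1)) => k; lia.
pose f i := Ordinal (lt4 i).
have /injectivePn [i [j ij fij]] : ~~ injectiveb f.
  apply/negP => /injectiveP /leq_card; by rewrite !card_ord.
have pos (i' : 'I_5) : (0 < cls i'.+1)%N.
  by rewrite lt0n; apply/eqP => h; apply: hcls; exists i'; rewrite h.
have eqc : cls i.+1 = cls j.+1 :> nat.
  have := congr1 val fij => /= h.
  by rewrite -(prednK (pos i)) -(prednK (pos j)) h.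
wlog lij : i j ij fij eqc / (i < j)%N.
  move=> H; case: (ltngtP i j) => [l|l|/val_inj e].
  - exact: H l.
  - by apply: H l => //; rewrite eq_sym.
  - by rewrite e eqxx in ij.
exists i.+1, j.+1; split; rewrite ?ltnS //; first by have := ltn_ord j; lia.
by apply: (same (cls i.+1)); [exact: clsP|rewrite eqc; exact: clsP].
Qed.

(* The coordinates below are taken in the basis of the triangular lattice whose
   first vector points from c to u 0. *)
Lemma six_points_close c (u : nat -> plane R) :
  exists i j, [/\ (i < j)%N, (j < 6)%N &
    dist2 (u i) (u j) <= dist2 (u i) c \/ dist2 (u i) (u j) <= dist2 (u j) c].
Proof.
have [e|e] := eqVneq (u 0%N) c.
  by exists 0%N, 1%N; split=> //; right; rewrite dist2C e.
pose n := dist2 (u 0%N) c.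
have n0 : 0 < n := dist2_gt0 e.
(* Inner and cross products with u 0 - c are Cartesian coordinates along that direction, scaled by
   its length. Squared distances get multiplied by [n], which is cancelled at the end. *)
pose a i := ((u i).1 - c.1) * ((u 0%N).1 - c.1) + ((u i).2 - c.2) * ((u 0%N).2 - c.2).
pose b i := ((u 0%N).1 - c.1) * ((u i).2 - c.2) - ((u 0%N).2 - c.2) * ((u i).1 - c.1).
pose r : R := Num.sqrt 3.
have r2 : r^-1 ^+ 2 = 3^-1 by rewrite exprVn sqr_sqrtr.
have hexE x y : hexnorm (x - y / r) (2 * y / r) = x ^+ 2 + y ^+ 2.
  rewrite /hexnorm; move: r2; move: r^-1 => t r2.
  have -> : y ^+ 2 = 3 * t ^+ 2 * y ^+ 2 by rewrite r2; field.
  by ring.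
have a0 : a 0%N = n by rewrite /a /n /dist2; ring.
have b0 : b 0%N = 0 by rewrite /b; ring.
have [||i [j [ij j6 h]]] :=
  @hexnorm_six (fun i => a i - b i / r) (fun i => 2 * b i / r).
- by rewrite b0 mul0r subr0 a0.
- by rewrite b0 mulr0 mul0r.
exists i, j; split=> //; move: h.
rewrite (_ : hexnorm (_ - (_ - _)) _ =
  hexnorm ((a i - a j) - (b i - b j) / r) (2 * (b i - b j) / r)); last first.
  by rewrite /hexnorm; ring.
rewrite !hexE.
have -> : (a i - a j) ^+ 2 + (b i - b j) ^+ 2 = n * dist2 (u i) (u j).
  by rewrite /a /b /n /dist2; ring.
have E k : a k ^+ 2 + b k ^+ 2 = n * dist2 (u k) c.
  by rewrite /a /b /n /dist2; ring.
by rewrite !E !ler_pM2l.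
Qed.

(** * Packing well-separated points into a square *)

Lemma same_cell (x y D : R) : 0 < D ->
  Num.floor (3 * x / D) = Num.floor (3 * y / D) -> 9 * (x - y) ^+ 2 < D ^+ 2.
Proof.
move=> D0 e.
have /andP[h1 h2] := floor_itv (3 * x / D).
have /andP[h3 h4] := floor_itv (3 * y / D).
rewrite e in h1 h2.
have h : `|3 * x / D - 3 * y / D| < 1.
  rewrite intrD in h2 h4.
  by rewrite ltr_norml; apply/andP; split; lra.
have -> : 9 * (x - y) ^+ 2 = `|3 * x / D - 3 * y / D| ^+ 2 * D ^+ 2.
  rewrite real_normK ?num_real //; field.
  by rewrite gt_eqF.
rewrite gtr_pMl ?exprn_gt0 //.
by rewrite expr_lt1.
Qed.

(** The value 3 occurs only for x = D: the closed interval is what costs a seventh cell per side. *)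
Lemma floor_bound (x D : R) : 0 < D -> x ^+ 2 <= D ^+ 2 ->
  (-3 <= Num.floor (3 * x / D) <= 3)%R.
Proof.
move=> D0 h.
have [h3 h4] : - D <= x /\ x <= D by split; nra.
have /andP[h1 h2] := floor_itv (3 * x / D).
have h5 : -3 <= 3 * x / D by rewrite ler_pdivlMr //; lra.
have h6 : 3 * x / D <= 3 by rewrite ler_pdivrMr //; lra.
have l1 : ((-3)%:~R : R) < (Num.floor (3 * x / D) + 1)%:~R.
  exact: le_lt_trans h2.
have l2 : (Num.floor (3 * x / D))%:~R <= (3%:~R : R) by exact: le_trans h6.
move: l1 l2; rewrite ltr_int ler_int; lia.
Qed.

(* A square of side 2 sqrt D2 consists of 49 cells, each too small for two of
   the points. *)
Lemma packing (D2 xm ym : R) (p : nat -> plane R) : 0 < D2 ->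
  (forall i, (i < 50)%N -> ((p i).1 - xm) ^+ 2 <= D2) ->
  (forall i, (i < 50)%N -> ((p i).2 - ym) ^+ 2 <= D2) ->
  exists i j, [/\ (i < j)%N, (j < 50)%N & 4 * dist2 (p i) (p j) < D2].
Proof.
move=> D0 hx hy; pose D := Num.sqrt D2.
have DD : D ^+ 2 = D2 by rewrite sqr_sqrtr // ltW.
have Dp : 0 < D by rewrite sqrtr_gt0.
pose f i := (Num.floor (3 * ((p i).1 - xm) / D), Num.floor (3 * ((p i).2 - ym) / D)).
have lt7 (z : int) : (-3 <= z <= 3)%R -> (absz (z + 3)%R < 7)%N by lia.
have eqz (z z' : int) : (-3 <= z <= 3)%R -> (-3 <= z' <= 3)%R ->
  absz (z + 3)%R = absz (z' + 3)%R -> z = z' by lia.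
have f1 (i : 'I_50) : (-3 <= (f i).1 <= 3)%R by apply: floor_bound => //; rewrite DD hx.
have f2 (i : 'I_50) : (-3 <= (f i).2 <= 3)%R by apply: floor_bound => //; rewrite DD hy.
pose g i := (Ordinal (lt7 _ (f1 i)), Ordinal (lt7 _ (f2 i))).
have /injectivePn [i [j ij gij]] : ~~ injectiveb g.
  by apply/negP => /injectiveP /leq_card; rewrite card_prod !card_ord.
wlog lij : i j ij gij / (i < j)%N.
  move=> H; case: (ltngtP i j) => [l|l|/val_inj e].
  - exact: H l.
  - by apply: H l => //; rewrite eq_sym.
  - by rewrite e eqxx in ij.
exists i, j; split=> //.
have e1 : (f i).1 = (f j).1.
  by apply: eqz (f1 i) (f1 j) _; have := congr1 (fun z => val z.1) gij.
have e2 : (f i).2 = (f j).2.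
  by apply: eqz (f2 i) (f2 j) _; have := congr1 (fun z => val z.2) gij.
have := same_cell Dp e1; have := same_cell Dp e2; rewrite DD /dist2.
have -> : (p i).1 - xm - ((p j).1 - xm) = (p i).1 - (p j).1 by ring.
have -> : (p i).2 - ym - ((p j).2 - ym) = (p i).2 - (p j).2 by ring.
(* Each coordinate contributes less than D2 / 9, and 4 * (2 / 9) < 1. *)
lra.
Qed.

End Geometry.

(** * Paired walks and the discrete Frechet distance *)

Section Frechet.
Context {R : realType}.
Implicit Types (p q : plane R) (P Q : seq (plane R)) (S : {fset plane R})
  (w : seq (seq (plane R) * seq (plane R))).

(** If [A] has no least element, [minimum A] is 0, which is below [a] by nonnegativity. *)
Lemma minimum_le (A : set R) a : (forall x, A x -> 0 <= x) -> A a -> minimum A <= a.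
Proof.
move=> A0 Aa; rewrite /minimum; case: xgetP => [x _ [_]|_]; first exact.
exact: A0.
Qed.

(** Containment in a list makes [A] finite, so that the minimum is attained. *)
Lemma minimum_mem (A : set R) (l : seq R) a :
  A a -> (forall x, A x -> x \in l) -> A (minimum A).
Proof.
move=> Aa Al; pose B := [seq x <- l | `[< A x >]].
have inB x : A x -> x \in B by move=> h; rewrite mem_filter Al // asboolT.
have Ba := inB _ Aa.
pose i0 := Ordinal (etrans (index_mem a B) Ba : (index a B < size B)%N).
case: (@arg_minP _ R _ i0 predT (fun i : 'I_(size B) => B`_i)) => // i _ hi.
have Ai : A B`_i.
  by have := mem_nth 0 (ltn_ord i); rewrite mem_filter => /andP[/asboolP].
rewrite /minimum; case: xgetP => [x _ [] //|/(_ B`_i) []]; split=> // x /inB Bx.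
have hx : (index x B < size B)%N by rewrite index_mem.
by have := hi (Ordinal hx) isT; rewrite /= nth_index.
Qed.

Lemma distE p q : dist p q = Num.sqrt (dist2 p q). Proof. by []. Qed.

Lemma distC p q : dist p q = dist q p.
Proof. by rewrite !distE dist2C. Qed.

Lemma walk_cost_ge0 w : 0 <= walk_cost w.
Proof. exact: bigmax_ge_id. Qed.

Lemma dist_le_walk_cost w b p q :
  b \in w -> p \in b.1 -> q \in b.2 -> dist p q <= walk_cost w.
Proof.
move=> bw pb qb; rewrite /walk_cost.
apply: le_trans (@le_bigmax_seq _ _ _ _ 0 b predT _ bw isT).
apply: le_trans (@le_bigmax_seq _ _ _ _ 0 p predT _ pb isT).
exact: (@le_bigmax_seq _ _ _ _ 0 q predT _ qb isT).
Qed.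

Lemma walk_cost_le w (m : R) : 0 <= m ->
  (forall b p q, b \in w -> p \in b.1 -> q \in b.2 -> dist p q <= m) ->
  walk_cost w <= m.
Proof.
move=> m0 h; rewrite /walk_cost big_seq; apply: bigmax_le => // b bw.
rewrite big_seq; apply: bigmax_le => // p pb.
by rewrite big_seq; apply: bigmax_le => // q qb; apply: h bw pb qb.
Qed.

Lemma bigmax_mem (T : eqType) (s : seq T) (F : T -> R) (l : seq R) :
  0 \in l -> (forall x, x \in s -> F x \in l) ->
  \big[Num.max/0]_(x <- s) F x \in l.
Proof.
move=> l0 lF; rewrite big_seq; elim/big_ind: _ => // x y lx ly.
by rewrite /Num.max; case: ifP.
Qed.

(** All possible values of a walk cost, 0 being the start value of the maximum. Their finiteness is
    what makes the minima in [dF] and [eps_star] exist. *)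
Definition distances P Q := 0 :: [seq dist p q | p <- P, q <- Q].

Lemma walk_cost_mem w P Q :
  (forall b, b \in w -> {subset b.1 <= P} /\ {subset b.2 <= Q}) ->
  walk_cost w \in distances P Q.
Proof.
move=> h; apply: bigmax_mem => [|b bw]; first exact: mem_head.
have [h1 h2] := h _ bw.
apply: bigmax_mem => [|p pb]; first exact: mem_head.
apply: bigmax_mem => [|q qb]; first exact: mem_head.
by rewrite inE; apply/orP; right; apply: allpairs_f; [apply: h1|apply: h2].
Qed.

Lemma paired_walk_sub P Q w b : paired_walk P Q w -> b \in w ->
  {subset b.1 <= P} /\ {subset b.2 <= Q}.
Proof.
move=> [<- <- _] bw; split=> x xb; apply/flatten_mapP.
  by exists b.
by exists b.
Qed.

(** Heads are paired off until one curve has a single vertex left, which takes the rest of the other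
    curve. *)
Lemma paired_walk_exists P Q : P != [::] -> Q != [::] ->
  exists w, paired_walk P Q w.
Proof.
elim: P Q => // p [_|p' P IH] [//|q Q] _ _.
  exists [:: ([:: p], q :: Q)]; split=> //=; first by rewrite cats0.
  by move=> b; rewrite inE => /eqP ->.
case: Q => [|q' Q].
  exists [:: (p :: p' :: P, [:: q])]; split=> //=; first by rewrite cats0.
  by move=> b; rewrite inE => /eqP ->.
have [//|//|w [h1 h2 h3]] := IH (q' :: Q).
exists (([:: p], [:: q]) :: w); split; rewrite /= ?h1 ?h2 //.
by move=> b; rewrite inE => /orP[/eqP ->//|]; apply: h3.
Qed.

Lemma dF_le P Q w : paired_walk P Q w -> dF P Q <= walk_cost w.
Proof.
move=> h; apply: minimum_le; last by exists w.
by move=> _ [w' _ <-]; apply: walk_cost_ge0.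
Qed.

Lemma dF_walk P Q : P != [::] -> Q != [::] ->
  exists2 w, paired_walk P Q w & walk_cost w = dF P Q.
Proof.
move=> P0 Q0; have [w hw] := paired_walk_exists P0 Q0.
have [|_ [w' hw' <-]|w' ? ?] := @minimum_mem
    [set walk_cost w | w in paired_walk P Q] (distances P Q) (walk_cost w).
- by exists w.
- by apply: walk_cost_mem => b; apply: paired_walk_sub.
- by exists w'.
Qed.

(* In a paired walk, every vertex is matched with a vertex of the other curve,
   hence with a different point of S. *)
Lemma eps_star_ge S (m : R) a P Q : partition_into P Q S -> a \in S ->
  (forall b, b \in S -> b != a -> m <= dist a b) -> m <= eps_star S.
Proof.
move=> hPQ aS ha; pose V := enum_fset S.
have sub P' Q' : partition_into P' Q' S -> {subset P' <= S} /\ {subset Q' <= S}.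
  move=> [_ _ _ _ [A [B [<- _ hA hB]]]].
  by split=> x; rewrite ?hA ?hB inE => ->; rewrite ?orbT.
have [[P' Q']] : [set dF PQ.1 PQ.2 | PQ in
    [set PQ | partition_into PQ.1 PQ.2 S]] (eps_star S).
  apply: (@minimum_mem _ (distances V V) (dF P Q)); first by exists (P, Q).
  move=> _ [[P' Q'] /= hp <-].
  have [sP sQ] := sub _ _ hp; case: hp => P0 Q0 _ _ _.
  have [w hw <-] := dF_walk P0 Q0; apply: walk_cost_mem => b.
  move=> /(paired_walk_sub hw)[h1 h2]; split=> x ?.
    by apply: sP; apply: h1.
  by apply: sQ; apply: h2.
move=> /= hp <-; have [sP sQ] := sub _ _ hp.
case: hp => P0 Q0 _ _ [A [B [AB dAB hA hB]]].
have [w hw <-] := dF_walk P0 Q0; case: hw => wP wQ wb.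
have neq p q : p \in P' -> q \in Q' -> q != p.
  rewrite hA hB => pA qB; apply/eqP => e.
  have : p \in (A `&` B)%fset by rewrite inE pA -e qB.
  by rewrite dAB.
have := aS; rewrite -AB inE -hA -hB => /orP[].
  move=> aP; have := aP; rewrite -wP => /flatten_mapP[b bw ab].
  have [_ b2 _] := wb _ bw.
  case E: b.2 b2 => [//|q l] _.
  have qb : q \in b.2 by rewrite E mem_head.
  have qQ : q \in Q' by rewrite -wQ; apply/flatten_mapP; exists b.
  apply: le_trans (dist_le_walk_cost bw ab qb).
  by apply: ha; [apply: sQ|apply: neq].
move=> aQ; have := aQ; rewrite -wQ => /flatten_mapP[b bw ab].
have [b1 _ _] := wb _ bw.
case E: b.1 b1 => [//|q l] _.
have qb : q \in b.1 by rewrite E mem_head.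
have qP : q \in P' by rewrite -wP; apply/flatten_mapP; exists b.
apply: le_trans (dist_le_walk_cost bw qb ab).
by rewrite distC; apply: ha; [apply: sP|rewrite eq_sym; apply: neq].
Qed.

(** The walk bounds [dF P Q] above by the square root of [m]; the point [a], all of whose distances
    are at least that root, bounds [eps_star S] below by it. *)
Lemma balanced_pair_of_walk S P Q w (m : R) a :
  paired_walk P Q w -> P != [::] -> uniq (P ++ Q) -> P ++ Q =i S ->
  (forall b p q, b \in w -> p \in b.1 -> q \in b.2 -> dist2 p q <= m) ->
  a \in S -> (forall b, b \in S -> b != a -> m <= dist2 a b) ->
  (size Q <= size P)%N -> (size P <= size Q + 4)%N ->
  balanced_pair S P Q.
Proof.
move=> hw P0 uPQ ePQ hm aS ha s1 s2.
have Q0 : Q != [::].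
  case: (hw) => wP wQ wb; apply: contra P0 => /eqP Q0.
  case: (w) wP wQ wb => [<- //|[b1 b2] w' _ /= wQ /(_ _ (mem_head _ _))[_ /= b20 _]].
  by move: wQ; rewrite Q0; case: b2 b20.
have hp : partition_into P Q S.
  move: uPQ; rewrite cat_uniq => /and3P[uP dPQ uQ]; split=> //.
  exists [fset x in P]%fset, [fset x in Q]%fset; split.
  - by apply/fsetP => x; rewrite -ePQ !inE mem_cat.
  - apply/fsetP => x; rewrite !inE; apply/negbTE/negP => /andP[xP xQ].
    by case/hasP: dPQ; exists x.
  - by move=> x; rewrite !inE.
  - by move=> x; rewrite !inE.
have hd : dF P Q <= eps_star S.
  apply: (@le_trans _ _ (Num.sqrt m)).
    apply: le_trans (dF_le hw) _; apply: walk_cost_le; first exact: sqrtr_ge0.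
    by move=> b p q bw pb qb; rewrite distE ler_wsqrtr // (hm b).
  apply: (eps_star_ge hp aS) => b bS ba.
  by rewrite distE ler_wsqrtr // ha.
split=> //; first by lia.
have -> : #|` S| = (size P + size Q)%N.
  rewrite -size_cat; apply/eqP; rewrite eq_sym; apply/eqP/perm_size.
  by apply: uniq_perm => //; apply: fset_uniq.
(* The difference of the sizes has the parity of their sum, so for an odd number of points it cannot
   be 4. *)
rewrite oddD => h.
have : odd (size P - size Q) by rewrite oddB.
have : (size P - size Q <= 4)%N by lia.
by case: (size P - size Q)%N => [|[|[|[|[|]]]]].
Qed.

End Frechet.

(** * Mergesort with a hook after each merge *)

Local Notation "c1 ;; c2" := (Seq c1 c2) (at level 85, right associativity).

Definition ilt e1 e2 := ILe (IAdd e1 (ICst 1)) e2.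
Definition incr x := ISet x (IAdd (IVar x) (ICst 1)).
Definition imin x e1 e2 := If (ILe e1 e2) (ISet x e1) (ISet x e2).

(* Integer registers: 0 is the number n of points, 3 the block width, 4, 5 and 6
   the start, middle and end of the block being merged.  Integer array 0 is the
   permutation being sorted, array 1 receives the merged blocks. *)
Definition merge_step key :=
  If (BAnd (ilt (IVar 7) (IVar 5))
        (BNot (BAnd (ilt (IVar 8) (IVar 6))
           (BNot (RLe (RGet key (IGet 0 (IVar 7))) (RGet key (IGet 0 (IVar 8))))))))
    (IPut 1 (IVar 9) (IGet 0 (IVar 7)) ;; incr 7)
    (IPut 1 (IVar 9) (IGet 0 (IVar 8)) ;; incr 8).

Definition merge_init :=
  imin 5 (IAdd (IVar 4) (IVar 3)) (IVar 0) ;;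
  imin 6 (IAdd (IVar 5) (IVar 3)) (IVar 0) ;;
  ISet 7 (IVar 4) ;;
  ISet 8 (IVar 5).

Definition merge_blocks key := merge_init ;; For 9 (IVar 4) 6 (merge_step key).

Definition merge_round key hook :=
  ISet 4 (ICst 0) ;;
  While (ilt (IVar 4) (IVar 0)) (merge_blocks key ;; hook ;; ISet 4 (IVar 6)) ;;
  For 9 (ICst 0) 0 (IPut 0 (IVar 9) (IGet 1 (IVar 9))).

Definition msort key hook :=
  For 9 (ICst 0) 0 (IPut 0 (IVar 9) (IVar 9)) ;;
  ISet 3 (ICst 1) ;;
  While (ilt (IVar 3) (IVar 0))
    (merge_round key hook ;; ISet 3 (IAdd (IVar 3) (IVar 3))).

Lemma merge_cons (T : Type) (leT : rel T) x s y t :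
  merge leT (x :: s) (y :: t) =
  if leT x y then x :: merge leT s (y :: t) else y :: merge leT (x :: s) t.
Proof. by []. Qed.

Lemma upd_same A (f : nat -> A) i v : upd f i v i = v.
Proof. by rewrite /upd eqxx. Qed.

Lemma upd_other A (f : nat -> A) i v j : j != i -> upd f i v j = f j.
Proof. by rewrite /upd => /negbTE ->. Qed.

Lemma run_seq (R : realType) (s : state R) c1 c2 :
  run (c1 ;; c2) s = run c2 (run c1 s).
Proof. by []. Qed.

Lemma run_imin (R : realType) (s : state R) x e1 e2 :
  run (imin x e1 e2) s = iset s x (minn (ieval s e1) (ieval s e2)).
Proof. by rewrite /= minnC /minn ltnNge; case: (_ <= _)%N. Qed.

Lemma run_if (R : realType) (s : state R) b c1 c2 :
  run (If b c1 c2) s = if beval s b then run c1 s else run c2 s.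
Proof. by []. Qed.

Lemma iota_recr a b : (a <= b)%N -> iota a (b.+1 - a) = rcons (iota a (b - a)) b.
Proof. by move=> h; rewrite subSn // -addn1 iotaD subnKC // cats1. Qed.

Lemma iota_recl a b : (a < b)%N -> iota a (b - a) = a :: iota a.+1 (b - a.+1).
Proof. by move=> h; rewrite -subSS subSn. Qed.

(** * Correctness of the mergesort *)

Section Sort.
Context {R : realType}.
Implicit Types (s : state R) (kf : nat -> R) (f : nat -> nat).

Definition slice f a z := [seq f i | i <- iota a (z - a)].

Lemma slice_recr f a b : (a <= b)%N -> slice f a b.+1 = rcons (slice f a b) (f b).
Proof. by move=> h; rewrite /slice iota_recr // map_rcons. Qed.

Lemma slice_recl f a b : (a < b)%N -> slice f a b = f a :: slice f a.+1 b.
Proof. by move=> h; rewrite /slice iota_recl. Qed.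

Lemma eq_slice f g a z : (forall i, (a <= i < z)%N -> f i = g i) -> slice f a z = slice g a z.
Proof. by move=> h; apply/eq_in_map => i; rewrite mem_iota => ?; apply: h; arith. Qed.

Lemma slice_nil f a : slice f a a = [::].
Proof. by rewrite /slice subnn. Qed.

Lemma mem_iota_slice a z i : (i \in iota a (z - a)) = (a <= i < z)%N.
Proof. by rewrite mem_iota; arith. Qed.

Definition le_key kf : rel nat := fun i j => kf i <= kf j.

Lemma le_key_total kf : total (le_key kf).
Proof. by move=> i j; apply: le_total. Qed.

(** Since [msort] starts from the identity, a block holds exactly its own range of indices. With
    points numbered by abscissa and keys given by ordinates, it is a vertical slab listed from
    bottom to top. *)
Definition sorted_block kf f a z :=
  perm_eq (slice f a z) (iota a (z - a)) && sorted (le_key kf) (slice f a z).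

Lemma merge_blocks_spec key kf s n lo mid hi :
  ivar s 0 = n -> ivar s 4 = lo -> rarr s key = kf ->
  mid = minn (lo + ivar s 3) n -> hi = minn (mid + ivar s 3) n -> (lo < n)%N ->
  wp (merge_blocks key) s ((hi - lo) * 5 + 8)
   (fun s' => [/\ ivar s' 5 = mid, ivar s' 6 = hi,
      slice (iarr s' 1) lo hi =
        merge (le_key kf) (slice (iarr s 0) lo mid) (slice (iarr s 0) mid hi) &
      forall i, (i < lo)%N -> iarr s' 1 i = iarr s 1 i]).
Proof.
move=> s0 s4 skf emid ehi lon.
have lm : (lo <= mid)%N by arith.
have mh : (mid <= hi)%N by arith.
apply: (@wp_seq_le _ 6 ((hi - lo) * 5 + 2)); first by arith.
apply: wp_run => //.
rewrite /merge_init !run_seq !run_imin /=.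
set s1 := iset _ 8 _.
have e5 : ivar s1 5 = mid by rewrite /s1 /= /upd /= s0 s4 emid.
have e6 : ivar s1 6 = hi by rewrite /s1 /= /upd /= s0 s4 ehi emid.
have e7 : ivar s1 7 = lo by rewrite /s1 /= /upd /= s4.
have e8 : ivar s1 8 = mid by rewrite -e5.
have e4 : ivar s1 4 = lo by rewrite /s1 /= /upd /= s4.
have eA : iarr s1 = iarr s by [].
have eK : rarr s1 = rarr s by [].
move: s1 e5 e6 e7 e8 e4 eA eK => s1 e5 e6 e7 e8 e4 eA eK.
set A := slice (iarr s 0); set M := merge _ _ _.
(* What has been written, followed by the merge of what remains on both sides, is always the full
   merge [M]. *)
pose I k (s' : state R) := exists i j,
  [/\ ivar s' 7 = i, ivar s' 8 = j, (lo <= i <= mid)%N, (mid <= j <= hi)%N &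
   [/\ (i + j = k + mid)%N,
     slice (iarr s' 1) lo k ++ merge (le_key kf) (A i mid) (A j hi) = M &
     forall l, (l < lo)%N -> iarr s' 1 l = iarr s 1 l]].
have := @wp_for _ 9 (IVar 4) 6 (merge_step key) s1 3 I; rewrite /= e4 e6; apply => //.
- by arith.
- exists lo, mid; rewrite /= /upd /= e7 e8; split=> //; try by arith.
  by split; rewrite ?eA // slice_nil.
- move=> k s' /andP[lok khi] [fI fA _ fK] h9 h6 [i [j [h7 h8 hi' hj]]] [hij hM hT].
  have f0 : iarr s' 0 = iarr s 0 by rewrite fA // eA.
  have f5 : ivar s' 5 = mid by rewrite fI.
  have fk : rarr s' key = kf by rewrite fK // eK.
  apply: wp_run => //= _.
  rewrite f0 fk f5 h6 h7 h8 h9 !addn1.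
  have slk v : slice (upd (iarr s' 1) k v) lo k.+1 = rcons (slice (iarr s' 1) lo k) v.
    rewrite slice_recr // /upd eqxx; congr rcons; apply: eq_slice => l ?.
    by case: eqP => // ?; arith.
  have tlk v l : (l < lo)%N -> upd (iarr s' 1) k v l = iarr s 1 l.
    by move=> ll; rewrite upd_other ?hT //; apply/eqP; arith.
  case: ifP => hc.
    exists i.+1, j; split; try by [rewrite /= /upd /= ?h7 ?addn1|arith].
    split; [by arith| |by move=> l ll; rewrite /= upd_same tlk].
    rewrite /= upd_same slk cat_rcons -[RHS]hM /A (@slice_recl _ i); last by arith.
    case/andP: hc => hc1; case: ltnP => hc2 /=.
      by rewrite negbK => hk; rewrite (@slice_recl _ j) // merge_cons ifT.
    have -> : j = hi by arith.
    by rewrite !slice_nil; case: (slice _ i.+1 mid).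
  exists i, j.+1; split; try by [rewrite /= /upd /= ?h8 ?addn1|arith].
  split; [by arith| |by move=> l ll; rewrite /= upd_same tlk].
  rewrite /= upd_same slk cat_rcons -[RHS]hM /A (@slice_recl _ j); last by arith.
  have jhi : (j < hi)%N by arith.
  move: hc; rewrite jhi /=.
  case: ltnP => /= hc1 => [/negbFE hk|_].
    rewrite (@slice_recl _ i) // merge_cons ifN //; exact: hk.
  have -> : i = mid by arith.
  by rewrite slice_nil.
- move=> s' [fi _ _ _] h9 [i [j [h7 h8 hi' hj]]] [hij hM hT].
  have e : merge (le_key kf) (A i mid) (A j hi) = [::].
    by rewrite /A (_ : i = mid) 1?(_ : j = hi) ?slice_nil //; arith.
  by rewrite e cats0 in hM; split=> //; rewrite fi.
Qed.

Lemma sorted_block_merge kf f g lo mid hi : (lo <= mid <= hi)%N ->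
  sorted_block kf f lo mid -> sorted_block kf f mid hi ->
  slice g lo hi = merge (le_key kf) (slice f lo mid) (slice f mid hi) ->
  sorted_block kf g lo hi.
Proof.
move=> /andP[lm mh] /andP[p1 s1] /andP[p2 s2] e; apply/andP; split; rewrite e.
  rewrite perm_merge (_ : (hi - lo) = (mid - lo) + (hi - mid))%N; last by arith.
  by rewrite iotaD subnKC // perm_cat.
by apply: merge_sorted => //; apply: le_key_total.
Qed.

(** The changes that the sort makes by itself, apart from the hook. The properties maintained by a
    hook have to survive these. *)
Definition sort_frame s s' := frame (msort 0 Skip) s s'.

Lemma sort_frame_sub c s s' :
  [&& all (mem [:: 3; 4; 5; 6; 7; 8; 9]%N) (iregs c), all (mem [:: 0; 1]%N) (iarrs c),
      nilp (rregs c) & nilp (rarrs c)] ->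
  frame c s s' -> sort_frame s s'.
Proof.
move=> /and4P[/allP h1 /allP h2 /nilP h3 /nilP h4]; apply: frame_sub; split.
- by move=> x /h1; move: x; apply/allP.
- by move=> x /h2; move: x; apply/allP.
- by move=> x; rewrite h3.
- by move=> x; rewrite h4.
Qed.

Lemma sort_frame_iset s x v :
  x \in [:: 3; 4; 5; 6; 7; 8; 9]%N -> sort_frame s (iset s x v).
Proof.
move=> hx; apply: (@sort_frame_sub (ISet x (ICst v))); first by rewrite /= andbT hx.
exact: (@frame_run _ (ISet x (ICst v))).
Qed.

Definition pairs_done (L : state R -> nat -> nat -> Prop) s lo hi :=
  forall a b, (lo <= a < hi)%N -> (lo <= b < hi)%N -> a != b -> L s a b.

(* Every pair is separated by the middle of exactly one block, so it is enough
   that the hook establishes L for the pairs separated in its block. *)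
Definition hook_spec n kf hook ch (H : state R -> Prop) (L : state R -> nat -> nat -> Prop) :=
  forall s lo mid hi, ivar s 0 = n -> ivar s 4 = lo -> ivar s 5 = mid -> ivar s 6 = hi ->
    (lo <= mid <= hi)%N -> (lo < hi <= n)%N -> sorted_block kf (iarr s 1) lo hi -> H s ->
    wp hook s (ch * (hi - lo)) (fun s' =>
      [/\ H s', (forall a b, L s a b -> L s' a b) &
        forall a b, (lo <= a < mid)%N -> (mid <= b < hi)%N -> L s' a b /\ L s' b a]).

Section Hook.
Context (n key ch : nat) (hook : cmd) (kf : nat -> R).
Context (H : state R -> Prop) (L : state R -> nat -> nat -> Prop).
Context (hookP : hook_spec n kf hook ch H L).
Context (hook_iregs : all (fun x => x \notin iregs hook) [:: 0; 3; 4; 5; 6]%N).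
Context (hook_iarrs : all (fun x => x \notin iarrs hook) [:: 0; 1]%N).
Context (hook_key : key \notin rarrs hook).
Context (H_frame : forall s s', sort_frame s s' -> H s -> H s').
Context (L_frame : forall s s' a b, sort_frame s s' -> L s a b -> L s' a b).

(** Truncation at [n] makes the blocks past the end empty, so statements about all blocks need no
    range for [b]. *)
Let start b w := minn (b * w) n.

Definition blocks_sorted f w := forall b, sorted_block kf f (start b w) (start b.+1 w).
Definition blocks_done s w := forall b, pairs_done L s (start b w) (start b.+1 w).

Lemma merge_round_spec s w : (0 < w)%N -> ivar s 0 = n -> ivar s 3 = w -> rarr s key = kf ->
  H s -> blocks_sorted (iarr s 0) w -> blocks_done s w ->
  wp (merge_round key hook) s (n * (ch + 18) + 4) (fun s' =>
    [/\ H s', blocks_sorted (iarr s' 0) (w + w) & blocks_done s' (w + w)]).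
Proof.
move=> w0 s0 s3 sK Hs bs bd.
apply: (@wp_seq_le _ 1 (n * (ch + 18) + 3)); first by arith.
apply: wp_run => //=.
set s1 := iset s 4 _.
have fr1 : sort_frame s s1.
  exact: sort_frame_iset.
have Hs1 := H_frame fr1 Hs.
have bd1 : blocks_done s1 w by move=> b x y hx hy hxy; apply: L_frame fr1 _; exact: bd hx hy hxy.
have /and5P[hk0 hk3 hk4 hk5 /andP[hk6 _]] := hook_iregs.
have /and3P[hk0' hk1' _] := hook_iarrs.
apply: (@wp_seq_le _ (n * (ch + 15) + 1) (n * 3 + 2)); first by arith.
pose J g s' := exists b, [/\ g = ((n - start b (w + w)) * (ch + 15) + 1)%N,
  ivar s' 4 = start b (w + w), H s', blocks_done s' w &
  forall b', (b' < b)%N ->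
    sorted_block kf (iarr s' 1) (start b' (w + w)) (start b'.+1 (w + w)) /\
    pairs_done L s' (start b' (w + w)) (start b'.+1 (w + w))].
apply: (@wp_while _ _ _ _ _ J); last first.
  by exists 0%N; split=> //; rewrite /start mul0n min0n ?subn0.
move=> s' g [fI fA _ fK] [b [-> h4 Hs' bd' hb]].
have f0 : ivar s' 0 = n by rewrite fI //= !(inE, mem_cat) (negbTE hk0).
have f3 : ivar s' 3 = w by rewrite fI //= !(inE, mem_cat) (negbTE hk3).
have fO : iarr s' 0 = iarr s 0 by rewrite fA //= !(inE, mem_cat) (negbTE hk0').
have fk : rarr s' key = kf by rewrite fK //= !(inE, mem_cat) (negbTE hook_key).
rewrite /= f0 h4 addn1; case: ifPn => ln.
  set lo := start b (w + w).
  pose mid := minn (lo + w) n; pose hi := minn (mid + w) n.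
  have elo : lo = start b.*2 w by rewrite /lo /start; arith.
  have emid : mid = start b.*2.+1 w by rewrite /mid /lo /start; arith.
  have ehi : hi = start b.+1.*2 w by rewrite /hi /mid /lo /start; arith.
  have ehi' : hi = start b.+1 (w + w) by rewrite /hi /mid /lo /start; arith.
  exists ((hi - lo) * (ch + 5) + 9)%N, ((n - hi) * (ch + 15) + 1)%N; split.
    have -> : (n - lo = (n - hi) + (hi - lo))%N by arith.
    have : (0 < hi - lo)%N by arith.
    rewrite mulnDl; move: (hi - lo)%N => d d0; clear_nonarith; nia.
  apply: (@wp_seq_le _ ((hi - lo) * 5 + 8) (ch * (hi - lo) + 1)); first by arith.
  apply: wp_frame.
  have := @merge_blocks_spec key kf s' n lo mid hi f0 h4 fk.
  rewrite f3 => /(_ erefl erefl ln) hm; apply: wp_mono hm (leqnn _) _.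
  move=> s2 [e5 e6 e1 e1'] fr2.
  have sf2 : sort_frame s' s2 by apply: sort_frame_sub fr2.
  have Hs2 := H_frame sf2 Hs'.
  have bd2 : blocks_done s2 w by move=> ? x y hx hy hxy; apply: L_frame sf2 _; exact: bd' hx hy hxy.
  case: fr2 => [fI2 fA2 _ fK2].
  have g0 : ivar s2 0 = n by rewrite fI2.
  have g4 : ivar s2 4 = lo by rewrite fI2.
  have sb2 : sorted_block kf (iarr s2 1) lo hi.
    rewrite fO in e1; apply: sorted_block_merge e1; first by arith.
      by rewrite elo emid; apply: bs.
    by rewrite ehi emid doubleS; apply: bs.
  apply: (@wp_seq_le _ (ch * (hi - lo)) 1); first by arith.
  apply: wp_frame.
  have lmh : (lo <= mid <= hi)%N by arith.
  have lhn : (lo < hi <= n)%N by arith.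
  apply: wp_mono (hookP g0 g4 e5 e6 lmh lhn sb2 Hs2) (leqnn _) _.
  move=> s3' [Hs3 Lm Ld] [fI3 fA3 _ fK3].
  apply: wp_run => //=.
  have fr4 : sort_frame s3' (iset s3' 4 (ivar s3' 6)).
    exact: sort_frame_iset.
  have pd3 b1 b2 : pairs_done L s2 b1 b2 -> pairs_done L (iset s3' 4 (ivar s3' 6)) b1 b2.
    by move=> h x y hx hy hxy; apply: L_frame fr4 _; apply: Lm; exact: h hx hy hxy.
  exists b.+1; split.
  - by rewrite ehi'.
  - by rewrite /= /upd /= fI3 // e6 ehi'.
  - exact: H_frame fr4 _.
  - by move=> b'; apply: pd3; exact: bd2.
  - move=> b'; rewrite ltnS leq_eqVlt => /orP[/eqP ->|lb].
      rewrite -ehi' -/lo /= fA3 //; split=> // x y hx hy hxy.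
      apply: L_frame fr4 _.
      (* Pairs within one half were treated in an earlier round; pairs across the middle are the
         work of the hook. *)
      have [xm|xm] := ltnP x mid; have [ym|ym] := ltnP y mid.
      + by apply: Lm; apply: (bd2 b.*2); rewrite -?elo -?emid //; arith.
      + by apply: (Ld x y _ _).1; arith.
      + by apply: (Ld y x _ _).2; arith.
      + by apply: Lm; apply: (bd2 b.*2.+1); rewrite -?emid -?doubleS -?ehi //; arith.
    have [h1 h2] := hb _ lb; split.
      rewrite /= fA3 //; have : slice (iarr s2 1) (start b' (w + w)) (start b'.+1 (w + w)) =
        slice (iarr s' 1) (start b' (w + w)) (start b'.+1 (w + w)).
        apply: eq_slice => i hi'; apply: e1'.
        by have := leq_mul lb (leqnn (w + w)); move: hi'; rewrite /lo /start; arith.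
      by move=> e; move: h1; rewrite /sorted_block e.
    apply: pd3 => x y hx hy hxy; apply: L_frame sf2 _; exact: h2 hx hy hxy.
have lo_n : start b (w + w) = n by rewrite /start in ln *; arith.
split; first by rewrite addn1.
have := @wp_for _ 9 (ICst 0) 0 (IPut 0 (IVar 9) (IGet 1 (IVar 9))) s' 1
  (fun k s'' => forall i, (i < k)%N -> iarr s'' 0 i = iarr s' 1 i).
rewrite /= subn0 f0; apply=> //.
  move=> k s'' kn [_ fA'' _ _] h9 _ hI; apply: wp_run => //= _ i.
  rewrite ltnS upd_same h9 (fA'' 1%N) // leq_eqVlt => /orP[/eqP ->|ik]; first exact: upd_same.
  by rewrite upd_other ?hI //; apply/eqP; arith.
move=> s'' fr'' _ hI.
have sf : sort_frame s' s'' by apply: sort_frame_sub fr''.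
have big b' : (b <= b')%N -> start b' (w + w) = n.
  by move=> lb; have := leq_mul lb (leqnn (w + w)); rewrite /start in lo_n *; arith.
split; first exact: H_frame sf _.
  move=> b'; case: (ltnP b' b) => lb; last first.
    by rewrite !big ?(leqW lb) // /sorted_block slice_nil subnn.
  have [h1 _] := hb _ lb; move: h1; rewrite /sorted_block.
  rewrite (@eq_slice (iarr s'' 0) (iarr s' 1)) // => i hi.
  by apply: hI; move: hi; rewrite /start; arith.
move=> b'; case: (ltnP b' b) => lb; last first.
  by rewrite !big ?(leqW lb) // => x y hx; arith.
by have [_ h2] := hb _ lb; move=> x y hx hy hxy; apply: L_frame sf _; exact: h2 hx hy hxy.
Qed.

Definition sort_time := (up_log 2 n * (n * (ch + 18) + 6) + (n * 3 + 4))%N.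

Lemma msort_spec s : (0 < n)%N -> ivar s 0 = n -> rarr s key = kf -> H s ->
  wp (msort key hook) s sort_time (fun s' =>
    [/\ H s', sorted_block kf (iarr s' 0) 0 n &
       forall a b, (a < n)%N -> (b < n)%N -> a != b -> L s' a b]).
Proof.
move=> n0 s0 sK Hs; rewrite /sort_time.
set T := (up_log 2 n * _)%N.
apply: (@wp_seq_le _ (n * 3 + 2) (T + 2)); first by arith.
have := @wp_for _ 9 (ICst 0) 0 (IPut 0 (IVar 9) (IVar 9)) s 1
  (fun k s' => forall i, (i < k)%N -> iarr s' 0 i = i).
rewrite /= subn0 s0; apply=> //.
  move=> k s' kn _ h9 _ hI; apply: wp_run => //= _ i.
  rewrite ltnS upd_same h9 leq_eqVlt => /orP[/eqP ->|ik]; first exact: upd_same.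
  by rewrite upd_other ?hI //; apply/eqP; arith.
move=> s1 fr1 _ hid.
have sf1 : sort_frame s s1 by apply: sort_frame_sub fr1.
have [fI1 _ _ fK1] := fr1.
have g0 : ivar s1 0 = n by rewrite fI1.
have gK : rarr s1 key = kf by rewrite fK1.
have H1 := H_frame sf1 Hs.
apply: (@wp_seq_le _ 1 (T + 1)); first by arith.
apply: wp_run => //=.
set s2 := iset s1 3 1.
have sf2 : sort_frame s1 s2 by exact: sort_frame_iset.
have /and5P[hk0 hk3 hk4 hk5 /andP[hk6 _]] := hook_iregs.
pose J g s' := exists r, [/\ g = ((up_log 2 n - r) * (n * (ch + 18) + 6) + 1)%N,
  ivar s' 3 = (2 ^ r)%N, H s', blocks_sorted (iarr s' 0) (2 ^ r) & blocks_done s' (2 ^ r)].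
apply: (@wp_while _ _ _ _ _ J); last first.
  exists 0%N; split; rewrite ?subn0 //; first exact: H_frame sf2 H1.
    move=> b; rewrite /sorted_block /start !muln1 /s2 /=.
    rewrite (_ : slice _ _ _ = iota (minn b n) (minn b.+1 n - minn b n)%N).
      by rewrite perm_refl /= (_ : (_ - _)%N = (b < n)%N :> nat); [case: (b < n)%N|arith].
    by rewrite -[RHS]map_id; apply: eq_slice => i hi; apply: hid; arith.
  by move=> b x y; rewrite /start !muln1 => hx hy xy; arith.
move=> s' g [fI fA _ fK] [r [-> h3 Hs' bs bd]].
have f0 : ivar s' 0 = n by rewrite fI //= !(inE, mem_cat) (negbTE hk0).
have fk : rarr s' key = kf by rewrite fK //= !(inE, mem_cat) (negbTE hook_key).
rewrite /= f0 h3 addn1; case: ifPn => ln.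
  have rl : (r < up_log 2 n)%N.
    rewrite ltnNge; apply/negP => h; have := @up_logP 2 n isT.
    by have := @leq_pexp2l 2 _ _ isT h; arith.
  exists (n * (ch + 18) + 4 + 1)%N, ((up_log 2 n - r.+1) * (n * (ch + 18) + 6) + 1)%N.
  split.
    by rewrite (_ : up_log 2 n - r = (up_log 2 n - r.+1).+1)%N; [rewrite mulSn; arith|arith].
  apply: wp_seq; apply: wp_frame.
  apply: wp_mono (merge_round_spec _ f0 h3 fk Hs' bs bd) (leqnn _) _; first by rewrite expn_gt0.
  move=> s4 [H4 bs4 bd4] [fI4 _ _ _]; apply: wp_run => //=.
  have sf4 : sort_frame s4 (iset s4 3 (ivar s4 3 + ivar s4 3)) by exact: sort_frame_iset.
  have e4 : ivar s4 3 = (2 ^ r)%N by rewrite fI4 //= !(inE, mem_cat) (negbTE hk3).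
  have e2 : (2 ^ r + 2 ^ r = 2 ^ r.+1)%N by rewrite expnS mul2n addnn.
  exists r.+1; split=> //.
  - by rewrite /= upd_same e4.
  - exact: H_frame sf4 _.
  - by rewrite -e2.
  - by rewrite -e2 => b x y hx hy hxy; apply: L_frame sf4 _; apply: bd4 hx hy hxy.
have st0 : start 0 (2 ^ r) = 0%N by rewrite /start; arith.
have st1 : start 1 (2 ^ r) = n by rewrite /start; arith.
split; first by rewrite addn1.
split=> //; first by have := bs 0%N; rewrite st0 st1.
by move=> a b an bn ab; apply: (bd 0%N); rewrite ?st0 ?st1.
Qed.
End Hook.
End Sort.

(** * Traversals of a merged block in both directions *)

Definition scan (fwd : bool) body :=
  For 10 (IVar 4) 6
    (ISet 11 (IGet 1 (if fwd then IVar 10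
                      else ISub (IAdd (IVar 4) (IVar 6)) (IAdd (IVar 10) (ICst 1)))) ;;
     body).

Definition two_scans init body :=
  (init ;; scan true (body true)) ;; (init ;; scan false (body false)).

Lemma rcons_split (T : Type) (h h1 t : seq T) x y : rcons h x = h1 ++ y :: t ->
  (h1 = h /\ y = x) \/ exists t', h = h1 ++ y :: t'.
Proof.
case/lastP: t => [|t z]; first by rewrite cats1 => /rcons_inj [-> ->]; left.
by rewrite -rcons_cons -rcons_cat => /rcons_inj [-> _]; right; exists t.
Qed.

Section Scan.
Context {R : realType}.
Implicit Types (s : state R) (kf : nat -> R).

Definition same_data s s' :=
  [/\ iarr s' 2 = iarr s 2, forall a, rarr s' a = rarr s a & forall x, rvar s' x = rvar s x].

Definition traversal (fwd : bool) (f : nat -> nat) lo hi :=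
  if fwd then slice f lo hi else rev (slice f lo hi).

Lemma size_slice f lo hi : size (slice f lo hi) = (hi - lo)%N.
Proof. by rewrite size_map size_iota. Qed.

Lemma nth_slice f lo hi i : (i < hi - lo)%N -> nth 0%N (slice f lo hi) i = f (lo + i)%N.
Proof. by move=> h; rewrite (nth_map 0%N) ?size_iota // nth_iota. Qed.

Lemma size_traversal fwd f lo hi : size (traversal fwd f lo hi) = (hi - lo)%N.
Proof. by case: fwd; rewrite /= ?size_rev size_slice. Qed.

Lemma nth_traversal fwd f lo hi k : (lo <= k < hi)%N ->
  nth 0%N (traversal fwd f lo hi) (k - lo) = f (if fwd then k else lo + hi - k.+1)%N.
Proof.
move=> hk; case: fwd => /=; first by rewrite nth_slice ?subnKC //; arith.
rewrite nth_rev size_slice ?nth_slice; try arith.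
by congr f; arith.
Qed.

(** [K] is the loop invariant, indexed by the points met so far; [D] is what the visit of a point
    establishes towards the earlier ones, and later visits must preserve it. *)
Lemma scan_spec fwd body s lo hi c (K : seq nat -> state R -> Prop)
    (D : state R -> nat -> nat -> Prop) (Q : state R -> Prop) :
  let xs := traversal fwd (iarr s 1) lo hi in
  ivar s 4 = lo -> ivar s 6 = hi -> (lo <= hi)%N ->
  all (fun x => x \notin iregs body) [:: 4; 6; 10]%N -> 1 \notin iarrs body ->
  (forall h s' x v, x \in [:: 10; 11]%N -> K h s' -> K h (iset s' x v)) ->
  (forall s' a b x v, x \in [:: 10; 11]%N -> D s' a b -> D (iset s' x v) a b) ->
  (forall h x t s', xs = h ++ x :: t -> frame (scan fwd body) s s' ->
     ivar s' 11 = x -> K h s' ->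
     wp body s' c (fun s'' => [/\ K (rcons h x) s'',
       forall a b, D s' a b -> D s'' a b & forall y, y \in h -> D s'' x y])) ->
  K [::] s ->
  (forall s', frame (scan fwd body) s s' -> K xs s' ->
     (forall h x t y, xs = h ++ x :: t -> y \in h -> D s' x y) -> Q s') ->
  wp (scan fwd body) s ((hi - lo) * (c + 3) + 2) Q.
Proof.
move=> xs s4 s6 lh /and4P[b4 b6 b10 _] b1 K_set D_set bodyP K0 QP.
have szx : size xs = (hi - lo)%N by rewrite size_traversal.
pose I k s' := K (take (k - lo) xs) s' /\
  forall h x t y, take (k - lo) xs = h ++ x :: t -> y \in h -> D s' x y.
pose inner := ISet 11 (IGet 1 (if fwd then IVar 10
  else ISub (IAdd (IVar 4) (IVar 6)) (IAdd (IVar 10) (ICst 1)))) ;; body.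
have := @wp_for _ 10 (IVar 4) 6 inner s (c + 1) I.
rewrite /= s4 s6 !inE /= b10 b6 addn3 addn1; apply=> //.
- rewrite /I subnn take0; split; first by apply: K_set.
  by move=> [].
- move=> k s' hk fr h10 h6 [hK hD].
  have hk' : (k - lo < size xs)%N by arith.
  have [fI fA _ _] := fr.
  have f4 : ivar s' 4 = lo by rewrite fI //= !(inE, mem_cat) (negbTE b4).
  have f1 : iarr s' 1 = iarr s 1 by rewrite fA //= !(inE, mem_cat) (negbTE b1).
  rewrite -add1n; apply: wp_seq; apply: wp_run => //=.
  set x := nth 0%N xs (k - lo).
  have -> : ieval s' (if fwd then IVar 10 else ISub (IAdd (IVar 4) (IVar 6))
     (IAdd (IVar 10) (ICst 1))) = (if fwd then k else lo + hi - k.+1)%N.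
    by case: (fwd); rewrite /= ?h10 ?f4 ?h6 ?addn1.
  have -> : iarr s' 1 (if fwd then k else (lo + hi - k.+1)%N) = x.
    by rewrite f1 /x nth_traversal.
  have tk : take (k.+1 - lo) xs = rcons (take (k - lo) xs) x.
    by rewrite subSn ?(take_nth 0%N) //; arith.
  have exs : xs = take (k - lo) xs ++ x :: drop (k.+1 - lo) xs.
    by rewrite -cat_rcons -tk cat_take_drop.
  have fr2 : frame (scan fwd body) s (iset s' 11 x).
    apply: frame_trans fr _.
    by split=> //= y; rewrite !inE /= => /norP[_ /norP[/negbTE h _]]; rewrite /upd h.
  have e11 : ivar (iset s' 11 x) 11 = x by rewrite /= upd_same.
  have hK' : K (take (k - lo) xs) (iset s' 11 x) by apply: K_set.
  apply: wp_mono (bodyP _ _ _ _ exs fr2 e11 hK') (leqnn _) _.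
  move=> s'' [K'' D'' Dx] _; rewrite /I tk; split; first exact: K_set.
  move=> h y t z e0 zh; apply: (D_set) => //; have e := rcons_split e0.
  case: e => [[eh ey]|[t' e]]; first by rewrite ey; apply: Dx; rewrite -eh.
  by apply: (D''); apply: (D_set) => //; apply: hD e zh.
- move=> s' fr h10 [hK hD]; rewrite -szx take_size in hK hD.
  exact: QP.
Qed.

(* At each point of the traversal, the body establishes L between this point and
   the points met before; flip tells which of the two comes first in L.  The
   traversal in the opposite order provides the other half. *)
Section TwoScans.
Context (n ci cb : nat) (kf : nat -> R) (init : cmd) (body : bool -> cmd) (flip : bool).
Context (H : state R -> Prop) (L : state R -> nat -> nat -> Prop).
Context (K : bool -> nat -> seq nat -> state R -> Prop).
Context (H_data : forall s s', same_data s s' -> H s -> H s').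
Context (L_data : forall s s' a b, same_data s s' -> L s a b -> L s' a b).
Context (K_set : forall fwd mid h s x v, x \in [:: 10; 11]%N ->
  K fwd mid h s -> K fwd mid h (iset s x v)).
Context (init_lf : loopfree init).
Context (init_cost : (cost init <= ci)%N).
Context (init_mods : [&& all (fun x => x \notin iregs init) [:: 0; 4; 5; 6]%N,
  all (fun x => x \notin iarrs init) [:: 1; 2]%N, nilp (rregs init) & nilp (rarrs init)]).
Context (init_K : forall fwd mid s, H s -> K fwd mid [::] (run init s)).
Context (body_mods : forall fwd,
  all (fun x => x \notin iregs (body fwd)) [:: 0; 4; 5; 6; 10]%N && (1%N \notin iarrs (body fwd))).

Definition opposite mid a b := (a < mid)%N != (b < mid)%N.

Context (bodyP : forall fwd s lo mid hi xs h x t,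
  ivar s 0 = n -> ivar s 4 = lo -> ivar s 5 = mid -> ivar s 6 = hi ->
  (lo <= mid <= hi)%N -> (lo < hi <= n)%N ->
  perm_eq xs (iota lo (hi - lo)) ->
  sorted (fun i j => if fwd then kf i <= kf j else kf j <= kf i) xs ->
  xs = h ++ x :: t -> ivar s 11 = x -> H s -> K fwd mid h s ->
  wp (body fwd) s cb (fun s' => [/\ H s', K fwd mid (rcons h x) s',
    forall a b, L s a b -> L s' a b &
    forall y, y \in h -> opposite mid x y -> if flip then L s' y x else L s' x y])).

Lemma half_scan_spec fwd s lo mid hi :
  ivar s 0 = n -> ivar s 4 = lo -> ivar s 5 = mid -> ivar s 6 = hi ->
  (lo <= mid <= hi)%N -> (lo < hi <= n)%N -> sorted_block kf (iarr s 1) lo hi -> H s ->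
  wp (init ;; scan fwd (body fwd)) s (ci + ((hi - lo) * (cb + 3) + 2)) (fun s' =>
    [/\ H s', (forall a b, L s a b -> L s' a b) &
      forall h x t y, traversal fwd (iarr s 1) lo hi = h ++ x :: t -> y \in h ->
        opposite mid x y -> if flip then L s' y x else L s' x y]).
Proof.
move=> s0 s4 s5 s6 lmh lhn /andP[pe so] Hs.
have [/and5P[i0 i4 i5 i6 _] /and3P[i1 i2 _] ir ia] := and4P init_mods.
have [/and5P[b0 b4 b5 b6 /andP[b10 _]] b1] := andP (body_mods fwd).
apply: wp_seq; apply: wp_run => //.
have [fI fA fR fK] := frame_run s init_lf.
have sd : same_data s (run init s).
  split; first exact: fA.
    by move=> a; apply: fK; rewrite (nilP ia).
  by move=> x; apply: fR; rewrite (nilP ir).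
have H1 := H_data sd Hs.
have K1 := init_K fwd mid Hs.
have e1 : iarr (run init s) 1 = iarr s 1 by apply: fA.
rewrite -e1; set s1 := run init s.
pose K' h s' := [/\ H s', K fwd mid h s' & forall a b, L s a b -> L s' a b].
apply: (@scan_spec fwd (body fwd) s1 lo hi cb K'
  (fun s' x y => opposite mid x y -> if flip then L s' y x else L s' x y)).
- by rewrite fI.
- by rewrite fI.
- by arith.
- by rewrite /= b4 b6 b10.
- by [].
- move=> h s' x v hx [h1 h2 h3].
  have sd' : same_data s' (iset s' x v) by [].
  split; [exact: H_data sd' _|exact: K_set|].
  by move=> a b /h3; apply: L_data.
- move=> s' a b x v hx h1 /h1; case: ifP => _; exact: L_data.
- move=> h x t s' exs [fI' fA' _ _] e11 [h1 h2 h3].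
  have pxs : perm_eq (traversal fwd (iarr s1 1) lo hi) (iota lo (hi - lo)).
    by rewrite e1; case: (fwd); rewrite //= perm_rev.
  have sxs : sorted (fun i j => if fwd then kf i <= kf j else kf j <= kf i)
     (traversal fwd (iarr s1 1) lo hi).
    by rewrite e1; case: (fwd); rewrite //= rev_sorted.
  have g0 : ivar s' 0 = n by rewrite fI' ?fI //= !(inE, mem_cat) (negbTE b0).
  have g4 : ivar s' 4 = lo by rewrite fI' ?fI //= !(inE, mem_cat) (negbTE b4).
  have g5 : ivar s' 5 = mid by rewrite fI' ?fI //= !(inE, mem_cat) (negbTE b5).
  have g6 : ivar s' 6 = hi by rewrite fI' ?fI //= !(inE, mem_cat) (negbTE b6).
  apply: wp_mono (bodyP g0 g4 g5 g6 lmh lhn pxs sxs exs e11 h1 h2) (leqnn _) _.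
  move=> s'' [k1 k2 k3 k4]; split=> //.
    by split=> // a b /h3 /k3.
  by move=> a b hD /hD; case: ifP => _; apply: k3.
- split=> // a b; exact: L_data.
- by move=> s' _ [h1 h2 h3] h4; split.
Qed.

Lemma two_scans_spec :
  hook_spec n kf (two_scans init body) (2 * (ci + cb + 5)) H L.
Proof.
move=> s lo mid hi s0 s4 s5 s6 lmh lhn sb Hs.
have [/and5P[i0 i4 i5 i6 _] /and3P[i1 i2 _] ir ia] := and4P init_mods.
have [/and5P[b0 b4 b5 b6 /andP[b10 _]] b1] := andP (body_mods true).
set T := (ci + ((hi - lo) * (cb + 3) + 2))%N.
apply: (@wp_seq_le _ T T).
  rewrite /T; have : (0 < hi - lo)%N by arith.
  by move: (hi - lo)%N => d d0; clear_nonarith; nia.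
apply: wp_frame.
apply: wp_mono (half_scan_spec true s0 s4 s5 s6 lmh lhn sb Hs) (leqnn _) _.
move=> s1 [H1 L1 D1] [fI fA _ _].
have g0 : ivar s1 0 = n by rewrite fI //= !(inE, mem_cat) (negbTE i0) (negbTE b0).
have g4 : ivar s1 4 = lo by rewrite fI //= !(inE, mem_cat) (negbTE i4) (negbTE b4).
have g5 : ivar s1 5 = mid by rewrite fI //= !(inE, mem_cat) (negbTE i5) (negbTE b5).
have g6 : ivar s1 6 = hi by rewrite fI //= !(inE, mem_cat) (negbTE i6) (negbTE b6).
have e1 : iarr s1 1 = iarr s 1 by rewrite fA //= !(inE, mem_cat) (negbTE i1) (negbTE b1).
rewrite -e1 in sb.
apply: wp_mono (half_scan_spec false g0 g4 g5 g6 lmh lhn sb H1) (leqnn _) _.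
move=> s2 [H2 L2 D2]; split=> //; first by move=> a b /L1 /L2.
move=> a b ha hb.
have mem x : (lo <= x < hi)%N -> x \in slice (iarr s 1) lo hi.
  by rewrite -e1 => hx; rewrite (perm_mem (andP sb).1) mem_iota_slice.
have op : opposite mid a b by rewrite /opposite; arith.
have op' : opposite mid b a by rewrite /opposite; arith.
have key x y : (lo <= x < hi)%N -> (lo <= y < hi)%N -> x != y -> opposite mid x y ->
    if flip then L s2 y x else L s2 x y.
  move=> hx hy xy hop; have [h [t E]] : exists h t, slice (iarr s 1) lo hi = h ++ x :: t.
    by case/splitPr: (mem _ hx) => h t; exists h, t.
  have := mem _ hy; rewrite E mem_cat inE eq_sym (negbTE xy) /= => /orP[yh|yt].
    by have := D1 _ _ _ _ E yh hop; case: ifP => _; apply: L2.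
  apply: (D2 (rev t) x (rev h)) => //; last by rewrite mem_rev.
  by rewrite /= e1 E rev_cat rev_cons cat_rcons.
have ab : a != b by apply/eqP; arith.
have := key a b; have := key b a; rewrite op op' ab eq_sym ab.
by case: (flip) => h1 h2; split; [apply: h1|apply: h2|apply: h2|apply: h1]; arith.
Qed.
End TwoScans.
End Scan.

(** * Approximate nearest neighbours *)

(* Real arrays 6 and 7 hold the coordinates sorted by abscissa, and integer
   array 2 a tentative neighbour of each point. *)
Definition rdist2 a b :=
  RAdd (RMul (RSub (RGet 6 a) (RGet 6 b)) (RSub (RGet 6 a) (RGet 6 b)))
       (RMul (RSub (RGet 7 a) (RGet 7 b)) (RSub (RGet 7 a) (RGet 7 b))).

Definition pred_of x := ISub (IVar x) (ICst 1).

Definition improve a b :=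
  If (RLe (rdist2 a (IGet 2 a)) (rdist2 a b)) Skip (IPut 2 a b).

(* The candidates for the point 11 are the best points seen so far on either
   side of the dividing line (registers 12 and 13, shifted by one, 0 meaning
   none): on each quadrant, the L1 distance is a linear function. *)
Definition quadrant_value (fwd left : bool) a :=
  RAdd (if left then RGet 6 a else RSub (RCst 0) (RGet 6 a))
       (if fwd then RGet 7 a else RSub (RCst 0) (RGet 7 a)).

Definition learn m := If (ILe (ICst 1) (IVar m)) (improve (IVar 11) (pred_of m)) Skip.

Definition update_best fwd left m :=
  If (BAnd (ILe (ICst 1) (IVar m))
        (RLe (quadrant_value fwd left (IVar 11)) (quadrant_value fwd left (pred_of m))))
    Skip (ISet m (IAdd (IVar 11) (ICst 1))).

Definition quadrant_body fwd :=
  If (ilt (IVar 11) (IVar 5))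
    (learn 13 ;; update_best fwd true 12)
    (learn 12 ;; update_best fwd false 13).

Definition quadrant_hook :=
  two_scans (ISet 12 (ICst 0) ;; ISet 13 (ICst 0)) quadrant_body.

Lemma sorted_before (T : eqType) (r : rel T) (h t : seq T) x y :
  transitive r -> sorted r (h ++ x :: t) -> y \in h -> r y x.
Proof.
move=> tr; elim: h => //= z h IH pz; rewrite inE => /orP[/eqP ->|yh].
  have := order_path_min tr pz; rewrite all_cat => /andP[_ /=].
  by case/andP.
by apply: IH yh; apply: path_sorted pz.
Qed.

(** * Correctness of the approximate search *)

Section Pass1.
Context {R : realType}.
Context (n : nat) (px py : nat -> R).
Implicit Types (s : state R).

Definition pt a : plane R := (px a, py a).
Definition d2 a b : R := dist2 (pt a) (pt b).

Context (px_mono : forall a b, (a <= b < n)%N -> px a <= px b).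

Definition neighbours s :=
  [/\ rarr s 6 = px, rarr s 7 = py & forall a, (a < n)%N -> (iarr s 2 a < n)%N && (iarr s 2 a != a)].

Lemma neighbours_data s s' : same_data s s' -> neighbours s -> neighbours s'.
Proof. by move=> [e1 e2 _] [h1 h2 h3]; split; rewrite ?e2 ?e1. Qed.

Lemma reval_rdist2 s a b : rarr s 6 = px -> rarr s 7 = py ->
  reval s (rdist2 a b) = d2 (ieval s a) (ieval s b).
Proof. by move=> /= -> ->; rewrite /d2 /dist2 !expr2. Qed.

(** The Euclidean norm is at most the L1 norm, which is at most sqrt 2 times the Euclidean one. This
    is the origin of the approximation factor. *)
Lemma dist2_quadrant (x y x' y' : R) : 0 <= x -> 0 <= y -> 0 <= x' -> 0 <= y' ->
  x + y <= x' + y' -> x ^+ 2 + y ^+ 2 <= 2 * (x' ^+ 2 + y' ^+ 2).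
Proof.
move=> hx hy hx' hy' h; apply: (@le_trans _ _ ((x' + y') ^+ 2)).
  apply: (@le_trans _ _ ((x + y) ^+ 2)); last by rewrite ler_sqr ?nnegrE ?addr_ge0.
  by rewrite sqrrD -addrA lerD2l lerDr mulrn_wge0 // mulr_ge0.
by have := sqr_ge0 (x' - y'); rewrite !expr2; lra.
Qed.

Definition improves s s' :=
  [/\ forall c, d2 c (iarr s' 2 c) <= d2 c (iarr s 2 c), ivar s' = ivar s, rvar s' = rvar s,
      rarr s' = rarr s & forall a, a != 2%N -> iarr s' a = iarr s a].

Lemma improve_spec s a b : neighbours s -> (ieval s a < n)%N -> (ieval s b < n)%N ->
  ieval s a != ieval s b ->
  let s' := run (improve a b) s in
  [/\ neighbours s', improves s s' &
     d2 (ieval s a) (iarr s' 2 (ieval s a)) <= d2 (ieval s a) (ieval s b)].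
Proof.
move=> hN an bn ab; have [h6 h7 hG] := hN.
move=> s'; rewrite /s' /improve run_if {s'}.
have -> : beval s (RLe (rdist2 a (IGet 2 a)) (rdist2 a b)) =
  (d2 (ieval s a) (iarr s 2 (ieval s a)) <= d2 (ieval s a) (ieval s b)).
  by rewrite -[beval _ _]/(reval s _ <= reval s _) !reval_rdist2.
case: leP => h; first by split.
split.
- split=> //= c cn; rewrite upd_same /upd; case: eqP => [->|_]; last exact: hG.
  by rewrite bn eq_sym.
- split=> //= [c|c hc]; last by rewrite upd_other.
  by rewrite upd_same /upd; case: eqP => [->|_ //]; exact: ltW.
- by rewrite /= !upd_same.
Qed.

Let sgn (b : bool) (v : R) := if b then v else - v.
Let qv fwd left a := sgn left (px a) + sgn fwd (py a).

Lemma reval_quadrant_value s fwd left a : rarr s 6 = px -> rarr s 7 = py ->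
  reval s (quadrant_value fwd left a) = qv fwd left (ieval s a).
Proof.
by move=> h6 h7; case: fwd left => -[]; rewrite /qv /= ?h6 ?h7 // !sub0r.
Qed.

Definition best (side : nat -> bool) (val : nat -> R) m (h : seq nat) s :=
  (ivar s m = 0%N /\ forall a, a \in h -> ~~ side a) \/
  exists2 b, ivar s m = b.+1 & [/\ b \in h, side b &
    forall a, a \in h -> side a -> val a <= val b].

Definition quadrant_inv fwd mid h s :=
  best (fun a => a < mid)%N (qv fwd true) 12 h s /\
  best (fun a => ~~ (a < mid)%N) (qv fwd false) 13 h s.

Lemma best_ivar side val m h s s' : ivar s' m = ivar s m -> best side val m h s ->
  best side val m h s'.
Proof. by rewrite /best => ->. Qed.

Lemma best_other side val m h x s : ~~ side x -> best side val m h s ->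
  best side val m (rcons h x) s.
Proof.
move=> sx [[h1 h2]|[b h1 [h2 h3 h4]]]; [left|right].
  by split=> // a; rewrite mem_rcons inE => /orP[/eqP ->//|/h2].
exists b => //; split=> //; first by rewrite mem_rcons inE h2 orbT.
by move=> a; rewrite mem_rcons inE => /orP[/eqP ->|/h4//]; rewrite (negbTE sx).
Qed.

Lemma update_best_spec s (side : nat -> bool) fwd left m h x :
  rarr s 6 = px -> rarr s 7 = py -> ivar s 11 = x -> m != 11%N -> side x ->
  best side (qv fwd left) m h s ->
  best side (qv fwd left) m (rcons h x) (run (update_best fwd left m) s).
Proof.
move=> h6 h7 h11 m11 sx hb; rewrite /update_best run_if.
rewrite -[beval _ _]/((0 < ivar s m)%N && (reval s _ <= reval s _)) !reval_quadrant_value //= h11.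
case: hb => [[h1 h2]|[b h1 [h2 h3 h4]]].
  rewrite h1 ltnn /=; right; exists x; first by rewrite /= upd_same addn1.
  split=> //; first by rewrite mem_rcons mem_head.
  move=> a; rewrite mem_rcons inE => /orP[/eqP ->//|/h2 /negbTE -> //].
rewrite h1 /= subn1 /=; case: leP => hx; right.
  exists b => //; split=> //; first by rewrite mem_rcons inE h2 orbT.
  by move=> a; rewrite mem_rcons inE => /orP[/eqP ->//|]; apply: h4.
exists x; first by rewrite /= upd_same addn1.
split=> //; first by rewrite mem_rcons mem_head.
move=> a; rewrite mem_rcons inE => /orP[/eqP ->//|] /h4 ha /ha /le_trans; apply.
exact: ltW.
Qed.

Lemma learn_spec s (side : nat -> bool) val m h x :
  neighbours s -> ivar s 11 = x -> (x < n)%N -> ~~ side x ->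
  (forall a, a \in h -> (a < n)%N) -> best side val m h s ->
  let s' := run (learn m) s in
  [/\ neighbours s', improves s s' &
   forall y, y \in h -> side y -> exists b, [/\ b \in h, side b, val y <= val b &
     d2 x (iarr s' 2 x) <= d2 x b]].
Proof.
move=> hN h11 xn sx hn hb s'; rewrite /s' /learn run_if {s'}.
rewrite [beval _ _]/(0 < ivar s m)%N.
case: hb => [[h1 h2]|[b h1 [h2 h3 h4]]]; rewrite h1 ?ltnn ?ltn0Sn.
  by split=> // y /h2 /negbTE ->.
have [||| k1 k2 k3] := @improve_spec s (IVar 11) (pred_of m) hN.
- by rewrite /= h11.
- by rewrite /= h1 subn1; apply: hn.
- by rewrite /= h11 h1 subn1; apply: contra sx => /eqP ->.
split=> // y yh sy; exists b; split=> //; first exact: h4.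
by move: k3; rewrite /= h11 h1 subn1.
Qed.

(** Relative to the candidate [b], the tentative neighbour of [a] is at most sqrt 2 times too far;
    the factor is squared here. *)
Let L1 s a b := d2 a (iarr s 2 a) <= 2 * d2 a b.

Lemma L1_improves s s' a b : improves s s' -> L1 s a b -> L1 s' a b.
Proof. by move=> [h _ _ _ _]; apply: le_trans. Qed.

Lemma quadrant_body_spec fwd s lo mid hi xs h x t :
  ivar s 0 = n -> ivar s 4 = lo -> ivar s 5 = mid -> ivar s 6 = hi ->
  (lo <= mid <= hi)%N -> (lo < hi <= n)%N ->
  perm_eq xs (iota lo (hi - lo)) ->
  sorted (fun i j => if fwd then py i <= py j else py j <= py i) xs ->
  xs = h ++ x :: t -> ivar s 11 = x -> neighbours s -> quadrant_inv fwd mid h s ->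
  wp (quadrant_body fwd) s 8 (fun s' => [/\ neighbours s',
    quadrant_inv fwd mid (rcons h x) s', forall a b, L1 s a b -> L1 s' a b &
    forall y, y \in h -> opposite mid x y -> L1 s' x y]).
Proof.
move=> s0 s4 s5 s6 lmh lhn pxs sxs exs s11 hN [bl br].
have inxs a : a \in xs -> (a < n)%N by rewrite (perm_mem pxs) mem_iota => ?; arith.
have xn : (x < n)%N by apply: inxs; rewrite exs mem_cat mem_head orbT.
have hn a : a \in h -> (a < n)%N by move=> ah; apply: inxs; rewrite exs mem_cat ah.
have ord y : y \in h -> if fwd then py y <= py x else py x <= py y.
  rewrite exs in sxs; apply: sorted_before sxs => a b c.
  by case: (fwd) => h1 h2; [exact: le_trans h2|exact: le_trans h1].
have ordx a b : (a < n)%N -> (b < n)%N -> (a < mid)%N -> ~~ (b < mid)%N -> px a <= px b.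
  by move=> *; apply: px_mono; arith.
apply: wp_run => //; rewrite /quadrant_body.
rewrite run_if [beval _ _]/((ivar s 11 + 1 <= ivar s 5)%N) s11 s5 addn1 !run_seq.
case: ifPn => xm'.
  have xm : (x < mid)%N := xm'.
  have sx : ~~ ~~ (x < mid)%N by rewrite negbK.
  have [N1 I1 D1] := @learn_spec s _ _ 13 h x hN s11 xn sx hn br.
  move: (run (learn 13) s) N1 I1 D1 => s1 N1 I1 D1.
  have [i1 i2 i3 i4 i5] := I1; have [n1 n2 n3] := N1.
  have e11 : ivar s1 11 = x by rewrite i2.
  have b1 := @update_best_spec s1 (fun a => a < mid)%N fwd true 12 h x n1 n2 e11 isT xm.
  have fr := frame_run s1 (isT : loopfree (update_best fwd true 12)).
  have sd : same_data s1 (run (update_best fwd true 12) s1).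
    by case: fr => f1 f2 f3 f4; split=> [|a|a]; [apply: f2|apply: f4|apply: f3].
  have eG : iarr (run (update_best fwd true 12) s1) 2 = iarr s1 2 by case: sd.
  split.
  - exact: neighbours_data sd N1.
  - split; first by apply: b1; apply: best_ivar bl; rewrite i2.
    apply: best_other => //; apply: best_ivar br.
    by case: fr => -> // _ _ _; rewrite i2.
  - by move=> a b; rewrite /L1 eG; apply: L1_improves.
  - move=> y yh; rewrite /opposite xm eq_sym eqb_id => ym.
    (* [b] has at least the linear value of [y] and lies in the same quadrant as seen from [x], so
       its L1 distance to [x] is at most that of [y]. *)
    have [//|b [bh bm yb db]] := D1 y yh.
    rewrite /L1 eG; apply: le_trans db _.
    have := ordx _ _ xn (hn _ bh) xm bm; have := ordx _ _ xn (hn _ yh) xm ym.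
    have := ord _ bh; have := ord _ yh; move: yb; rewrite /qv /sgn /d2 /dist2 /=.
    have sq (u v : R) : (u - v) ^+ 2 = (v - u) ^+ 2 by rewrite -opprB sqrrN.
    rewrite (sq (px x) (px b)) (sq (px x) (px y)).
    case: (fwd) => *.
      by apply: dist2_quadrant; lra.
    by rewrite (sq (py x) (py b)) (sq (py x) (py y)); apply: dist2_quadrant; lra.
have xm : ~~ (x < mid)%N := xm'.
have [N1 I1 D1] := @learn_spec s _ _ 12 h x hN s11 xn xm hn bl.
move: (run (learn 12) s) N1 I1 D1 => s1 N1 I1 D1.
have [i1 i2 i3 i4 i5] := I1; have [n1 n2 n3] := N1.
have e11 : ivar s1 11 = x by rewrite i2.
have b1 := @update_best_spec s1 (fun a => ~~ (a < mid)%N) fwd false 13 h x n1 n2 e11 isT xm.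
have fr := frame_run s1 (isT : loopfree (update_best fwd false 13)).
have sd : same_data s1 (run (update_best fwd false 13) s1).
  by case: fr => f1 f2 f3 f4; split=> [|a|a]; [apply: f2|apply: f4|apply: f3].
have eG : iarr (run (update_best fwd false 13) s1) 2 = iarr s1 2 by case: sd.
split.
- exact: neighbours_data sd N1.
- split; last by apply: b1; apply: best_ivar br; rewrite i2.
  apply: best_other => //; apply: best_ivar bl.
  by case: fr => -> // _ _ _; rewrite i2.
- by move=> a b; rewrite /L1 eG; apply: L1_improves.
- move=> y yh; rewrite /opposite (negbTE xm) eq_sym => ym.
  have [|b [bh bm yb db]] := D1 y yh; first by move: ym; case: (y < mid)%N.
  have ym' : (y < mid)%N by move: ym; case: (y < mid)%N.
  rewrite /L1 eG; apply: le_trans db _.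
  have := ordx _ _ (hn _ bh) xn bm xm; have := ordx _ _ (hn _ yh) xn ym' xm.
  have := ord _ bh; have := ord _ yh; move: yb; rewrite /qv /sgn /d2 /dist2 /=.
  have sq (u v : R) : (u - v) ^+ 2 = (v - u) ^+ 2 by rewrite -opprB sqrrN.
  case: (fwd) => *.
    by apply: dist2_quadrant; lra.
  by rewrite (sq (py x) (py b)) (sq (py x) (py y)); apply: dist2_quadrant; lra.
Qed.

Lemma quadrant_data s s' a b : same_data s s' -> L1 s a b -> L1 s' a b.
Proof. by move=> [e _ _]; rewrite /L1 e. Qed.

Lemma quadrant_hook_spec : hook_spec n py quadrant_hook 30 neighbours L1.
Proof.
apply: (@two_scans_spec _ n 2 8 py _ _ false neighbours L1 quadrant_inv).
- exact: neighbours_data.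
- exact: quadrant_data.
- move=> fwd mid h s x v; rewrite !inE => hx [h1 h2]; split;
    [apply: (best_ivar _ h1)|apply: (best_ivar _ h2)];
    by rewrite /= upd_other //; case/orP: hx => /eqP ->.
- by [].
- by [].
- by [].
- by move=> fwd mid s _; split; left; split=> //=; rewrite ?upd_same.
- by case.
- exact: quadrant_body_spec.
Qed.
End Pass1.

(** * Exact nearest neighbours of the isolated points *)

(* Real register 0 holds the largest squared distance found by the first pass. *)
Definition in_strip :=
  RLe (RMul (RSub (RGet 6 (IVar 11)) (RGet 6 (IVar 5))) (RSub (RGet 6 (IVar 11)) (RGet 6 (IVar 5))))
      (RVar 0).

Definition unsettled a :=
  BNot (RLe (RAdd (rdist2 a (IGet 2 a)) (rdist2 a (IGet 2 a))) (RVar 0)).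

(* Integer array 3 lists the unsettled points of the strip, and register 14 is
   its length.  By the packing lemma, only the last 49 of them matter. *)
Definition strip_body (fwd : bool) :=
  If in_strip
    (For 15 (ISub (IVar 14) (ICst 49)) 14 (improve (IGet 3 (IVar 15)) (IVar 11)) ;;
     If (unsettled (IVar 11)) (IPut 3 (IVar 14) (IVar 11) ;; incr 14) Skip)
    Skip.

Definition strip_hook := two_scans (ISet 14 (ICst 0)) strip_body.

(** * Correctness of the exact search *)

Section Pass2.
Context {R : realType}.
Context (n : nat) (px py : nat -> R) (D : R).
Implicit Types (s : state R).
Context (px_mono : forall a b, (a <= b < n)%N -> px a <= px b).
Context (D_gt0 : 0 < D).
Let pt := pt px py.
Let d2 := d2 px py.

Definition near_neighbours s :=
  [/\ neighbours n px py s, rvar s 0 = D, forall a, (a < n)%N -> d2 a (iarr s 2 a) <= D &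
    forall a b, (a < n)%N -> (b < n)%N -> a != b -> d2 a (iarr s 2 a) <= 2 * d2 a b].

Definition settled s a := 2 * d2 a (iarr s 2 a) <= D.

(** A settled point needs no exact neighbour: its tentative one is within sqrt (D / 2), which is a
    lower bound for delta. *)
Let L2 s a b := settled s a \/ d2 a (iarr s 2 a) <= d2 a b.

Let strip mid a := (px a - px mid) ^+ 2 <= D.

Let before (fwd : bool) a b := if fwd then py a <= py b else py b <= py a.

(** [l] is the list kept in integer array 3. Its order and the isolation of its points are what the
    packing argument uses; the last clause says that a strip point is left out only if it is
    settled. *)
Definition strip_inv fwd mid (h : seq nat) s :=
  let l := slice (iarr s 3) 0 (ivar s 14) in
  [/\ uniq l, {subset l <= h}, sorted (before fwd) l,
     forall u, u \in l -> strip mid u /\ forall b, (b < n)%N -> u != b -> D < 4 * d2 u b &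
     forall u, u \in h -> strip mid u -> u \in l \/ settled s u].

Lemma before_trans fwd : transitive (before fwd).
Proof.
by move=> b a c; case: fwd => h1 h2; [exact: le_trans h2|exact: le_trans h1].
Qed.

Lemma beval_unsettled s a : rarr s 6 = px -> rarr s 7 = py -> rvar s 0 = D ->
  beval s (unsettled a) = ~~ settled s (ieval s a).
Proof.
move=> h6 h7 hD; change ((~~ (reval s (rdist2 a (IGet 2 a)) +
  reval s (rdist2 a (IGet 2 a)) <= rvar s 0)) = ~~ settled s (ieval s a)).
by rewrite !(reval_rdist2 _ _ h6 h7) hD /settled mulr_natl mulr2n.
Qed.

Definition closer s s' := forall c, d2 c (iarr s' 2 c) <= d2 c (iarr s 2 c).

Lemma settled_closer s s' a : closer s s' -> settled s a -> settled s' a.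
Proof. by move=> h; apply: le_trans; rewrite ler_pM2l. Qed.

Lemma L2_closer s s' a b : closer s s' -> L2 s a b -> L2 s' a b.
Proof.
move=> hi [h|h]; [left; exact: settled_closer hi h|right].
exact: le_trans (hi a) h.
Qed.

Lemma near_closer s s' : closer s s' -> rvar s' 0 = rvar s 0 -> neighbours n px py s' ->
  near_neighbours s -> near_neighbours s'.
Proof.
move=> h1 h2 hN [_ h3 h4 h5]; split=> //; first by rewrite h2.
  by move=> a an; apply: le_trans (h1 a) (h4 a an).
by move=> a b an bn ab; apply: le_trans (h1 a) (h5 a b an bn ab).
Qed.

(** Otherwise the j-th point and the last 49 ones, whose ordinates lie between its own and that of
    [x], would all be in the square of side 2 sqrt D centred at (px mid, py x), which is too small
    for 50 isolated points. *)
Lemma far_apart fwd mid (l : seq nat) x j :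
  uniq l -> sorted (before fwd) l -> (forall u, u \in l -> before fwd u x) ->
  (forall u, u \in l -> (u < n)%N) ->
  (forall u, u \in l -> strip mid u /\ forall b, (b < n)%N -> u != b -> D < 4 * d2 u b) ->
  (j + 49 < size l)%N -> D < d2 (nth 0%N l j) x.
Proof.
move=> ul sl lx ln lP jl; rewrite ltNge; apply/negP => hd.
(* Index 0 stands for the j-th point, indices 1 to 49 for the last 49 points. *)
pose f i := nth 0%N l (if i == 0%N then j else size l - 50 + i)%N.
have ltf i : (i < 50)%N -> ((if i == 0%N then j else size l - 50 + i)%N < size l)%N.
  by case: eqP; arith.
have fl i : (i < 50)%N -> f i \in l by move=> hi; apply: mem_nth; apply: ltf.
have fj i : (i < 50)%N -> before fwd (nth 0%N l j) (f i).
  move=> hi; apply: (sorted_leq_nth (@before_trans fwd) _ 0%N sl); rewrite ?inE.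
  - by move=> a; case: (fwd) => /=; rewrite /before.
  - exact: (ltf 0%N).
  - exact: ltf.
  - by case: eqP; arith.
have [||i1 [i2 [i12 i2l hc]]] := @packing R D (px mid) (py x) (fun i => pt (f i)) D_gt0.
- by move=> i /fl /lP [].
- move=> i hi; apply: le_trans hd.
  apply: (@le_trans _ _ ((py (nth 0%N l j) - py x) ^+ 2)); last first.
    by rewrite /d2 /dist2 lerDr sqr_ge0.
  have := fj _ hi; have := lx _ (fl _ hi); rewrite /before /=.
  by case: (fwd) => h1 h2; nra.
have i1l : (i1 < 50)%N by arith.
have ne : f i1 != f i2.
  rewrite nth_uniq ?ltf //.
  by case: (i1 =P 0%N); case: (i2 =P 0%N); arith.
have [_ /(_ _ (ln _ (fl _ i2l)) ne)] := lP _ (fl _ i1l).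
by rewrite ltNge (ltW hc).
Qed.

Lemma strip_body_spec fwd s lo mid hi xs h x t :
  ivar s 0 = n -> ivar s 4 = lo -> ivar s 5 = mid -> ivar s 6 = hi ->
  (lo <= mid <= hi)%N -> (lo < hi <= n)%N ->
  perm_eq xs (iota lo (hi - lo)) ->
  sorted (fun i j => if fwd then py i <= py j else py j <= py i) xs ->
  xs = h ++ x :: t -> ivar s 11 = x -> near_neighbours s -> strip_inv fwd mid h s ->
  wp (strip_body fwd) s 210 (fun s' => [/\ near_neighbours s',
    strip_inv fwd mid (rcons h x) s', forall a b, L2 s a b -> L2 s' a b &
    forall y, y \in h -> opposite mid x y -> L2 s' y x]).
Proof.
move=> s0 s4 s5 s6 lmh lhn pxs sxs exs s11 hN hK.
have [hNb hD hle htwo] := hN; have [h6 h7 hG] := hNb.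
have [ul lh sl lP hl] := hK; set l := slice _ _ _ in ul lh sl lP hl.
have inxs a : a \in xs -> (a < n)%N by rewrite (perm_mem pxs) mem_iota => ?; arith.
have xn : (x < n)%N by apply: inxs; rewrite exs mem_cat mem_head orbT.
have hn a : a \in h -> (a < n)%N by move=> ah; apply: inxs; rewrite exs mem_cat ah.
have ord y : y \in h -> before fwd y x.
  by rewrite exs in sxs; apply: sorted_before sxs; apply: before_trans.
have xh : x \notin h.
  have : uniq xs by rewrite (perm_uniq pxs) iota_uniq.
  by rewrite exs cat_uniq /= => /and3P[_ /norP[]].
(* The dividing abscissa lies between the two points, so if one of them is outside the strip, they
   are farther apart than any tentative neighbour. *)
have opp_d y : y \in h -> opposite mid x y -> D < (px x - px mid) ^+ 2 \/ D < (px y - px mid) ^+ 2 ->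
    D < d2 y x.
  move=> /hn yn op hd; apply: (@lt_le_trans _ _ ((px y - px x) ^+ 2)); last first.
    by rewrite /d2 /dist2 lerDl sqr_ge0.
  have [xm|xm] := ltnP x mid; have [ym|ym] := ltnP y mid; rewrite /opposite ?xm ?ym in op.
  - by [].
  - have h1 : px x <= px mid by apply: px_mono; arith.
    have h2 : px mid <= px y by apply: px_mono; arith.
    by case: hd; nra.
  - have h1 : px y <= px mid by apply: px_mono; arith.
    have h2 : px mid <= px x by apply: px_mono; arith.
    by case: hd; nra.
  - by move: op; rewrite !ltnNge xm ym.
have bstrip : beval s in_strip = (strip mid x).
  by rewrite /= h6 hD s11 s5 /strip expr2.
apply: wp_if; rewrite bstrip => hx; last first.
  apply: wp_run => //; split=> //.
    split=> //; first by move=> u /lh; rewrite mem_rcons inE orbC => ->.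
    move=> u; rewrite mem_rcons inE => /orP[/eqP -> h1|]; last exact: hl.
    by rewrite h1 in hx.
  move=> y yh op; right; apply: le_trans (hle _ (hn _ yh)) (ltW _).
  by apply: opp_d => //; left; rewrite ltNge.
apply: (@wp_seq_le _ 205 4) => //.
set a := (ivar s 14 - 49)%N; set cnt := ivar s 14.
pose I i s' := [/\ closer s s', neighbours n px py s' &
  forall j, (a <= j < i)%N -> d2 (iarr s 3 j) (iarr s' 2 (iarr s 3 j)) <= d2 (iarr s 3 j) x].
have inl j : (j < cnt)%N -> iarr s 3 j \in l.
  by move=> hj; apply: map_f; rewrite mem_iota_slice.
have := @wp_for R 15 (ISub (IVar 14) (ICst 49)) 14 (improve (IGet 3 (IVar 15)) (IVar 11)) s 2 I.
set Q := (X in wp _ _ 205 X).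
move=> /(_ Q isT isT isT) hfor; apply: wp_mono (hfor _ _ _ _) _ _ => //; last by rewrite /=; arith.
- by rewrite /=; arith.
- by split=> // j; rewrite /= -/a; arith.
- move=> i s' ib fr i15 i14 [hI hN' hj].
  have [fI fA _ _] := fr.
  have f3 : iarr s' 3 = iarr s 3 by rewrite fA.
  have f11 : ivar s' 11 = x by rewrite fI.
  have il : iarr s 3 i \in l by apply: inl; move: ib; rewrite /= /cnt; arith.
  have ih := lh _ il.
  have e1 : ieval s' (IGet 3 (IVar 15)) = iarr s 3 i by rewrite /= i15 f3.
  have e2 : ieval s' (IVar 11) = x by [].
  have := @improve_spec R n px py s' (IGet 3 (IVar 15)) (IVar 11) hN'.
  rewrite e1 e2 => /(_ (hn _ ih) xn) [|k1 [k2 _ _ _ _] k3].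
    by apply/eqP => e; rewrite -e ih in xh.
  apply: wp_run => // _; split=> //.
    by move=> c; apply: le_trans (k2 c) (hI c).
  move=> j /andP[aj]; rewrite ltnS leq_eqVlt => /orP[/eqP ->//|ji].
  by apply: le_trans (k2 _) _; apply: hj; apply/andP; split.
- move=> s1 fr _ [hI hN1 hj].
  have [fI fA fR fK] := fr.
  have f3 : iarr s1 3 = iarr s 3 by rewrite fA.
  have f11 : ivar s1 11 = x by rewrite fI.
  have f14 : ivar s1 14 = cnt by rewrite fI.
  have fD : rvar s1 0 = D by rewrite fR.
  have near1 : near_neighbours s1 by apply: near_closer hN => //; rewrite fR.
  have learnt y : y \in h -> opposite mid x y -> L2 s1 y x.
    move=> yh op; have hy1 : d2 y (iarr s1 2 y) <= D by case: near1 => _ _ + _; apply; exact: hn.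
    have [sy|sy] := boolP (strip mid y); last first.
      right; apply: le_trans hy1 (ltW _); apply: opp_d => //; right.
      by rewrite ltNge.
    case: (hl _ yh sy) => [yl|]; last by left; apply: settled_closer hI _.
    right; have [j jc ej] : exists2 j, (j < cnt)%N & y = iarr s 3 j.
      by case/mapP: yl => j; rewrite mem_iota_slice => /andP[_ jc] ->; exists j.
    (* Either [y] is among the last 49 stored points and has just been compared with [x], or [x] is
       farther from it than its present neighbour. *)
    have [aj|ja] := leqP a j; first by rewrite ej; apply: hj; rewrite aj.
    apply: le_trans hy1 (ltW _).
    have := @far_apart fwd mid l x j ul sl (fun u ul => ord u (lh u ul)) (fun u ul => hn u (lh u ul)) lP.
    rewrite /l size_slice nth_slice ?subn0 ?add0n -?ej //; apply.
    by move: ja; rewrite /a; arith.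
  apply: wp_if => hb.
    apply: wp_run => //=; rewrite f14 f11 addn1.
    set s2 := iset _ 14 _.
    have e2 : iarr s2 2 = iarr s1 2 by [].
    have el : slice (iarr s2 3) 0 (ivar s2 14) = rcons l x.
      rewrite /= !upd_same slice_recr // upd_same f3; congr rcons.
      by apply: eq_slice => i ib; rewrite upd_other //; apply/eqP; arith.
    have c2 : closer s s2 by [].
    split=> //.
    + rewrite /strip_inv el; split.
      * by rewrite rcons_uniq ul andbT; apply: contra xh => /lh.
      * by move=> u; rewrite !mem_rcons !inE => /orP[->//|/lh ->]; rewrite orbT.
      * move: sl lh; case: (l) => [//|z l'] /= pl lh'; rewrite rcons_path pl /=.
        by apply: ord; apply: lh'; apply: mem_last.
      * move=> u; rewrite mem_rcons inE => /orP[/eqP ->|/lP //]; split=> // b bn xb.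
        (* Isolation of a new stored point: being unsettled gives a factor 2, the approximation of
           the first pass another one. *)
        have hb2 : D < 2 * d2 x (iarr s1 2 x).
          case: (hN1) => g6 g7 _; move: hb.
          by rewrite beval_unsettled //= f11 ltNge.
        have : d2 x (iarr s1 2 x) <= 2 * d2 x b by case: near1 => _ _ _; apply.
        lra.
      * move=> u; rewrite !mem_rcons !inE => /orP[->|uh su]; first by left.
        by case: (hl _ uh su) => [->|hs]; [left; rewrite orbT|right; apply: settled_closer c2 _].
    + by move=> u v; apply: L2_closer.
  apply: wp_run => //=; split=> //.
    rewrite /strip_inv f14 f3 -/l; split=> //.
      by move=> u /lh; rewrite mem_rcons inE orbC => ->.
    move=> u; rewrite mem_rcons inE => /orP[/eqP -> _|uh su]; last first.
      by case: (hl _ uh su); [left|right; apply: settled_closer hI _].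
    right; case: (hN1) => g6 g7 _; move: hb.
    by rewrite beval_unsettled //= f11 negbK.
  by move=> u v; apply: L2_closer.
Qed.

Lemma near_data s s' : same_data s s' -> near_neighbours s -> near_neighbours s'.
Proof.
move=> sd [h1 h2 h3 h4]; have [e _ er] := sd; split; rewrite ?er ?e //.
exact: neighbours_data sd h1.
Qed.

Lemma strip_data s s' a b : same_data s s' -> L2 s a b -> L2 s' a b.
Proof. by move=> [e _ _]; rewrite /L2 /settled e. Qed.

Lemma strip_hook_spec : hook_spec n py strip_hook 432 near_neighbours L2.
Proof.
apply: (@two_scans_spec _ n 1 210 py _ _ true near_neighbours L2 strip_inv).
- exact: near_data.
- exact: strip_data.
- move=> fwd mid h s x v; rewrite !inE => hx; rewrite /strip_inv /= upd_other //.
  by case/orP: hx => /eqP ->.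
- by [].
- by [].
- by [].
- by move=> fwd mid s _; rewrite /strip_inv /= upd_same slice_nil; split.
- by case.
- exact: strip_body_spec.
Qed.
End Pass2.

(** * Assembling the neighbour search *)

Definition reindex :=
  For 10 (ICst 0) 0
    (RPut 6 (IVar 10) (RGet 0 (IGet 0 (IVar 10))) ;;
     RPut 7 (IVar 10) (RGet 1 (IGet 0 (IVar 10))) ;;
     IPut 2 (IVar 10) (ISub (ICst 1) (IVar 10))).

Definition max_step :=
  If (RLe (rdist2 (IVar 10) (IGet 2 (IVar 10))) (RVar 0)) Skip
    (RSet 0 (rdist2 (IVar 10) (IGet 2 (IVar 10)))).

Definition find_neighbours :=
  msort 0 Skip ;; reindex ;; msort 7 quadrant_hook ;;
  (RSet 0 (RCst 0) ;; For 10 (ICst 0) 0 max_step) ;;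
  msort 7 strip_hook.

Definition find_neighbours_time n :=
  (sort_time n 1 + (n * 5 + 2) + sort_time n 30 + (n * 4 + 3) + sort_time n 432)%N.

Section Near.
Context {R : realType}.
Implicit Types (s : state R) (l : seq (plane R)).

Lemma max_loop_spec n px py s : (0 < n)%N -> ivar s 0 = n -> neighbours n px py s ->
  (forall a b, (a < n)%N -> (b < n)%N -> a != b -> 0 < d2 px py a b) ->
  wp (RSet 0 (RCst 0) ;; For 10 (ICst 0) 0 max_step) s (n * 4 + 3) (fun s' =>
    [/\ 0 < rvar s' 0, forall a, (a < n)%N -> d2 px py a (iarr s 2 a) <= rvar s' 0 &
      exists2 a, (a < n)%N & rvar s' 0 = d2 px py a (iarr s 2 a)]).
Proof.
move=> n0 s0 [h6 h7 hG] pos.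
apply: (@wp_seq_le _ 1 (n * 4 + 2)); first by arith.
apply: wp_run => //=; set s1 := rset s 0 _.
pose I k s' := [/\ 0 <= rvar s' 0, forall a, (a < k)%N -> d2 px py a (iarr s 2 a) <= rvar s' 0 &
   rvar s' 0 = 0 \/ exists2 a, (a < n)%N & rvar s' 0 = d2 px py a (iarr s 2 a)].
have := @wp_for R 10 (ICst 0) 0 max_step s1 2 I; rewrite /= s0 subn0; apply=> //.
- by split; rewrite /= ?upd_same //; left.
- move=> k s' kn [fI fA _ fK] h10 _ [h1 h2 h3]; apply: wp_run => // _.
  have e6 : rarr s' 6 = px by rewrite fK.
  have e7 : rarr s' 7 = py by rewrite fK.
  have e2 : iarr s' 2 = iarr s 2 by rewrite fA.
  have E : reval s' (rdist2 (IVar 10) (IGet 2 (IVar 10))) = d2 px py k (iarr s 2 k).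
    by rewrite (reval_rdist2 _ _ e6 e7) /= h10 e2.
  rewrite /max_step run_if.
  rewrite (_ : beval _ _ = (d2 px py k (iarr s 2 k) <= rvar s' 0)); last by rewrite -E.
  case: (leP (d2 px py k (iarr s 2 k)) (rvar s' 0)) => hk.
    split=> // a; rewrite ltnS leq_eqVlt => /orP[/eqP -> //|]; exact: h2.
  rewrite [run _ _]/(rset s' 0 (reval s' _)) E; split.
  + by rewrite /= upd_same dist2_ge0.
  + move=> a; rewrite /= upd_same ltnS leq_eqVlt => /orP[/eqP -> //|/h2 h].
    exact: le_trans h (ltW hk).
  + by right; exists k => //; rewrite /= upd_same.
- move=> s' _ _ [_ h2 h3].
  have p0 : 0 < rvar s' 0.
    apply: lt_le_trans (h2 _ n0); have /andP[? ?] := hG _ n0.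
    by apply: pos => //; rewrite eq_sym.
  by split=> //; case: h3 => // e; rewrite e ltxx in p0.
Qed.

(** Renumbering by abscissa turns the blocks of the later sorts into slabs. The truncated [1 - k]
    gives point 0 the neighbour 1 and all others the neighbour 0: a valid start, as there are at
    least two points and none is its own neighbour. *)
Lemma reindex_spec n s : ivar s 0 = n ->
  wp reindex s (n * 5 + 2) (fun s' => forall k, (k < n)%N ->
    [/\ rarr s' 6 k = rarr s 0 (iarr s 0 k), rarr s' 7 k = rarr s 1 (iarr s 0 k) &
        iarr s' 2 k = (1 - k)%N]).
Proof.
move=> s0.
have := @wp_for R 10 (ICst 0) 0
  (RPut 6 (IVar 10) (RGet 0 (IGet 0 (IVar 10))) ;;
     RPut 7 (IVar 10) (RGet 1 (IGet 0 (IVar 10))) ;;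
     IPut 2 (IVar 10) (ISub (ICst 1) (IVar 10))) s 3 (fun i s' => forall k, (k < i)%N ->
    [/\ rarr s' 6 k = rarr s 0 (iarr s 0 k), rarr s' 7 k = rarr s 1 (iarr s 0 k) &
        iarr s' 2 k = (1 - k)%N]).
rewrite /= s0 subn0; apply=> //.
move=> i s' ib [fI fA _ fK] h10 _ hI; apply: wp_run => // _ k.
have e0 : rarr s' 0 = rarr s 0 by rewrite fK.
have e1 : rarr s' 1 = rarr s 1 by rewrite fK.
have eO : iarr s' 0 = iarr s 0 by rewrite fA.
rewrite ltnS leq_eqVlt /= h10 e0 eO => /orP[/eqP ->|ki].
  by rewrite /upd /= !eqxx e1.
have ne : (k == i) = false by apply/eqP; arith.
by rewrite /upd /= ne; apply: hI.
Qed.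

Lemma sorted_block_all n (kf : nat -> R) f : sorted_block kf f 0 n ->
  perm_eq (slice f 0 n) (iota 0 n) /\
  forall a b, (a <= b < n)%N -> kf (f a) <= kf (f b).
Proof.
rewrite /sorted_block subn0 => /andP[pe so]; split=> // a b /andP[ab bn].
have tr : transitive (le_key kf) by move=> y x z; apply: le_trans.
have an : (a < n)%N by arith.
have := sorted_leq_nth tr _ 0%N so a b; rewrite !inE size_slice subn0.
rewrite !nth_slice ?subn0 // !add0n; apply=> //.
by move=> x; apply: lexx.
Qed.

(** This pins [m] down as the square of delta without asking every recorded neighbour to be a
    nearest one. *)
Definition neighbour_scale n px py s (m : R) :=
  [/\ neighbours n px py s, forall a, (a < n)%N -> d2 px py a (iarr s 2 a) <= m &
    exists2 a, (a < n)%N & forall b, (b < n)%N -> b != a -> m <= d2 px py a b].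

Lemma find_neighbours_spec l : uniq l -> (2 <= size l)%N ->
  wp find_neighbours (input l) (find_neighbours_time (size l)) (fun s =>
    exists px py m, [/\ neighbour_scale (size l) px py s m, ivar s 0 = size l &
      perm_eq [seq pt px py k | k <- iota 0 (size l)] l]).
Proof.
move=> ul l2; set n := size l; have n0 : (0 < n)%N by arith.
rewrite /find_neighbours_time.
have i0 : ivar (input l) 0 = n by [].
apply: (@wp_seq_le _ (sort_time n 1) ((n * 5 + 2) + sort_time n 30 + (n * 4 + 3) + sort_time n 432)).
  by arith.
apply: wp_frame.
pose kf := rarr (input l) 0.
have hs : hook_spec n kf Skip 1 (fun _ => True) (fun _ _ _ => True).
  move=> s lo mid hi *; apply: wp_run => //=; arith.
have H0 := @msort_spec R n 0 1 Skip kf _ _ hs isT isT isT (fun _ _ _ _ => I)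
  (fun _ _ _ _ _ _ => I) (input l) n0 i0 erefl I.
apply: wp_mono H0 (leqnn _) _ => s1 [_ /sorted_block_all [pO mO] _] [fI1 fA1 fR1 fK1].
have s1n : ivar s1 0 = n by rewrite fI1.
apply: (@wp_seq_le _ (n * 5 + 2) (sort_time n 30 + (n * 4 + 3) + sort_time n 432)); first by arith.
apply: wp_frame; apply: wp_mono (reindex_spec s1n) (leqnn _) _ => s2 h2 [fI2 fA2 fR2 fK2].
have s2n : ivar s2 0 = n by rewrite fI2.
set px := rarr s2 6; set py := rarr s2 7.
have On k : (k < n)%N -> (iarr s1 0 k < n)%N.
  move=> kn; have : iarr s1 0 k \in iota 0 n.
    by rewrite -(perm_mem pO) map_f // mem_iota_slice.
  by rewrite mem_iota; arith.
have ptE k : (k < n)%N -> pt px py k = nth 0 l (iarr s1 0 k).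
  move=> kn; have [e6 e7 _] := h2 k kn; rewrite /pt /px /py e6 e7 !fK1 //= /upd /=.
  by rewrite !(nth_map 0) ?On //; case: (nth 0 l _).
have pl : perm_eq [seq pt px py k | k <- iota 0 n] l.
  rewrite (_ : map _ _ = [seq nth 0 l k | k <- slice (iarr s1 0) 0 n]); last first.
    rewrite /slice subn0 -map_comp; apply/eq_in_map => k.
    by rewrite mem_iota => kn; apply: ptE; arith.
  apply: perm_trans (perm_map _ pO) _.
  by rewrite (_ : map _ _ = l) // -[RHS](mkseq_nth 0).
have pos a b : (a < n)%N -> (b < n)%N -> a != b -> 0 < d2 px py a b.
  move=> an bn ab; apply: dist2_gt0.
  have sz : size [seq pt px py k | k <- iota 0 n] = n by rewrite size_map size_iota.
  have E k : (k < n)%N -> pt px py k = nth 0 [seq pt px py k | k <- iota 0 n] k.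
    by move=> kn; rewrite (nth_map 0%N) ?size_iota // nth_iota.
  by rewrite !E // nth_uniq ?sz // (perm_uniq pl).
have px_mono a b : (a <= b < n)%N -> px a <= px b.
  move=> hab; have an : (a < n)%N by arith.
  have bn : (b < n)%N by arith.
  have [ea _ _] := h2 a an; have [eb _ _] := h2 b bn.
  by rewrite /px ea eb !fK1 //; apply: mO.
have N2 : neighbours n px py s2.
  split=> // a an; have [_ _ ->] := h2 a an.
  by apply/andP; split; [arith|apply/eqP; arith].
apply: (@wp_seq_le _ (sort_time n 30) ((n * 4 + 3) + sort_time n 432)); first by arith.
apply: wp_frame.
have qf : forall s s', sort_frame s s' -> same_data s s'.
  by move=> u v [_ f2 f3 f4]; split=> [|a|a]; [apply: f2|apply: f4|apply: f3].
have H1 := @msort_spec R n 7 30 quadrant_hook py _ _ (quadrant_hook_spec px_mono)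
  isT isT isT (fun u v h => neighbours_data (qf u v h))
  (fun u v a b h => @quadrant_data R px py u v a b (qf u v h)) s2 n0 s2n erefl N2.
apply: wp_mono H1 (leqnn _) _ => s3 [N3 _ L3] [fI3 fA3 fR3 fK3].
have s3n : ivar s3 0 = n by rewrite fI3.
apply: (@wp_seq_le _ (n * 4 + 3) (sort_time n 432)); first by arith.
apply: wp_frame; apply: wp_mono (max_loop_spec n0 s3n N3 pos) (leqnn _) _.
move=> s4 [D0 Dmax [aD aDn eD]] [fI4 fA4 fR4 fK4].
have s4n : ivar s4 0 = n by rewrite fI4.
have e42 : iarr s4 2 = iarr s3 2 by rewrite fA4.
set D := rvar s4 0 in D0 Dmax eD.
have N4 : near_neighbours n px py D s4.
  split=> //; rewrite ?e42 //.
  by case: N3 => h6 h7 hG; split; rewrite ?fK4 ?e42.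
have s47 : rarr s4 7 = py by case: N4 => -[].
have H2 := @msort_spec R n 7 432 strip_hook py _ _ (strip_hook_spec px_mono D0)
  isT isT isT (fun u v h => near_data (qf u v h))
  (fun u v a b h => @strip_data R px py D u v a b (qf u v h)) s4 n0 s4n s47 N4.
apply: wp_frame; apply: wp_mono H2 (leqnn _) _ => s5 [N5 _ L5] [fI5 _ _ _].
have [nb5 _ _ _] := N5.
pose f (i : 'I_n) := d2 px py i (iarr s5 2 i).
have [i _ imax] := @arg_maxP _ R _ (Ordinal n0) predT f isT.
exists px, py, (f i); split=> //; last by rewrite fI5.
split=> //; first by move=> a an; exact: (imax (Ordinal an) isT).
(* If the point [i] with the largest final distance is settled, that distance squared is at most
   [D / 2], and the point that attained [D] in the first pass has no point closer than this.
   Otherwise the neighbour of [i] is exact. *)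
have [st|/negP nst] := boolP (settled px py D s5 i).
  exists aD => // b bn ba.
  have : d2 px py aD (iarr s3 2 aD) <= 2 * d2 px py aD b by apply: L3 => //; rewrite eq_sym.
  by move: st; rewrite /settled -/(f i) eD; lra.
exists i => // b bn bi.
by have := L5 i b (ltn_ord i) bn; rewrite eq_sym bi => /(_ isT) [].
Qed.
End Near.

(** * Star forests *)

(* Nonzero entries of integer array 4 mark the matched points, whose neighbour is
   redirected to their partner. *)
Definition match_step :=
  If (BAnd (ILe (IGet 4 (IVar 10)) (ICst 0)) (ILe (IGet 4 (IGet 2 (IVar 10))) (ICst 0)))
    (IPut 4 (IVar 10) (ICst 1) ;; IPut 4 (IGet 2 (IVar 10)) (ICst 1) ;;
     IPut 2 (IGet 2 (IVar 10)) (IVar 10))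
    Skip.

(* The leaves of the star with centre c are stored in integer array 6 from
   index 6 c on, and their number is entry c of integer array 5. *)
Definition six e := IAdd e (IAdd e (IAdd e (IAdd e (IAdd e e)))).

Definition leaf_exp i := IGet 6 (IAdd (six (IVar 11)) (ICst i)).

Definition close_test (ij : nat * nat) :=
  let a := leaf_exp ij.1 in let b := leaf_exp ij.2 in
  BNot (BAnd (BNot (RLe (rdist2 a b) (rdist2 a (IVar 11))))
             (BNot (RLe (rdist2 a b) (rdist2 b (IVar 11))))).

(** The last two of the six leaves fill the gaps left by leaves i < j. Slot 4 is read after slot j
    has been overwritten, so for j = 4 it already contains leaf 5. The split leaf i becomes the
    centre of leaf j. *)
Definition split_pair (ij : nat * nat) :=
  let slot k := IAdd (six (IVar 11)) (ICst k) in
  ISet 13 (leaf_exp ij.1) ;; ISet 14 (leaf_exp ij.2) ;;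
  IPut 6 (slot ij.2) (leaf_exp 5) ;; IPut 6 (slot ij.1) (leaf_exp 4) ;;
  IPut 5 (IVar 11) (ICst 4) ;;
  IPut 6 (six (IVar 13)) (IVar 14) ;; IPut 5 (IVar 13) (ICst 1).

Definition leaf_pairs := [seq (i, j) | j <- iota 0 6, i <- iota 0 j]%N.

Definition split_star :=
  foldr (fun ij k => If (close_test ij) (split_pair ij) k) Skip leaf_pairs.

Definition push_leaf :=
  ISet 11 (IGet 2 (IVar 10)) ;; ISet 12 (IGet 5 (IVar 11)) ;;
  IPut 6 (IAdd (six (IVar 11)) (IVar 12)) (IVar 10) ;;
  IPut 5 (IVar 11) (IAdd (IVar 12) (ICst 1)).

Definition push := push_leaf ;; If (ILe (ICst 5) (IVar 12)) split_star Skip.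

Definition push_step (matched : bool) :=
  If (BAnd (if matched then ILe (ICst 1) (IGet 4 (IVar 10)) else ILe (IGet 4 (IVar 10)) (ICst 0))
           (ILe (IGet 5 (IVar 10)) (ICst 0)))
    push Skip.

Definition make_stars :=
  For 10 (ICst 0) 0 match_step ;;
  For 10 (ICst 0) 0 (push_step false) ;;
  For 10 (ICst 0) 0 (push_step true).

(** * The star forest as an invariant *)

Section Forest.
Context {R : realType}.
Context (n : nat) (px py : nat -> R) (m : R).
Implicit Types (s : state R) (F M : nat -> nat) (lst : nat -> seq nat).
Let d2 := d2 px py.

Definition links F := forall a, (a < n)%N -> [/\ (F a < n)%N, F a != a & d2 a (F a) <= m].

(** Redirecting links to partners makes [F] an involution on the marked points. *)
Definition matching F M :=
  (forall a, (a < n)%N -> M a != 0%N -> F (F a) = a /\ M (F a) != 0%N).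

(** A leaf need not hang on its neighbour [F p], since splitting may have moved it, but [F p] still
    has leaves. For partners p and c this shows that c is no leaf as long as p has none, so p can be
    attached to c. *)
Definition forest (done : pred nat) F lst :=
  [/\ forall c p, (c < n)%N -> p \in lst c ->
        [/\ (p < n)%N, d2 p c <= m, lst p = [::], done p & lst (F p) != [::]],
      forall c, (c < n)%N -> uniq (lst c),
      forall c c' p, (c < n)%N -> (c' < n)%N -> p \in lst c -> p \in lst c' -> c = c' &
      forall p, (p < n)%N -> done p -> lst p != [::] \/ exists2 c, (c < n)%N & p \in lst c].

Lemma d2C a b : d2 a b = d2 b a. Proof. exact: dist2C. Qed.

Lemma forest_ext done done' F lst lst' : (forall p, (p < n)%N -> done p = done' p) ->
  (forall c, (c < n)%N -> lst c = lst' c) -> links F -> forest done F lst -> forest done' F lst'.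
Proof.
move=> ed el lF [f1 f2 f3 f4]; split.
- move=> c p cn; rewrite -el // => pc; have [h1 h2 h3 h4 h5] := f1 c p cn pc.
  by have [h6 _ _] := lF p h1; rewrite -ed // -!el.
- by move=> c cn; rewrite -el //; apply: f2.
- by move=> c c' p cn cn'; rewrite -!el //; apply: f3.
- move=> p pn; rewrite -ed // -el // => /(f4 _ pn)[|[c cn pc]]; first by left.
  by right; exists c; rewrite -?el.
Qed.

(** Covers points that have become centres before their turn, for instance by a split. *)
Lemma forest_done done F lst p : lst p != [::] ->
  forest done F lst -> forest (fun q => done q || (q == p)) F lst.
Proof.
move=> lp [f1 f2 f3 f4]; split=> //.
  by move=> c q cn qc; have [h1 h2 h3 h4 h5] := f1 c q cn qc; rewrite h4.
by move=> q qn /orP[/(f4 _ qn)//|/eqP ->]; left.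
Qed.

Lemma forest_push done F lst p c : links F -> (p < n)%N -> c = F p -> ~~ done p ->
  lst p = [::] -> (forall c', (c' < n)%N -> c \notin lst c') ->
  forest done F lst ->
  forest (fun q => done q || (q == p)) F
    (fun c' => if c' == c then rcons (lst c) p else lst c').
Proof.
move=> lF pn ec dp lp cfree [f1 f2 f3 f4].
have [cn cp dpc] := lF p pn; rewrite -ec in cn cp dpc.
have pfree c' : (c' < n)%N -> p \notin lst c'.
  by move=> hc; apply/negP => /(f1 _ _ hc)[_ _ _]; rewrite (negbTE dp).
have mem c' q : (c' < n)%N ->
    q \in (if c' == c then rcons (lst c) p else lst c') =
    (q \in lst c') || ((c' == c) && (q == p)).
  by move=> hc; case: (c' =P c) => [->|_]; rewrite ?orbF // mem_rcons inE orbC.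
have ne c' : lst c' != [::] -> (if c' == c then rcons (lst c) p else lst c') != [::].
  by case: (c' =P c) => // _ _; case: (lst c).
split.
- move=> c' q hc; rewrite mem // => /orP[qc|/andP[/eqP -> /eqP ->]].
    have [h1 h2 h3 h4 h5] := f1 c' q hc qc; split; rewrite ?h4 //; last exact: ne.
    by case: (q =P c) => // e; move: qc; rewrite e (negbTE (cfree _ hc)).
  split=> //; first by rewrite eq_sym (negbTE cp).
    by rewrite eqxx orbT.
  by rewrite -ec eqxx; case: (lst c).
- move=> c' hc; case: (c' =P c) => [_|_]; last exact: f2.
  by rewrite rcons_uniq pfree // f2.
- move=> c1 c2 q h1 h2; rewrite !mem //.
  move=> /orP[q1|/andP[/eqP e1 /eqP eq1]] /orP[q2|/andP[/eqP e2 /eqP eq2]].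
  + exact: f3 q1 q2.
  + by move: q1; rewrite eq2 (negbTE (pfree _ h1)).
  + by move: q2; rewrite eq1 (negbTE (pfree _ h2)).
  + by rewrite e1 e2.
- move=> q qn /orP[/(f4 _ qn)[h|[c' hc qc]]|/eqP ->].
  + by left; apply: ne.
  + by right; exists c' => //; rewrite mem // qc.
  + by right; exists c => //; rewrite mem // !eqxx orbT.
Qed.

(** The leaf [u] has no leaves and is free to become the centre of [v]; as [L] is nonempty, [c]
    stays a centre, so no point loses that role. *)
Lemma forest_split done F lst c u v L : links F -> (c < n)%N ->
  perm_eq (lst c) [:: u, v & L] -> L != [::] -> d2 u v <= m ->
  forest done F lst ->
  forest done F (fun c' => if c' == u then [:: v] else if c' == c then L else lst c').
Proof.
move=> lF cn pc L0 duv [f1 f2 f3 f4].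
have inc x : x \in lst c = [|| x == u, x == v | x \in L] by rewrite (perm_mem pc) !inE.
have uc : u \in lst c by rewrite inc eqxx.
have vc : v \in lst c by rewrite inc eqxx orbT.
have := f2 c cn; rewrite (perm_uniq pc) /= !inE negb_or -andbA => /and4P[uv uL vL ulL].
have [un _ u0 du Fu] := f1 c u cn uc; have [vn _ v0 dv Fv] := f1 c v cn vc.
have nec : lst c != [::] by apply/eqP => e; rewrite e in uc.
have uc' : u != c by apply/eqP => e; rewrite -e u0 in nec.
pose lst' c' := if c' == u then [:: v] else if c' == c then L else lst c'.
have ne c' : lst c' != [::] -> lst' c' != [::] by rewrite /lst'; case: (c' =P u) => // _; case: (c' =P c).
have mem c' q : (c' < n)%N -> q \in lst' c' ->
    (c' = u /\ q = v) \/ [/\ q \in lst c', c' != u, q != u & q != v].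
  move=> hc; rewrite /lst'; case: (c' =P u) => [->|/eqP cu]; first by rewrite inE => /eqP; left.
  case: (c' =P c) => [->|/eqP cc] qc; right.
    split; [by rewrite inc qc !orbT|by []| |].
      by apply: contraNneq uL => <-.
    by apply: contraNneq vL => <-.
  by split=> //; apply: contraNneq cc => e; rewrite e in qc; rewrite (f3 _ _ _ hc cn qc).
have mem' c' q : (c' < n)%N -> q \in lst c' -> q != u -> q != v -> q \in lst' c'.
  rewrite /lst' => hc qc qu qv; case: (c' =P u) => [e|_]; first by rewrite e u0 in qc.
  by case: (c' =P c) => [e|//]; move: qc; rewrite e inc (negbTE qu) (negbTE qv).
split.
- move=> c' q hc /(mem _ _ hc)[[-> ->]|[qc cu qu qv]].
    split=> //; first by rewrite d2C.
      rewrite eq_sym (negbTE uv); case: (v =P c) => // e.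
      by move: nec; rewrite -e v0.
    exact: ne.
  have [h1 h2 h3 h4 h5] := f1 c' q hc qc; split=> //; last exact: ne.
  rewrite (negbTE qu); case: (q =P c) => // e; by move: nec; rewrite -e h3.
- by move=> c' hc; case: (c' =P u) => // _; case: (c' =P c) => // _; apply: f2.
- move=> c1 c2 q h1 h2 /(mem _ _ h1)[[e1 q1]|[q1 _ _ qv1]] /(mem _ _ h2)[[e2 q2]|[q2 _ _ qv2]].
  + by rewrite e1 e2.
  + by rewrite q1 eqxx in qv2.
  + by rewrite q2 eqxx in qv1.
  + exact: f3 q1 q2.
- move=> q qn /(f4 _ qn)[h|[c' hc qc]]; first by left; apply: ne.
  have [->|qu] := eqVneq q u; first by left; rewrite /= ?eqxx.
  have [->|qv] := eqVneq q v; first by right; exists u; rewrite //= ?eqxx mem_head.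
  by right; exists c' => //; apply: mem'.
Qed.

(** Every point is a centre or a leaf, never both, and a leaf of one centre only. *)
Lemma forest_perm F lst : forest predT F lst ->
  perm_eq (flatten [seq (if nilp (lst c) then [::] else c :: lst c) | c <- iota 0 n]) (iota 0 n).
Proof.
move=> [f1 f2 f3 f4]; pose star c := if nilp (lst c) then [::] else c :: lst c.
have star_mem c x : x \in star c -> ~~ nilp (lst c) /\ ((x = c) \/ x \in lst c).
  by rewrite /star; case: ifP => // h; rewrite inE => /orP[/eqP ->|]; split; auto.
have leaf c x : (c < n)%N -> x \in lst c -> nilp (lst x).
  by move=> cn /(f1 _ _ cn)[_ _ -> _ _].
apply: uniq_perm; rewrite ?iota_uniq //.
  have : all (fun c => c < n)%N (iota 0 n) by apply/allP => c; rewrite mem_iota.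
  have := iota_uniq 0 n; elim: (iota 0 n) => //= c l IH /andP[cl ul] /andP[cn ln].
  rewrite -/(star c) cat_uniq IH // andbT; apply/andP; split.
    rewrite /star; case: ifP => //= h; rewrite f2 // andbT.
    by apply/negP => /(leaf _ _ cn); rewrite h.
  apply/hasPn => x /flatten_mapP[c' cl' xc']; apply/negP => xc.
  have hc' := allP ln _ cl'.
  have [h1 [e1|e1]] := star_mem _ _ xc; have [h2 [e2|e2]] := star_mem _ _ xc'.
  - by rewrite -e1 e2 cl' in cl.
  - by have := leaf _ _ hc' e2; rewrite e1 (negbTE h1).
  - by have := leaf _ _ cn e1; rewrite e2 (negbTE h2).
  - by rewrite (f3 _ _ _ cn hc' e1 e2) cl' in cl.
move=> x; rewrite mem_iota add0n /=; apply/flatten_mapP/idP.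
  move=> [c]; rewrite mem_iota add0n => /= cn xc.
  by have [_ [->//|/(f1 _ _ cn)[]]] := star_mem _ _ xc.
move=> xn; case: (f4 x xn isT) => [h|[c cn xc]].
  exists x; first by rewrite mem_iota.
  by rewrite /nilp size_eq0 (negbTE h) mem_head.
exists c; first by rewrite mem_iota.
by case: ifP => h; [move/nilP: h xc => ->|rewrite inE xc orbT].
Qed.

End Forest.

(** * Correctness of the matching and of the stars *)

Section Push.
Context {R : realType}.
Context (n : nat) (px py : nat -> R) (m : R).
Implicit Types (s : state R) (F M : nat -> nat) (lst : nat -> seq nat).
Let d2 := d2 px py.
Let links := links n px py m.
Let forest := forest n px py m.

Lemma match_loop_spec s : ivar s 0 = n -> links (iarr s 2) -> (forall a, iarr s 4 a = 0%N) ->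
  wp (For 10 (ICst 0) 0 match_step) s (n * 6 + 2) (fun s' =>
    [/\ links (iarr s' 2), matching n (iarr s' 2) (iarr s' 4) &
      forall p, (p < n)%N -> iarr s' 4 p = 0%N -> iarr s' 4 (iarr s' 2 p) != 0%N]).
Proof.
move=> s0 lF M0.
pose I k s' := [/\ links (iarr s' 2), matching n (iarr s' 2) (iarr s' 4) &
      forall p, (p < k)%N -> iarr s' 4 p = 0%N -> iarr s' 4 (iarr s' 2 p) != 0%N].
have := @wp_for R 10 (ICst 0) 0 match_step s 4 I; rewrite /= s0 subn0; apply=> //.
  by split=> // a an; rewrite /= M0.
move=> p s' pn [fI _ _ _] h10 _ [lF' mF' hM]; apply: wp_run => // _.
rewrite /match_step run_if.
set F := iarr s' 2 in lF' mF' hM *; set M := iarr s' 4 in mF' hM *.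
have [Fn Fp dF] := lF' p pn.
rewrite (_ : beval _ _ = (M p == 0%N) && (M (F p) == 0%N)); last first.
  by rewrite /= h10 !leqn0.
case: ifPn => [/andP[/eqP Mp /eqP Mq]|hc]; last first.
  split=> // q; rewrite ltnS leq_eqVlt => /orP[/eqP ->|]; last exact: hM.
  by move: hc; rewrite negb_and => /orP[/eqP //|].
set q := F p in Fn Fp dF Mq *.
have -> : run (IPut 4 (IVar 10) (ICst 1) ;; IPut 4 (IGet 2 (IVar 10)) (ICst 1) ;;
     IPut 2 (IGet 2 (IVar 10)) (IVar 10)) s' = iput (iput (iput s' 4 p 1) 4 q 1) 2 q p.
  by rewrite /= h10.
set s2 := iset _ 10 _.
have eF a : iarr s2 2 a = if a == q then p else F a by [].
have eM a : iarr s2 4 a = if a == q then 1%N else if a == p then 1%N else M a by [].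
have pq : (p == q) = false by rewrite eq_sym (negbTE Fp).
split.
- move=> a an; rewrite eF; case: eqP => [->|_]; last exact: lF'.
  by rewrite pq; split=> //; rewrite /d2 d2C.
- move=> a an; rewrite !eM !eF; case: (a =P q) => [->|/eqP aq].
    by rewrite pq eqxx /= -/q.
  case: (a =P p) => [->|/eqP ap]; first by rewrite -/q eqxx.
  move=> /(mF' _ an)[h1 h2].
  have Faq : (F a == q) = false by apply/eqP => e; rewrite e Mq in h2.
  have Fap : (F a == p) = false by apply/eqP => e; rewrite e Mp in h2.
  by rewrite Faq Fap.
- move=> a; rewrite ltnS leq_eqVlt !eM !eF.
  case: (a =P q) => // /eqP aq; case: (a =P p) => //= /eqP ap ha /(hM _ ha) h.
  by case: (F a =P q) => // _; case: (F a =P p).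
Qed.

(** The value of [six], a sum because the machine does not multiply integers. Six slots are needed
    although at most five leaves remain: the sixth is occupied between [push_leaf] and
    [split_star]. *)
Definition base c := (c + (c + (c + (c + (c + c)))))%N.

Definition leaves s c := mkseq (fun i => iarr s 6 (base c + i)) (iarr s 5 c).

Lemma base_inj c c' i i' : (i < 6)%N -> (i' < 6)%N -> c != c' ->
  (base c + i == base c' + i')%N = false.
Proof. by rewrite /base => *; apply/eqP; arith. Qed.

Lemma size_leaves s c : size (leaves s c) = iarr s 5 c.
Proof. by rewrite size_mkseq. Qed.

Lemma push_leaf_spec s p c k : ivar s 10 = p -> iarr s 2 p = c -> iarr s 5 c = k ->
  (forall c', iarr s 5 c' <= 5)%N ->
  let s' := run push_leaf s in
  [/\ ivar s' 11 = c, ivar s' 12 = k,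
    forall c', iarr s' 5 c' = if c' == c then k.+1 else iarr s 5 c' &
    forall c', leaves s' c' = if c' == c then rcons (leaves s c) p else leaves s c'].
Proof.
move=> h10 h2 h5 le5; rewrite /push_leaf !run_seq.
rewrite [run (ISet 11 _) s]/(iset s 11 (iarr s 2 (ivar s 10))) h10 h2.
set s1 := iset s 11 c.
have -> : run (ISet 12 (IGet 5 (IVar 11))) s1 = iset s1 12 k by rewrite /s1 /= upd_same h5.
set s2 := iset s1 12 k.
have -> : run (IPut 6 (IAdd (six (IVar 11)) (IVar 12)) (IVar 10)) s2 =
  iput s2 6 (base c + k) p by rewrite /s2 /= /upd /= h10.
set s3 := iput s2 6 _ p.
have -> : run (IPut 5 (IVar 11) (IAdd (IVar 12) (ICst 1))) s3 = iput s3 5 c k.+1.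
  by rewrite /s3 /= /upd /= addn1.
set s' := iput s3 5 c _; have e6 : iarr s' 6 = upd (iarr s 6) (base c + k) p by [].
have e5 c' : iarr s' 5 c' = if c' == c then k.+1 else iarr s 5 c' by [].
have k5 : (k <= 5)%N by rewrite -h5.
split=> // c'; rewrite /leaves e5 e6 h5; case: eqP => [->|/eqP cc'].
  rewrite mkseqS upd_same; congr rcons.
  apply/eq_in_map => i; rewrite mem_iota => ik; rewrite upd_other // eqn_add2l.
  by apply/eqP; arith.
apply/eq_in_map => i; rewrite mem_iota => ik; rewrite upd_other // base_inj //.
  by have := le5 c'; arith.
Qed.

Lemma run_find (T : eqType) (test : T -> bexp) (act : T -> cmd) (l : seq T) s :
  has (fun x => beval s (test x)) l ->
  exists2 x, x \in l & beval s (test x) /\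
    run (foldr (fun x k => If (test x) (act x) k) Skip l) s = run (act x) s.
Proof.
elim: l => //= y l IH; case E: (beval s (test y)) => /=.
  by exists y; rewrite ?mem_head // E.
by move=> /IH[x xl h]; exists x; rewrite // inE xl orbT.
Qed.

Lemma mem_leaf_pairs i j : (i < j < 6)%N -> (i, j) \in leaf_pairs.
Proof.
by move=> /andP[]; case: j => [|[|[|[|[|[|j]]]]]] //; case: i => [|[|[|[|[|i]]]]].
Qed.

Let rest (b : nat -> nat) i j :=
  mkseq (fun k => if k == i then (if 4 == j then b 5 else b 4) else if k == j then b 5 else b k) 4.

Lemma perm_rest (b : nat -> nat) (i j : nat) : (i, j) \in leaf_pairs ->
  perm_eq (mkseq b 6) [:: b i, b j & rest b i j].
Proof.
by rewrite !inE => h; move: h; do ?[case/orP]; move=> /eqP[-> ->]; apply/permP => P;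
  rewrite /rest /= !addn0;
  move: (P (b 0) : nat) (P (b 1) : nat) (P (b 2) : nat) (P (b 3) : nat) (P (b 4) : nat) (P (b 5) : nat);
  clear; lia.
Qed.

Lemma split_star_spec s c : ivar s 11 = c -> rarr s 6 = px -> rarr s 7 = py ->
  iarr s 5 c = 6 -> (forall c', c' != c -> iarr s 5 c' <= 5)%N ->
  c \notin leaves s c -> (forall u, u \in leaves s c -> d2 u c <= m) ->
  let s' := run split_star s in
  (forall c', iarr s' 5 c' <= 5)%N /\
  exists u v L, [/\ perm_eq (leaves s c) [:: u, v & L], L != [::], d2 u v <= m &
    forall c', leaves s' c' = if c' == u then [:: v] else if c' == c then L else leaves s c'].
Proof.
move=> h11 h6 h7 h5 le5 cfree dm; pose b i := iarr s 6 (base c + i).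
have bE i : ieval s (leaf_exp i) = b i by rewrite /= h11.
have e11 : ieval s (IVar 11) = c by [].
have lE : leaves s c = mkseq b 6 by rewrite /leaves h5.
have testE ij : beval s (close_test ij) =
    (d2 (b ij.1) (b ij.2) <= d2 (b ij.1) c) || (d2 (b ij.1) (b ij.2) <= d2 (b ij.2) c).
  case: ij => i j; rewrite -[RHS]negbK negb_or.
  change (beval s (close_test (i, j))) with
    (~~ (~~ (reval s (rdist2 (leaf_exp i) (leaf_exp j)) <= reval s (rdist2 (leaf_exp i) (IVar 11)))
     && ~~ (reval s (rdist2 (leaf_exp i) (leaf_exp j)) <= reval s (rdist2 (leaf_exp j) (IVar 11))))).
  by rewrite !(reval_rdist2 _ _ h6 h7) !bE !e11.
have [|[i j] ijl [tij ->]] := @run_find _ close_test split_pair leaf_pairs s.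
  have [i [j [ij j6 h]]] := six_points_close (pt px py c) (fun i => pt px py (b i)).
  apply/hasP; exists (i, j); first by apply: mem_leaf_pairs; rewrite ij.
  by rewrite testE; apply/orP.
have [i6 j6] : (i < 6)%N /\ (j < 6)%N.
  by move: ijl; rewrite !inE => h; move: h; do ?[case/orP]; move=> /eqP[-> ->].
have inb k : (k < 6)%N -> b k \in leaves s c.
  by move=> k6; rewrite lE map_f // mem_iota.
have uc : b i != c by apply: contraNneq cfree => e; rewrite -{1}e; apply: inb.
rewrite /split_pair !run_seq.
set s1 := run (ISet 13 _) s; have -> : s1 = iset s 13 (b i) by rewrite /s1 /= h11.
set s2 := run (ISet 14 _) _; have -> : s2 = iset (iset s 13 (b i)) 14 (b j).
  by rewrite /s2 /= /upd /= h11.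
set s2' := iset _ 14 _.
set s3 := run (IPut 6 _ _) s2'; have -> : s3 = iput s2' 6 (base c + j) (b 5).
  by rewrite /s3 /= /upd /= h11.
set s3' := iput s2' 6 _ _.
set s4 := run (IPut 6 _ _) s3'.
have -> : s4 = iput s3' 6 (base c + i) (if 4 == j then b 5 else b 4)%N.
  by rewrite /s4 /= /upd /= h11 -[X in (X + 4)%N]/(base c) eqn_add2l.
set s4' := iput s3' 6 _ _.
set s5 := run (IPut 5 _ _) s4'; have -> : s5 = iput s4' 5 c 4 by rewrite /s5 /= /upd /= h11.
set s5' := iput s4' 5 _ _.
set s6 := run (IPut 6 _ _) s5'; have -> : s6 = iput s5' 6 (base (b i) + 0) (b j).
  by rewrite /s6 /= /upd /= addn0.
set s6' := iput s5' 6 _ _.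
set s7 := run (IPut 5 _ _) s6'; have -> : s7 = iput s6' 5 (b i) 1 by rewrite /s7 /= /upd /=.
set s' := iput s6' 5 _ _.
have E5 c' : iarr s' 5 c' = if c' == b i then 1%N else if c' == c then 4%N else iarr s 5 c' by [].
have E6 : iarr s' 6 = upd (upd (upd (iarr s 6) (base c + j) (b 5))
   (base c + i) (if 4 == j then b 5 else b 4)%N) (base (b i) + 0) (b j) by [].
split.
  by move=> c'; rewrite E5; case: eqP => // _; case: (c' =P c) => // /eqP; apply: le5.
exists (b i), (b j), (rest b i j); split.
- by rewrite lE; apply: perm_rest.
- by [].
- have := dm _ (inb _ i6); have := dm _ (inb _ j6); move: tij; rewrite testE /=.
  by move=> /orP[] h h1 h2; apply: le_trans h _.
- move=> c'; rewrite {1}/leaves E5 E6; case: (c' =P b i) => [->|/eqP cu].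
    by rewrite /mkseq /= upd_same.
  case: (c' =P c) => [->|/eqP cc].
    apply/eq_in_map => k; rewrite mem_iota => /andP[_ k4].
    rewrite upd_other; last by rewrite base_inj //; [arith|rewrite eq_sym].
    by rewrite /upd !eqn_add2l.
  apply/eq_in_map => k; rewrite mem_iota => k5.
  have k6 : (k < 6)%N by have := le5 _ cc; arith.
  by rewrite !upd_other // base_inj.
Qed.

Lemma nilp_leaves s c : (leaves s c == [::]) = (iarr s 5 c == 0%N).
Proof. by rewrite -size_eq0 size_leaves. Qed.

(** Two rounds: first the unmatched points are attached, then the matched ones; [k] is the progress
    in the current round. *)
Definition turn_done M (matched : bool) k p := if M p == 0%N then matched || (p < k)%N else matched && (p < k)%N.

Lemma push_loop_spec s matched F M : ivar s 0 = n -> rarr s 6 = px -> rarr s 7 = py ->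
  iarr s 2 = F -> iarr s 4 = M -> links F -> matching n F M ->
  (forall p, (p < n)%N -> M p = 0%N -> M (F p) != 0%N) ->
  (forall c, iarr s 5 c <= 5)%N -> forest (turn_done M matched 0) F (leaves s) ->
  wp (For 10 (ICst 0) 0 (push_step matched)) s (n * 42 + 2) (fun s' =>
    (forall c, iarr s' 5 c <= 5)%N /\ forest (turn_done M matched n) F (leaves s')).
Proof.
move=> s0 h6 h7 h2 h4 lF mF hM c5 f0.
pose I k s' := (forall c, iarr s' 5 c <= 5)%N /\ forest (turn_done M matched k) F (leaves s').
have := @wp_for R 10 (ICst 0) 0 (push_step matched) s 40 I; rewrite /= s0 subn0; apply=> //.
move=> p s' pn fr h10 _ [c5' fo].
have [g2 g4 g6 g7] : [/\ iarr s' 2 = F, iarr s' 4 = M, rarr s' 6 = px & rarr s' 7 = py].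
  by case: fr => _ fA _ fK; rewrite !fA ?fK //; case: (matched).
apply: wp_run => [|//|_]; first by case: (matched).
have turnS q : turn_done M matched p.+1 q = turn_done M matched p q || ((q == p) && ((M p != 0%N) == matched)).
  rewrite /turn_done ltnS leq_eqVlt; case: (q =P p) => [->|_] /=; last by rewrite orbF.
  by rewrite ltnn; case: (M p == 0%N); case: (matched).
rewrite /push_step run_if.
have -> : beval s' (BAnd (if matched then ILe (ICst 1) (IGet 4 (IVar 10)) else ILe (IGet 4 (IVar 10)) (ICst 0))
           (ILe (IGet 5 (IVar 10)) (ICst 0))) = ((M p != 0%N) == matched) && (leaves s' p == [::]).
  rewrite nilp_leaves; case: (matched); rewrite /= h10 g4.
    by rewrite lt0n eqb_id leqn0.
  by rewrite !leqn0 eqbF_neg negbK.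
case: ifPn => [/andP[mp /eqP lp]|hc]; last first.
  split=> //; move: hc; rewrite negb_and => /orP[mp|lp].
    apply: forest_ext fo => // q qn; by rewrite turnS (negbTE mp) andbF orbF.
  have := forest_done lp fo; case: ((M p != 0%N) =P matched) => mp.
    by apply: forest_ext => // q qn; rewrite turnS mp eqxx andbT.
  by move=> _; apply: forest_ext fo => // q qn; rewrite turnS; move/eqP/negbTE: mp => ->; rewrite andbF orbF.
have [Fn Fp dFp] := lF p pn; set c := F p in Fn Fp dFp.
have ndone : ~~ turn_done M matched p p.
  by rewrite /turn_done ltnn; move: mp; case: (M p == 0%N); case: (matched).
have [f1 f2 f3 f4] := fo.
(* The new centre is no leaf. If [p] is unmatched, its neighbour is matched, hence not yet
   processed; if [p] is matched, a leaf [c] would have [F c = p] as a point with leaves. *)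
have cfree c' : (c' < n)%N -> c \notin leaves s' c'.
  move=> cn'; apply/negP => /(f1 _ _ cn')[_ _ _ dc lc].
  move: mp dc; rewrite /turn_done; case: (M p =P 0%N) => [Mp|/eqP Mp] /eqP <- /=.
    by rewrite (negbTE (hM p pn Mp)).
  by have [FFp _] := mF p pn Mp; rewrite FFp lp eqxx in lc.
rewrite /push run_seq.
have := @push_leaf_spec s' p c _ h10 (congr1 (@^~ p) g2) erefl c5'.
have fr1 := frame_run s' (isT : loopfree push_leaf).
move: (run push_leaf s') fr1 => s1 [_ _ _ fK1] [h11 h12 E5 EL].
have fo1 : forest (turn_done M matched p.+1) F (leaves s1).
  have := forest_push lF pn erefl ndone lp cfree fo; apply: forest_ext => //.
  by move=> q qn; rewrite turnS mp andbT.
rewrite run_if (_ : beval _ _ = (5 <= iarr s' 5 c)%N); last by rewrite /= h12.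
case: ifPn => h5; last first.
  split; last exact: fo1.
  by move=> c'; rewrite /= E5; case: (c' =P c) => // _; rewrite ltnNge.
have c56 : iarr s1 5 c = 6 by rewrite E5 eqxx; have := c5' c; arith.
have [e16 e17] : rarr s1 6 = px /\ rarr s1 7 = py by rewrite !fK1.
have [k1 k2 k3 k4] := fo1.
have [||u lu|c6 [u [v [L [pL L0 duv E]]]]] := split_star_spec h11 e16 e17 c56.
- by move=> c' cc'; rewrite E5 (negbTE cc').
- apply/negP => hc; have [_ _ + _ _] := k1 c c Fn hc.
  by move/eqP; rewrite nilp_leaves c56.
- by have [] := k1 c u Fn lu.
split=> //.
have := forest_split lF Fn pL L0 duv fo1; apply: forest_ext => // c' _.
by rewrite -E.
Qed.
End Push.

(** * The two curves *)

Definition emit a b r e :=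
  RPut a (IVar r) (RGet 6 e) ;; RPut b (IVar r) (RGet 7 e) ;; incr r.

Definition emit_star a b r a' b' r' :=
  ISet 11 (IGet 5 (IVar 10)) ;;
  For 12 (ICst 0) 11 (emit a b r (IGet 6 (IAdd (six (IVar 10)) (IVar 12)))) ;;
  emit a' b' r' (IVar 10).

(* The shorter curve receives the leaves, which keeps the difference of the
   lengths at most 4 since a star has at most 5 leaves. *)
Definition emit_step :=
  If (ILe (ICst 1) (IGet 5 (IVar 10)))
    (If (ILe (IVar 1) (IVar 2)) (emit_star 2 3 1 4 5 2) (emit_star 4 5 2 2 3 1)) Skip.

Definition swap_step :=
  RSet 1 (RGet 2 (IVar 10)) ;; RPut 2 (IVar 10) (RGet 4 (IVar 10)) ;; RPut 4 (IVar 10) (RVar 1) ;;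
  RSet 1 (RGet 3 (IVar 10)) ;; RPut 3 (IVar 10) (RGet 5 (IVar 10)) ;; RPut 5 (IVar 10) (RVar 1).

Definition swap_curves :=
  For 10 (ICst 0) 0 swap_step ;;
  ISet 11 (IVar 1) ;; ISet 1 (IVar 2) ;; ISet 2 (IVar 11).

Section Emit.
Context {R : realType}.
Context (n : nat) (px py : nat -> R) (m : R).
Implicit Types (s : state R) (P Q : seq (plane R)) (w : seq (seq (plane R) * seq (plane R))).
Let pt := pt px py.
Let d2 := d2 px py.

Lemma make_stars_spec s : ivar s 0 = n -> rarr s 6 = px -> rarr s 7 = py ->
  links n px py m (iarr s 2) -> (forall a, iarr s 4 a = 0%N) -> (forall a, iarr s 5 a = 0%N) ->
  wp make_stars s (n * 90 + 6) (fun s' => (forall c, iarr s' 5 c <= 5)%N /\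
    exists F, forest n px py m predT F (leaves s')).
Proof.
move=> s0 h6 h7 lF M0 C0.
apply: (@wp_seq_le _ (n * 6 + 2) (n * 84 + 4)); first by arith.
apply: wp_frame; apply: wp_mono (match_loop_spec s0 lF M0) (leqnn _) _.
move=> s1 [lF1 mF1 hM1] [fI1 fA1 _ fK1].
apply: (@wp_seq_le _ (n * 42 + 2) (n * 42 + 2)); first by arith.
have C1 a : iarr s1 5 a = 0%N by rewrite fA1.
have [g0 g6 g7] : [/\ ivar s1 0 = n, rarr s1 6 = px & rarr s1 7 = py] by rewrite fI1 ?fK1.
have lnil c : leaves s1 c = [::] by rewrite /leaves C1.
apply: wp_frame; apply: wp_mono (push_loop_spec g0 g6 g7 erefl erefl lF1 mF1 hM1 _ _) (leqnn _) _.
- by move=> c; rewrite C1.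
- split=> [c p _|c _|c c' p _ _|p _]; rewrite ?lnil //.
  by rewrite /turn_done ltn0; case: ifP.
move=> s2 [C2 fo2] [fI2 fA2 _ fK2].
have [k0 k6 k7] : [/\ ivar s2 0 = n, rarr s2 6 = px & rarr s2 7 = py] by rewrite fI2 ?fK2.
have k2 : iarr s2 2 = iarr s1 2 by rewrite fA2.
have k4 : iarr s2 4 = iarr s1 4 by rewrite fA2.
apply: wp_mono (push_loop_spec k0 k6 k7 k2 k4 lF1 mF1 hM1 C2 _) (leqnn _) _.
  apply: forest_ext fo2 => // p pn; rewrite /turn_done pn ltn0 andbF.
  by case: ifP.
move=> s3 [C3 fo3]; split=> //; exists (iarr s1 2).
by apply: forest_ext fo3 => // p pn; rewrite /turn_done pn; case: ifP.
Qed.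

Lemma ieval_rput s a i v e : ieval (rput s a i v) e = ieval s e.
Proof. by elim: e => //= [x e ->|e1 -> e2 ->|e1 -> e2 ->]. Qed.

Lemma emit_spec s a b r e : a != b -> rarr s 6 = px -> rarr s 7 = py -> a != 7%N ->
  output_curve (run (emit a b r e) s) r a b = rcons (output_curve s r a b) (pt (ieval s e)).
Proof.
move=> ab h6 h7 a7; rewrite /output_curve.
have -> : ivar (run (emit a b r e) s) r = (ivar s r).+1 by rewrite /= upd_same addn1.
rewrite mkseqS /=; congr rcons.
  apply/eq_in_map => i; rewrite mem_iota => ir.
  have ir' : i != ivar s r by apply/eqP; arith.
  by rewrite /upd !eqxx (eq_sym b) (negbTE ab) (negbTE ir').
rewrite ieval_rput /upd !eqxx (negbTE ab) /= h6 /pt.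
by rewrite eqxx (eq_sym 7%N) (negbTE a7) h7.
Qed.

Lemma output_curve_frame s s' k x y : ivar s' k = ivar s k -> rarr s' x = rarr s x ->
  rarr s' y = rarr s y -> output_curve s' k x y = output_curve s k x y.
Proof. by rewrite /output_curve => -> -> ->. Qed.

Lemma emit_star_spec s a b r a' b' r' c :
  uniq [:: a; b; a'; b'; 6; 7]%N -> uniq [:: r; r'; 0; 10; 11; 12]%N ->
  ivar s 10 = c -> rarr s 6 = px -> rarr s 7 = py -> (iarr s 5 c <= 5)%N ->
  wp (emit_star a b r a' b' r') s 31 (fun s' =>
    output_curve s' r a b = output_curve s r a b ++ [seq pt x | x <- leaves s c] /\
    output_curve s' r' a' b' = rcons (output_curve s r' a' b') (pt c)).
Proof.
move=> ua ur h10 h6 h7 c5.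
have := ua; rewrite /= !inE !negb_or => /and5P[/and5P[ab aa' ab' a6 a7]
  /and4P[ba' bb' b6 b7] /and3P[ab'' a6' a7'] /andP[b6' b7'] _].
have := ur; rewrite /= !inE !negb_or => /and3P[/and5P[rr' r0 r10 r11 r12]
  /and4P[s0 s10 s11 s12] _].
apply: (@wp_seq_le _ 1 30) => //; apply: wp_run => //.
set s1 := run _ s.
apply: (@wp_seq_le _ 27 3) => //; apply: wp_frame.
pose I k s' := output_curve s' r a b =
  output_curve s r a b ++ [seq pt (iarr s 6 (base c + i)) | i <- iota 0 k].
have := @wp_for R 12 (ICst 0) 11 (emit a b r (IGet 6 (IAdd (six (IVar 10)) (IVar 12)))) s1 3 I.
have e11 : ivar s1 11 = iarr s 5 c by rewrite /s1 /= upd_same h10.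
set Q := (X in wp _ _ 27 X); move=> /(_ Q) hfor.
have : wp (For 12 (ICst 0) 11 (emit a b r (IGet 6 (IAdd (six (IVar 10)) (IVar 12))))) s1
    ((ivar s1 11 - 0) * 5 + 2) Q; last first.
  move=> h; apply: wp_mono h _ (fun _ => id); rewrite e11 subn0.
  by move: (iarr s 5 c) c5; clear; lia.
apply: hfor => //.
- by rewrite /= !inE eq_sym.
- by rewrite /= !inE eq_sym.
- by rewrite /I /= cats0; apply: output_curve_frame => //=; rewrite upd_other // upd_other.
- move=> k s' _ [fI fA _ fK] h12 _ hI; apply: wp_run => // _.
  have g6 : rarr s' 6 = px by rewrite fK //= !inE !negb_or !(eq_sym 6%N) a6 b6.
  have g7 : rarr s' 7 = py.
    by rewrite fK //= !inE !negb_or !(eq_sym 7%N) a7 b7.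
  have g10 : ivar s' 10 = c by rewrite fI //= !inE !(eq_sym 10%N) (negbTE r10).
  have gA : iarr s' 6 = iarr s 6 by rewrite fA.
  rewrite /I; rewrite (@output_curve_frame (run (emit a b r (IGet 6 (IAdd (six (IVar 10)) (IVar 12)))) s')) //; last first.
    by rewrite [ivar (iset _ _ _) r]/= upd_other.
  rewrite (emit_spec _ _ ab g6 g7) // hI rcons_cat; congr cat.
  have -> : iota 0 k.+1 = rcons (iota 0 k) k by rewrite -[k.+1]subn0 iota_recr ?subn0.
  rewrite map_rcons; congr rcons.
  by congr pt; rewrite /= gA g10 h12.
- move=> s' [fI fA _ fK] _ hI _; apply: wp_run => //.
  have g6 : rarr s' 6 = px by rewrite fK //= !inE !negb_or !(eq_sym 6%N) a6 b6.
  have g7 : rarr s' 7 = py by rewrite fK //= !inE !negb_or !(eq_sym 7%N) a7 b7.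
  have g10 : ivar s' 10 = c by rewrite fI //= !inE !(eq_sym 10%N) (negbTE r10).
  have [_ _ _ fK2] := frame_run s' (isT : loopfree (emit a' b' r' (IVar 10))).
  have [fI2 _ _ _] := frame_run s' (isT : loopfree (emit a' b' r' (IVar 10))).
  split.
    rewrite (@output_curve_frame s').
    + rewrite hI e11 /leaves; congr (_ ++ _).
      by rewrite -map_comp; apply: eq_map.
    + by rewrite fI2 //= !inE.
    + by rewrite fK2 //= !inE !negb_or aa' ab'.
    + by rewrite fK2 //= !inE !negb_or ba' bb'.
  rewrite (emit_spec _ _ _ g6 g7) // /= g10; congr rcons.
  apply: output_curve_frame.
  + rewrite fI; first by rewrite /= upd_other.
    by rewrite /= !inE !negb_or s12 (eq_sym r') rr'.
  + by rewrite fK //= !inE !negb_or (eq_sym a') aa' (eq_sym a') ba'.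
  + by rewrite fK //= !inE !negb_or (eq_sym b') ab' (eq_sym b') bb'.
Qed.

Definition star_walk P Q w :=
  paired_walk P Q w /\
  forall b p q, b \in w -> p \in b.1 -> q \in b.2 -> dist2 p q <= m.

Lemma star_walk_rcons P Q w p q : star_walk P Q w -> p != [::] -> q != [::] ->
  (size p == 1%N) || (size q == 1%N) ->
  (forall x y, x \in p -> y \in q -> dist2 x y <= m) ->
  star_walk (P ++ p) (Q ++ q) (rcons w (p, q)).
Proof.
move=> [[hP hQ hb] hd] p0 q0 pq h; split; first split.
- by rewrite map_rcons flatten_rcons hP.
- by rewrite map_rcons flatten_rcons hQ.
- by move=> b; rewrite mem_rcons inE => /orP[/eqP ->|/hb].
- move=> b x y; rewrite mem_rcons inE => /orP[/eqP -> /=|]; first exact: h.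
  exact: hd.
Qed.

Lemma star_walk_sym P Q w : star_walk P Q w -> star_walk Q P [seq (b.2, b.1) | b <- w].
Proof.
move=> [[hP hQ hb] hd]; split; first split.
- by rewrite -map_comp.
- by rewrite -map_comp.
- by move=> _ /mapP[b /hb [h1 h2 h3] ->]; rewrite orbC.
- by move=> _ p q /mapP[b bw ->] /= pb qb; rewrite dist2C; apply: hd bw qb pb.
Qed.

(** Empty for a point without leaves, which is listed in the star of its centre instead. *)
Definition star lst (c : nat) : seq nat := if nilp (lst c) then [::] else c :: lst c.

Lemma emit_loop_spec s F : ivar s 0 = n -> ivar s 1 = 0%N -> ivar s 2 = 0%N ->
  rarr s 6 = px -> rarr s 7 = py -> (forall c, iarr s 5 c <= 5)%N ->
  forest n px py m predT F (leaves s) ->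
  wp (For 10 (ICst 0) 0 emit_step) s (n * 35 + 2) (fun s' =>
    let P := output_curve s' 1 2 3 in let Q := output_curve s' 2 4 5 in
    exists w, [/\ star_walk P Q w, (size P <= size Q + 4)%N, (size Q <= size P + 4)%N &
      perm_eq (P ++ Q) [seq pt x | x <- iota 0 n]]).
Proof.
move=> s0 s1 s2 h6 h7 c5 fo.
pose I k s' := let P := output_curve s' 1 2 3 in let Q := output_curve s' 2 4 5 in
    exists w, [/\ star_walk P Q w, (size P <= size Q + 4)%N, (size Q <= size P + 4)%N &
      perm_eq (P ++ Q) [seq pt x | x <- flatten [seq star (leaves s) c | c <- iota 0 k]]].
have := @wp_for R 10 (ICst 0) 0 emit_step s 33 I; rewrite /= s0 subn0; apply=> //.
- by exists [::]; rewrite /output_curve /= !upd_other ?s1 ?s2.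
- move=> c s' cn [fI fA _ fK] h10 _.
  have g6 : rarr s' 6 = px by rewrite fK.
  have g7 : rarr s' 7 = py by rewrite fK.
  have gL : leaves s' = leaves s.
    by apply/funext => x; rewrite /leaves !fA.
  have gC : iarr s' 5 = iarr s 5 by rewrite fA.
  have iotaS : [seq star (leaves s) x | x <- iota 0 c.+1] =
      rcons [seq star (leaves s) x | x <- iota 0 c] (star (leaves s) c).
    by rewrite -[in LHS](subn0 c.+1) iota_recr // subn0 map_rcons.
  rewrite {1}/I; set P := output_curve s' 1 2 3; set Q := output_curve s' 2 4 5.
  move=> [w [hw lPQ lQP pPQ]].
  have [f1 _ _ _] := fo.
  apply: wp_if => hc; last first.
    apply: wp_run => // _; exists w; split=> //.
    rewrite iotaS flatten_rcons /star /nilp size_leaves -gC.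
    by move: hc; rewrite /= h10 -eqn0Ngt => ->; rewrite cats0.
  have c0 : ~~ nilp (leaves s c).
    by rewrite /nilp size_leaves -gC; move: hc; rewrite /= h10 lt0n.
  set ls := [seq pt x | x <- leaves s c].
  have ls0 : ls != [::] by rewrite /ls -size_eq0 size_map.
  have lsz : (0 < size ls <= 5)%N.
    by rewrite /ls size_map size_leaves c5 andbT lt0n; move: c0; rewrite /nilp size_leaves.
  have hd x y : x \in ls -> y \in [:: pt c] -> dist2 x y <= m.
    by move=> /mapP[z /(f1 _ _ cn)[_ h _ _ _] ->]; rewrite inE => /eqP ->.
  have step P' Q' : perm_eq (P' ++ Q') ((P ++ Q) ++ pt c :: ls) ->
      perm_eq (P' ++ Q') [seq pt x | x <- flatten [seq star (leaves s) x | x <- iota 0 c.+1]].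
    move=> /perm_trans; apply; rewrite iotaS flatten_rcons map_cat.
    by rewrite /star (negbTE c0) /= perm_cat2r.
  have c5' : (iarr s' 5 c <= 5)%N by rewrite gC.
  have sP : size P = ivar s' 1 by rewrite size_mkseq.
  have sQ : size Q = ivar s' 2 by rewrite size_mkseq.
  apply: wp_if => hPQ.
    apply: wp_mono (@emit_star_spec s' 2 3 1 4 5 2 c isT isT h10 g6 g7 c5') _ _ => //.
    move=> s'' [eP eQ] _; rewrite /I.
    rewrite (_ : output_curve (iset s'' 10 c.+1) 1 2 3 = P ++ ls); last by rewrite /ls -gL -eP.
    rewrite (_ : output_curve (iset s'' 10 c.+1) 2 4 5 = Q ++ [:: pt c]); last by rewrite cats1 -eQ.
    exists (rcons w (ls, [:: pt c])); split.
    + by apply: star_walk_rcons; rewrite //= orbT.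
    + by move: hPQ; rewrite /= -sP -sQ !size_cat /=; move: lsz; clear; lia.
    + by rewrite !size_cat /=; move: lsz lQP; clear; lia.
    + apply: step; rewrite -!catA perm_cat2l perm_catC -catA perm_cat2l.
      exact: perm_refl.
  apply: wp_mono (@emit_star_spec s' 4 5 2 2 3 1 c isT isT h10 g6 g7 c5') _ _ => //.
  move=> s'' [eQ eP] _; rewrite /I.
  rewrite (_ : output_curve (iset s'' 10 c.+1) 2 4 5 = Q ++ ls); last by rewrite /ls -gL -eQ.
  rewrite (_ : output_curve (iset s'' 10 c.+1) 1 2 3 = P ++ [:: pt c]); last by rewrite cats1 -eP.
  exists (rcons w ([:: pt c], ls)); split.
  + by apply: star_walk_rcons => // x y xc yl; rewrite dist2C; apply: hd.
  + by rewrite !size_cat /=; move: lsz lPQ; clear; lia.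
  + by move: hPQ; rewrite /= -sP -sQ !size_cat /=; move: lsz; clear; lia.
  + apply: step; rewrite -!catA perm_cat2l.
    by rewrite -(cat1s (pt c) ls) !catA perm_cat2r perm_catC.
move=> s' _ _ [w [hw l1 l2 hp]]; exists w; split=> //.
by apply: perm_trans hp _; apply: perm_map; apply: forest_perm fo.
Qed.

(** Exchanging the first [n] entries is enough because neither curve has more than [n] vertices. *)
Lemma swap_curves_spec s : ivar s 0 = n -> (ivar s 1 <= n)%N -> (ivar s 2 <= n)%N ->
  wp swap_curves s (n * 8 + 5) (fun s' =>
    output_curve s' 1 2 3 = output_curve s 2 4 5 /\
    output_curve s' 2 4 5 = output_curve s 1 2 3).
Proof.
move=> s0 l1 l2.
apply: (@wp_seq_le _ (n * 8 + 2) 3); first by arith.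
pose I k (s' : state R) := forall i,
  [/\ rarr s' 2 i = rarr s (if i < k then 4 else 2)%N i, rarr s' 3 i = rarr s (if i < k then 5 else 3)%N i,
     rarr s' 4 i = rarr s (if i < k then 2 else 4)%N i & rarr s' 5 i = rarr s (if i < k then 3 else 5)%N i].
have := @wp_for R 10 (ICst 0) 0 swap_step s 6 I; rewrite /= s0 subn0; apply=> //.
  move=> k s' _ _ h10 _ hI; apply: wp_run => // _ i.
  have [e2 e3 e4 e5] := hI i; have [k2 k3 k4 k5] := hI k; rewrite ltnn in k2 k3 k4 k5.
  rewrite ltnS leq_eqVlt /= /upd /= h10.
  case: (i =P k) => [->|_] /=; last by split.
  by split.
move=> s' [fI _ _ _] _ hI; apply: wp_run => //.
have f1 : ivar s' 1 = ivar s 1 by rewrite fI.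
have f2 : ivar s' 2 = ivar s 2 by rewrite fI.
have e1 : ivar (run (ISet 11 (IVar 1) ;; ISet 1 (IVar 2) ;; ISet 2 (IVar 11)) s') 1 = ivar s 2.
  by rewrite /= /upd /=.
have e2 : ivar (run (ISet 11 (IVar 1) ;; ISet 1 (IVar 2) ;; ISet 2 (IVar 11)) s') 2 = ivar s 1.
  by rewrite /= /upd /=.
split; rewrite /output_curve ?e1 ?e2; apply/eq_in_map => i; rewrite mem_iota => ib.
  by have [h2 h3 _ _] := hI i; rewrite /= h2 h3 (_ : i < n)%N //; arith.
by have [_ _ h4 h5] := hI i; rewrite /= h4 h5 (_ : i < n)%N //; arith.
Qed.
End Emit.

(** * The whole program and its running time *)

Definition balanced_curves :=
  find_neighbours ;; make_stars ;; For 10 (ICst 0) 0 emit_step ;;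
  If (ILe (IVar 2) (IVar 1)) Skip swap_curves.

Definition balanced_curves_time n :=
  (find_neighbours_time n + (n * 90 + 6) + (n * 35 + 2) + (n * 8 + 6))%N.

Lemma balanced_curves_correct (R : realType) :
  finds_in_time (@balanced_pair R) balanced_curves balanced_curves_time.
Proof.
move=> S l S2 ul lS.
have szl : size l = #|` S|.
  by apply/perm_size/uniq_perm => //; apply: fset_uniq.
rewrite -szl in S2 *; set n := size l.
suff [s [t [h1 h2 h3]]] : wp balanced_curves (input l) (balanced_curves_time n)
    (fun s => balanced_pair S (output_curve s 1 2 3) (output_curve s 2 4 5)).
  by exists s, t.
apply: (@wp_seq_le _ (find_neighbours_time n) ((n * 90 + 6) + (n * 35 + 2) + (n * 8 + 6))).
  by rewrite /balanced_curves_time !addnA.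
apply: wp_frame; apply: wp_mono (find_neighbours_spec ul S2) (leqnn _) _.
move=> s1 [px [py [m [[[h6 h7 hG] hm [a an ha]] s10 hp]]]] [fI1 fA1 _ _].
rewrite -/n in hG hm an ha s10 hp.
apply: (@wp_seq_le _ (n * 90 + 6) ((n * 35 + 2) + (n * 8 + 6))); first by rewrite !addnA.
have lk : links n px py m (iarr s1 2).
  by move=> b bn; have /andP[h1 h2] := hG b bn; split=> //; apply: hm.
have M0 b : iarr s1 4 b = 0%N by rewrite fA1.
have C0 b : iarr s1 5 b = 0%N by rewrite fA1.
apply: wp_frame; apply: wp_mono (make_stars_spec s10 h6 h7 lk M0 C0) (leqnn _) _.
move=> s2 [C5 [F fo]] [fI2 _ _ fK2].
have [g0 g1 g2] : [/\ ivar s2 0 = n, ivar s2 1 = 0%N & ivar s2 2 = 0%N].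
  by rewrite !fI2 // !fI1.
have [g6 g7] : rarr s2 6 = px /\ rarr s2 7 = py by rewrite !fK2.
apply: (@wp_seq_le _ (n * 35 + 2) (n * 8 + 6)); first by [].
apply: wp_frame; apply: wp_mono (emit_loop_spec g0 g1 g2 g6 g7 C5 fo) (leqnn _) _.
move=> s3 [w [hw lPQ lQP pPQ]] [fI3 _ _ _].
have s30 : ivar s3 0 = n by rewrite fI3.
set P := output_curve s3 1 2 3 in hw lPQ lQP pPQ *.
set Q := output_curve s3 2 4 5 in hw lPQ lQP pPQ *.
have szP : size P = ivar s3 1 by rewrite size_mkseq.
have szQ : size Q = ivar s3 2 by rewrite size_mkseq.
have {}pPQ : perm_eq (P ++ Q) l by apply: perm_trans pPQ hp.
have szn : (size P + size Q = n)%N by rewrite -size_cat (perm_size pPQ).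
have pE k : (k < n)%N -> pt px py k = nth 0 [seq pt px py k | k <- iota 0 n] k.
  by move=> kn; rewrite (nth_map 0%N) ?size_iota // nth_iota.
have ptl k : (k < n)%N -> pt px py k \in S.
  by move=> kn; rewrite -lS -(perm_mem hp) map_f // mem_iota.
have far b : b \in S -> b != pt px py a -> m <= dist2 (pt px py a) b.
  rewrite -lS -(perm_mem hp) => /mapP[k]; rewrite mem_iota => /= kn -> ka.
  by apply: ha => //; apply: contra ka => /eqP ->.
have final P' Q' w' : star_walk m P' Q' w' -> perm_eq (P' ++ Q') l ->
    (size Q' <= size P')%N -> (size P' <= size Q' + 4)%N -> balanced_pair S P' Q'.
  move=> [hw1 hw2] p' l1 l2.
  apply: (balanced_pair_of_walk hw1 _ _ _ hw2 (ptl _ an) far) => //.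
  - apply: contraTneq S2 => e; rewrite -(perm_size p') size_cat.
    by move: l1; rewrite e /= leqn0 => /eqP ->.
  - by rewrite (perm_uniq p').
  - by move=> x; rewrite (perm_mem p').
rewrite addnS; apply: wp_if => hc.
  by apply: wp_run; rewrite //= ?addnS //; apply: (final _ _ w) => //; rewrite szP szQ.
apply: wp_mono (swap_curves_spec s30 _ _) _ _; first by rewrite -szP -szn leq_addr.
- by rewrite -szQ -szn leq_addl.
- by [].
move=> s4 [-> ->]; apply: (final _ _ [seq (b.2, b.1) | b <- w]) => //.
- exact: star_walk_sym.
- by rewrite perm_catC.
- by rewrite ltnW // szP szQ ltnNge.
Qed.

Lemma balanced_curves_time_bound : exists2 K, (0 < K)%N &
  forall n, (1 < n)%N -> (balanced_curves_time n <= K * (n * up_log 2 n))%N.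
Proof.
(* A generous value: the explicit coefficients add up to less, and the logarithm is at least 1,
   which absorbs the linear terms. *)
exists 2000%N => // n n1; have L0 : (0 < up_log 2 n)%N by rewrite up_log_gt0.
rewrite /balanced_curves_time /find_neighbours_time /sort_time.
by move: (up_log 2 n) L0 => L L0; nia.
Qed.

(** The rounded logarithm exceeds the binary one by at most 1, which is itself at most the binary
    logarithm of [n]; hence the factor 2. *)
Lemma up_log_ln (R : realType) n : (1 < n)%N ->
  (up_log 2 n)%:R <= 2 / ln 2 * ln (n%:R) :> R.
Proof.
move=> n1; have ln2 : 0 < ln (2 : R) by rewrite ln_gt0 // ltr1n.
have h : ln (2 : R) * (up_log 2 n).-1%:R <= ln (n%:R : R).
  rewrite mulr_natr -lnXn // -natrX ler_ln ?posrE ?ltr0n ?expn_gt0 //; last by arith.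
  by rewrite ler_nat ltnW // up_log_gtn.
have h' : ln (2 : R) <= ln (n%:R : R) by rewrite ler_ln ?posrE ?ltr0n ?ler_nat //; arith.
have -> : (up_log 2 n)%:R = (up_log 2 n).-1%:R + 1 :> R.
  by rewrite natr1 prednK // up_log_gt0.
rewrite mulrAC ler_pdivlMr // mulrDl mul1r; lra.
Qed.

Theorem theorem19 (R : realType) :
  (forall S : {fset plane R}, (2 <= #|` S|)%N ->
     exists P Q : seq (plane R), balanced_pair S P Q) /\
  (exists (c : cmd) (T : nat -> nat),
     finds_in_time (@balanced_pair R) c T /\
     (fun n => (T n)%:R : R^o) =O_\oo (fun n => n%:R * ln (n%:R) : R^o)).

Proof.
have h2 := @balanced_curves_correct R.
split.
  (* Existence of the curves is read off from a run of the program on an enumeration of [S]. *)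
  move=> S S2; have [s [t [_ _ h]]] := h2 S (enum_fset S) S2 (fset_uniq S) (fun=> erefl).
  by exists (output_curve s 1 2 3), (output_curve s 2 4 5).
exists balanced_curves, balanced_curves_time; split=> //.
have ln2 : 0 < ln (2 : R) by rewrite ln_gt0 // ltr1n.
have [K K0 hK] := balanced_curves_time_bound.
apply/eqO_exP; exists (K%:R * (2 / ln 2)).
  by rewrite mulr_gt0 ?ltr0n // divr_gt0.
exists 2%N => // n /= n1.
have lnn : 0 <= ln (n%:R : R) by rewrite ln_ge0 // ler1n; arith.
rewrite normr_nat normrM normr_nat (ger0_norm lnn).
apply: (@le_trans _ _ (K * (n * up_log 2 n))%N%:R); first by rewrite ler_nat hK.
rewrite !natrM -!mulrA ler_wpM2l ?ler0n //.
rewrite [leRHS](_ : _ = n%:R * (2 / ln 2 * ln n%:R)); last by ring.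
by rewrite ler_wpM2l ?ler0n // up_log_ln.
Qed.
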